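(* Let $\Omega\subseteq\mathbb{R}^n$ be open, let $\nu,C_1,\dots,C_{n-1}\in\mathcal{C}^\infty(\Omega,\mathbb{R})$, put $H:=C_{n-1}$, and let $X$ be the vector field on $\Omega$ with components $X_i=\nu\cdot\frac{\partial(C_1,\dots,C_{n-2},x_i,H)}{\partial(x_1,\dots,x_n)}$. Let $\overline{x}_e\in\mathcal{E}^{C_{n-1}}_{C_1,\dots,C_{n-2}}$ be a non-degenerate regular equilibrium point of $X$ and let $\Sigma_{\overline{x}_e}$ be the symplectic leaf through $\overline{x}_e$. Then: (a) the characteristic polynomial of the linearization $\mathfrak{L}^{X|_{\Sigma_{\overline{x}_e}}}(\overline{x}_e)$ of the restricted vector field $X|_{\Sigma_{\overline{x}_e}}$ at $\overline{x}_e$ is $\mu^2+\mathcal{I}_X(\overline{x}_e)$; (b) if $\mathcal{I}_X(\overline{x}_e)<0$, then $\overline{x}_e$ is an unstable equilibrium of $X|_{\Sigma_{\overline{x}_e}}$; (c) if $\mathcal{I}_X(\overline{x}_e)>0$, then $\overline{x}_e$ is a Lyapunov stable equilibrium of $X|_{\Sigma_{\overline{x}_e}}$; (d) if $\mathcal{I}_X(\overline{x}_e)>0$, then there exist $\varepsilon_0>0$ and a one-parameter family $\{\gamma_\varepsilon\}_{0<\varepsilon\le\varepsilon_0}\subset\Sigma_{\overline{x}_e}$ of periodic orbits of $X|_{\Sigma_{\overline{x}_e}}$ (hence of $X$) that shrink to $\overline{x}_e$ as $\varepsilon\to0$, with periods $T_\varepsilon\to 2\pi/\sqrt{\mathcal{I}_X(\overline{x}_e)}$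 as $\varepsilon\to0$; moreover $\{\overline{x}_e\}\cup\bigcup_{0<\varepsilon<\varepsilon_0}\gamma_\varepsilon$ is the connected component of $\Sigma_{\overline{x}_e}\setminus\gamma_{\varepsilon_0}$ containing $\overline{x}_e$.
   Context: $\langle\cdot,\cdot\rangle$ is the standard inner product on $\mathbb{R}^n$ and $\nabla$ the gradient. $\frac{\partial(C_1,\dots,C_{n-2},x_i,H)}{\partial(x_1,\dots,x_n)}$ is the Jacobian determinant of $(C_1,\dots,C_{n-2},x_i,H)$. $X$ is the Hamiltonian vector field of $H$ for the Poisson bracket $\{f,g\}\,\mathrm{d}x_1\wedge\dots\wedge\mathrm{d}x_n=\nu\,\mathrm{d}C_1\wedge\dots\wedge\mathrm{d}C_{n-2}\wedge\mathrm{d}f\wedge\mathrm{d}g$. A point is regular iff $\nu\neq0$ and $\nabla C_1\wedge\dots\wedge\nabla C_{n-2}\neq0$ there. For a regular point $\overline{x}_e$, the symplectic leaf $\Sigma_{\overline{x}_e}$ is the connected component containing $\overline{x}_e$ of the two-dimensional submanifold $\{\overline{x}\in\Omega: C_i(\overline{x})=C_i(\overline{x}_e)\ (i=1,\dots,n-2),\ \nu(\overline{x})\neq0,\ \nabla C_1(\overline{x})\wedge\dots\wedge\nabla C_{n-2}(\overline{x})\neq0\}$; $X$ is tangent to it. For decomposable $k$-vectors, $\langle u_1\wedge\dots\wedge u_k,v_1\wedge\dots\wedge v_k\rangle_k:=\det[\langle u_i,v_j\rangle]$. $\mathcal{E}^{C_{n-1}}_{C_1,\dots,C_{n-2}}:=\{\overline{x}\in\Omega:\nu(\overline{x})\neq0,\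 \nabla C_1\wedge\dots\wedge\nabla C_{n-2}(\overline{x})\neq0,\ \nabla C_1\wedge\dots\wedge\nabla C_{n-1}(\overline{x})=0\}$. For $\overline{x}_e$ in it, let $\overrightarrow{\lambda_e}\in\mathbb{R}^{n-2}$ be the unique vector with $\nabla H(\overline{x}_e)+\sum_i\lambda^e_i\nabla C_i(\overline{x}_e)=0$ and $F_{\overrightarrow{\lambda_e}}:=H+\sum_i\lambda^e_iC_i$; $\overline{x}_e$ is non-degenerate if $A:=\operatorname{Hess}F_{\overrightarrow{\lambda_e}}(\overline{x}_e)=\mathrm{D}(\nabla F_{\overrightarrow{\lambda_e}})(\overline{x}_e)$ is invertible, and then $\mathcal{I}_X(\overline{x}_e):=\nu^2(\overline{x}_e)\det(A)\langle A^{-1}\nabla C_1(\overline{x}_e)\wedge\dots\wedge A^{-1}\nabla C_{n-2}(\overline{x}_e),\nabla C_1(\overline{x}_e)\wedge\dots\wedge\nabla C_{n-2}(\overline{x}_e)\rangle_{n-2}$. The linearization of a vector field $Y$ at an equilibrium $m$ is $\mathfrak{L}^Y(m)v:=\frac{\mathrm{d}}{\mathrm{d}t}(\mathrm{D}F^Y_t(m)v)|_{t=0}$, $F^Y_t$ the flow; for $X|_{\Sigma_{\overline{x}_e}}$ it is an endomorphism of $T_{\overline{x}_e}\Sigma_{\overline{x}_e}$. *)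

(* Defs.v *)
From mathcomp Require Import all_boot all_order all_algebra all_classical all_reals all_analysis.
Set Implicit Arguments. Unset Strict Implicit. Unset Printing Implicit Defensive.
Import Order.TTheory GRing.Theory Num.Theory numFieldNormedType.Exports.
Local Open Scope ring_scope.
Local Open Scope classical_set_scope.

Section Defs.
Variables (R : realType) (n : nat).
Local Notation V := 'rV[R]_n.

Definition iderivs (vs : seq V) (f : V -> R) : V -> R :=
  foldr (fun v g => 'D_v g) f vs.

Definition smooth_on (Omega : set V) (f : V -> R) : Prop :=
  forall vs : seq V,
    (forall v x, Omega x -> derivable (iderivs vs f) x v) /\
    (forall x, Omega x -> {for x, continuous (iderivs vs f)}).

Definition ebasis (j : 'I_n) : V := \row_k (k == j)%:R.
Definition partial (f : V -> R) (j : 'I_n) (x : V) : R := 'D_(ebasis j) f x.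
Definition grad (f : V -> R) (x : V) : V := \row_j partial f j x.

(* The functions C_1, ..., C_{n-1} are C 0, ..., C (n-2); H := C (n-2). *)
Definition grads (k : nat) (C : nat -> V -> R) (x : V) : 'M[R]_(k, n) :=
  \matrix_(r < k, j < n) partial (C r) j x.

(* Jacobian matrix of (C_1, ..., C_{n-2}, x_i, H) at x *)
Definition jacmat (C : nat -> V -> R) (i : 'I_n) (x : V) : 'M[R]_n :=
  \matrix_(r < n, j < n)
    if (val r < n - 2)%N then partial (C r) j x
    else if (val r == n - 2)%N then (j == i)%:R
    else partial (C (n - 2)%N) j x.

Definition Xfield (nu : V -> R) (C : nat -> V -> R) (x : V) : V :=
  \row_i (nu x * \det (jacmat C i x)).

(* regular point: nu <> 0 and grad C_1 /\ ... /\ grad C_{n-2} <> 0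
   (a wedge of vectors is nonzero iff the vectors are linearly independent) *)
Definition regular (nu : V -> R) (C : nat -> V -> R) (x : V) : Prop :=
  nu x != 0 /\ row_free (grads (n - 2) C x).

Definition equil_set (Omega : set V) (nu : V -> R) (C : nat -> V -> R) : set V :=
  [set x | Omega x /\ regular nu C x /\ ~~ row_free (grads (n - 1) C x)].

(* symplectic leaf through xe: connected component containing xe of the
   regular part of the level set of the Casimirs C_1, ..., C_{n-2} *)
Definition leaf_level (Omega : set V) (nu : V -> R) (C : nat -> V -> R) (xe : V)
  : set V :=
  [set x | Omega x /\ (forall k, (k < n - 2)%N -> C k x = C k xe) /\ regular nu C x].
Definition leaf (Omega : set V) (nu : V -> R) (C : nat -> V -> R) (xe : V) : set V :=
  connected_component (leaf_level Omega nu C xe) xe.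

Definition Flam (C : nat -> V -> R) (lam : 'rV[R]_(n - 2)) (x : V) : R :=
  C (n - 2)%N x + \sum_(k < n - 2) lam 0 k * C k x.

Definition hess (f : V -> R) (x : V) : 'M[R]_n :=
  \matrix_(i < n, j < n) partial (fun y => partial f i y) j x.

(* standard inner product and the induced inner product on decomposable k-vectors *)
Definition ip (u v : V) : R := (u *m v^T) 0 0.
Definition wedge_ip (k : nat) (u v : 'I_k -> V) : R :=
  \det (\matrix_(i < k, j < k) ip (u i) (v j)).

Definition IX (nu : V -> R) (C : nat -> V -> R) (lam : 'rV[R]_(n - 2)) (xe : V) : R :=
  let A := hess (Flam C lam) xe in
  nu xe ^+ 2 * \det A *
  wedge_ip (fun i : 'I_(n - 2) => (invmx A *m (grad (C i) xe)^T)^T)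
           (fun i : 'I_(n - 2) => grad (C i) xe).

Definition sol_on (X : V -> V) (S : set V) (gam : R -> V) (T : R) : Prop :=
  (forall t : R, 0 <= t < T -> S (gam t)) /\
  (forall t : R, 0 < t < T -> is_derive t (1 : R) gam (X (gam t))) /\
  (gam t @[t --> (0 : R)^'+] --> gam 0).

Definition fwd_sol (X : V -> V) (S : set V) (gam : R -> V) : Prop :=
  (forall t : R, 0 <= t -> S (gam t)) /\
  (forall t : R, 0 < t -> is_derive t (1 : R) gam (X (gam t))) /\
  (gam t @[t --> (0 : R)^'+] --> gam 0).

Definition lyap_stable (X : V -> V) (S : set V) (xe : V) : Prop :=
  forall eps : R, 0 < eps -> exists2 del : R, 0 < del &
    forall y, S y -> `|y - xe| < del ->
      (exists gam, gam 0 = y /\ fwd_sol X S gam) /\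
      (forall (T : R) gam, gam 0 = y -> sol_on X S gam T ->
         forall t : R, 0 <= t < T -> `|gam t - xe| < eps).

Definition periodic_orbit (X : V -> V) (S : set V) (g : set V) (T : R) : Prop :=
  0 < T /\ exists c : R -> V,
    (forall t : R, S (c t)) /\
    (forall t : R, is_derive t (1 : R) c (X (c t))) /\
    (forall t : R, c (t + T) = c t) /\
    (forall s : R, 0 < s < T -> c s != c 0) /\
    g = range c.

Definition tangent (S : set V) (x : V) (v : V) : Prop :=
  exists c : R -> V, c 0 = x /\ (\forall t \near (0 : R), S (c t)) /\
    is_derive (0 : R) (1 : R) c v.

Definition local_flow (X : V -> V) (S : set V) (x : V) (phi : R -> V -> V) : Prop :=
  exists2 r : R, 0 < r & forall y, S y -> `|y - x| < r ->
    phi 0 y = y /\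
    forall t : R, `|t| < r -> S (phi t y) /\ is_derive t (1 : R) (phi ^~ y) (X (phi t y)).

(* The linearization L of X|_S at xe, L v = d/dt (D F_t(xe) v)|_{t=0},
   is represented by the 2x2 matrix M in the basis b of T_xe S:
   L (b j) = sum_i M i j b i, where D F_t(xe) v = d/ds F_t(c s)|_{s=0}
   for any curve c in S through xe with velocity v. *)
Definition linearization_matrix (X : V -> V) (S : set V) (xe : V)
  (b : 'I_2 -> V) (M : 'M[R]_2) : Prop :=
  forall phi, local_flow X S xe phi ->
  forall (j : 'I_2) (c : R -> V), c 0 = xe -> (\forall s \near (0 : R), S (c s)) ->
    is_derive (0 : R) (1 : R) c (b j) ->
    (\forall t \near (0 : R), derivable (fun s => phi t (c s)) 0 (1 : R)) /\
    is_derive (0 : R) (1 : R) (fun t => 'D_(1 : R) (fun s => phi t (c s)) 0)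
      (\sum_(i < 2) M i j *: b i).

Definition tangent_basis (S : set V) (xe : V) (b : 'I_2 -> V) : Prop :=
  (forall a : 'I_2 -> R, \sum_(i < 2) a i *: b i = 0 -> forall i, a i = 0) /\
  (forall v, tangent S xe v <-> exists a : 'I_2 -> R, v = \sum_(i < 2) a i *: b i).

End Defs.

(* Main.v *)
(* Near xe the leaf is the graph of a map over its tangent plane. In the coordinates of a basis
   (x1, x2) of that plane, X has linear part rho J Q, where Q is the Hessian of F = F_lambda
   restricted to the plane, J is the symplectic matrix and rho = nu times a Jacobian determinant.
   So the linear part is trace-free with determinant rho^2 det Q, and Jacobi's formula for
   complementary minors identifies this number with I_X.

   If I_X < 0, the quadratic form u . Bu of the linear part B grows exponentially along
   solutions. If I_X > 0, Q is definite and one can choose the basis so that Q = alpha Id and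
   B is the rotation with speed om = sqrt I_X. Then (F - F(xe)) / alpha is a first integral
   close to half the squared radius; each of its small level sets meets every ray from xe
   exactly once, hence is a closed curve around xe. X does not vanish on that curve, which is
   therefore a periodic orbit. In polar coordinates the time along it is the integral over the
   angle of a density that tends to 1 / om, whence the limit 2 pi / om of the periods.

   No inverse or implicit function theorem with smooth dependence and no flow is needed: strict
   differentiability at xe provides the chart, solutions are obtained by reparametrizing level
   curves, and the linearization follows from a Gronwall estimate. *)
Require Import Defs.
From mathcomp Require Import all_boot all_order all_algebra all_classical all_reals all_analysis.
From mathcomp Require Import perm ring lra.
Set Implicit Arguments. Unset Strict Implicit. Unset Printing Implicit Defensive.
Import Order.TTheory GRing.Theory Num.Theory numFieldNormedType.Exports.
Local Open Scope ring_scope.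
Local Open Scope classical_set_scope.

(** * Norms and the inner product *)

(** The leaf is given only as a set of points, so its regularity is expressed by estimates for pairs
    of points: [chart_strict] compares [x - y] with its tangential part up to [e * |x - y|], and
    [chart_level] does the same for the first integral. The two-point form makes the first integral
    increase along rays and makes the radius of a level curve Lipschitz in the angle; a one-point
    expansion at [xe] would give neither.

    The field sees [H] only modulo the Casimirs, because its determinant does not change when
    multiples of their gradients are added to the last row. So [H] may be replaced by [F], whose
    gradient vanishes at [xe], and the linear part of the field involves only the Hessian of [F].

    A level curve is at first just a Lipschitz graph over the angle. It becomes differentiable
    because one scalar component of its velocity can be computed and the conserved quantities fix
    the direction. Since [lyap_stable] asks for a solution and for the confinement of all solutions,
    the former comes from the periodic orbits and the latter from the conservation of [F]. *)

Lemma near_ballE (R : numFieldType) (V : normedModType R) (x : V) (P : V -> Prop) :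
  (\forall y \near x, P y) <->
  exists2 d : R, 0 < d & forall y, `|y - x| < d -> P y.
Proof.
split=> [/nbhs_normP[d /= d0 dP]|[d d0 dP]].
  by exists d => // y yx; apply: dP => /=; rewrite /ball_ /= distrC.
by apply/nbhs_normP; exists d => //= y; rewrite /ball_ /= distrC; apply: dP.
Qed.

Lemma continuous_forP (R : numFieldType) (V W : normedModType R) (f : V -> W) (p : V) :
  {for p, continuous f} <-> forall e, 0 < e ->
    exists2 d : R, 0 < d & forall x, `|x - p| < d -> `|f x - f p| <= e.
Proof.
split=> [/cvgrPdist_le cv e e0|H].
  have /near_ballE[d d0 dH] : \forall x \near p, `|f p - f x| <= e by exact: (cv _ e0).
  by exists d => // x /dH; rewrite distrC.
have : f x @[x --> p] --> f p; last exact.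
apply/cvgrPdist_le => e e0; have [d d0 dH] := H _ e0.
by apply/near_ballE; exists d => // x /dH; rewrite distrC.
Qed.

(** Clearing the denominator makes the estimate trivial at [h = 0], so that derivatives can be read
    off from bounds on increments and conversely. *)
Lemma is_deriveP (R : numFieldType) (W : normedModType R) (c : R -> W) (t : R) (v : W) :
  is_derive t 1 c v <->
  forall e, 0 < e -> exists2 d : R, 0 < d &
    forall h : R, `|h| < d -> `|c (t + h) - c t - h *: v| <= e * `|h|.
Proof.
have growth : is_derive t 1 c v <->
    (h^-1 *: ((c \o shift t) (h *: 1) - c t) @[h --> 0^']) --> v.
  split=> [[+ <-]//|cv]; split; first by apply/cvg_ex; exists v.
  exact: cvg_lim.
have E h : h != 0 -> v - h^-1 *: ((c \o shift t) (h *: 1) - c t) =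
    - (h^-1 *: (c (t + h) - c t - h *: v)).
  move=> h0; rewrite /= [h *: 1]mulr1 [in RHS]scalerBr [in RHS]scalerA mulVf//.
  by rewrite scale1r opprB [h + t]addrC.
rewrite growth; split=> [/cvgrPdist_le cv e e0|H]; last first.
  apply/cvgrPdist_le => e e0; have [d d0 dH] := H _ e0.
  near=> h.
  have h0 : h != 0 by near: h; exact: nbhs_dnbhs_neq.
  rewrite E// normrN normrZ normfV ler_pdivrMl ?normr_gt0// mulrC.
  by apply: dH; near: h; exact: dnbhs0_lt.
have /near_ballE[d d0 dH] : \forall h \near (0 : R),
    h != 0 -> `|v - h^-1 *: ((c \o shift t) (h *: 1) - c t)| <= e.
  exact: (cv _ e0).
exists d => // h hd; have [->|h0] := eqVneq h 0.
  by rewrite addr0 subrr scale0r subrr !normr0 mulr0.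
have := dH h; rewrite subr0 => /(_ hd h0).
by rewrite E// normrN normrZ normfV ler_pdivrMl ?normr_gt0// mulrC.
Unshelve. all: by end_near. Qed.

Section ip.
Context {R : realType} {n : nat}.
Local Notation V := 'rV[R]_n.
Implicit Types u v w : V.

Lemma ipE u v : ip u v = \sum_j u 0 j * v 0 j.
Proof. by rewrite /ip mxE; apply: eq_bigr => j _; rewrite !mxE. Qed.

Lemma ipC u v : ip u v = ip v u.
Proof. by rewrite !ipE; apply: eq_bigr => j _; rewrite mulrC. Qed.

Lemma ipDr u v w : ip u (v + w) = ip u v + ip u w.
Proof. by rewrite /ip linearD mulmxDr mxE. Qed.

Lemma ipZr u a v : ip u (a *: v) = a * ip u v.
Proof. by rewrite /ip linearZ -scalemxAr mxE. Qed.

Lemma ipNr u v : ip u (- v) = - ip u v.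
Proof. by rewrite /ip linearN mulmxN mxE. Qed.

Lemma ipBr u v w : ip u (v - w) = ip u v - ip u w.
Proof. by rewrite ipDr ipNr. Qed.

Lemma ip0r u : ip u 0 = 0.
Proof. by rewrite /ip linear0 mulmx0 mxE. Qed.

Lemma ipDl u v w : ip (u + v) w = ip u w + ip v w.
Proof. by rewrite ![ip _ w]ipC ipDr. Qed.

Lemma ipZl a u v : ip (a *: u) v = a * ip u v.
Proof. by rewrite ![ip _ v]ipC ipZr. Qed.

Lemma ipNl u v : ip (- u) v = - ip u v.
Proof. by rewrite ![ip _ v]ipC ipNr. Qed.

Lemma ipBl u v w : ip (u - v) w = ip u w - ip v w.
Proof. by rewrite ![ip _ w]ipC ipBr. Qed.

Lemma ip0l u : ip 0 u = 0.
Proof. by rewrite ipC ip0r. Qed.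

Lemma ip_ebasis u j : ip u (ebasis R j) = u 0 j.
Proof.
rewrite ipE (bigD1 j)//= mxE eqxx mulr1 big1 ?addr0// => k kj.
by rewrite mxE (negPf kj) mulr0.
Qed.

End ip.

Section norm.
Context {R : realType}.

Lemma ler_mx_norm m n (A : 'M[R]_(m, n)) i j : `|A i j| <= `|A|.
Proof.
rewrite [leRHS]/Num.Def.normr /= mx_normrE; apply/bigmax_geP; right => /=.
by exists (i, j).
Qed.

Lemma mx_norm_le m n (A : 'M[R]_(m, n)) (M : R) :
  0 <= M -> (forall i j, `|A i j| <= M) -> `|A| <= M.
Proof.
move=> M0 AM; rewrite [leLHS]/Num.Def.normr /= mx_normrE; apply/bigmax_leP; split=> //= -[i j] _; exact: AM.
Qed.

(** The norm is the largest absolute value of an entry; this is where the factor [n] comes from,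
    here and in [ip_norm_le]. *)
Lemma mulmx_norm_le m n p (A : 'M[R]_(m, n)) (B : 'M[R]_(n, p)) :
  `|A *m B| <= n%:R * `|A| * `|B|.
Proof.
apply: mx_norm_le => [|i j]; first by rewrite !mulr_ge0.
rewrite mxE (le_trans (ler_norm_sum _ _ _))//.
apply: (@le_trans _ _ (\sum_(k < n) `|A| * `|B|)).
  by apply: ler_sum => k _; rewrite normrM ler_pM// ler_mx_norm.
by rewrite sumr_const card_ord -mulrA mulr_natl.
Qed.

Lemma ip_norm_le n (u v : 'rV[R]_n) : `|ip u v| <= n%:R * `|u| * `|v|.
Proof.
rewrite ipE (le_trans (ler_norm_sum _ _ _))//.
apply: (@le_trans _ _ (\sum_(k < n) `|u| * `|v|)).
  by apply: ler_sum => k _; rewrite normrM ler_pM// ler_mx_norm.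
by rewrite sumr_const card_ord -mulrA mulr_natl.
Qed.

Lemma ip_bounded n (u : 'rV[R]_n) :
  exists2 K : R, 0 < K & forall v, `|ip u v| <= K * `|v|.
Proof.
exists (n%:R * `|u| + 1) => [|v]; first by rewrite ltr_wpDl ?mulr_ge0.
by rewrite (le_trans (ip_norm_le _ _))// ler_wpM2r// lerDl.
Qed.

Lemma is_derive_ip n (u : 'rV[R]_n) (c : R -> 'rV[R]_n) (t : R) v :
  is_derive t 1 c v -> is_derive t 1 (fun s => ip u (c s)) (ip u v).
Proof.
move=> /is_deriveP cv; apply/is_deriveP => e e0.
have [K K0 uK] := ip_bounded u.
have [d d0 dH] := cv (e / K) ltac:(by rewrite divr_gt0).
exists d => // h /dH hd.
rewrite -ipBr -[h *: _]ipZr -ipBr (le_trans (uK _))// -ler_pdivlMl//.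
by rewrite mulrA [K^-1 * _]mulrC.
Qed.

End norm.

(** * Strict differentiability and local surjectivity *)

Lemma is_derive_line (R : realType) (V : normedModType R) (f : V -> R) (z v : V) (t : R) :
  derivable f (z + t *: v) v ->
  is_derive t 1 (fun s : R => f (z + s *: v)) ('D_v f (z + t *: v)).
Proof.
have E : (fun h : R => h^-1 *: (((fun s : R => f (z + s *: v)) \o shift t) (h *: 1) -
    f (z + t *: v))) = (fun h => h^-1 *: ((f \o shift (z + t *: v)) (h *: v) - f (z + t *: v))).
  by apply/funext => h /=; rewrite [h *: 1]mulr1 scalerDl addrCA.
by move=> df; split; rewrite /derivable /derive E.
Qed.

Lemma MVT_line (R : realType) (V : normedModType R) (f : V -> R) (z v : V) (s : R) :
  (forall t, Num.min 0 s <= t <= Num.max 0 s -> derivable f (z + t *: v) v) ->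
  exists2 t, Num.min 0 s <= t <= Num.max 0 s &
    f (z + s *: v) - f z = s * 'D_v f (z + t *: v).
Proof.
move=> fd; pose g t := f (z + t *: v).
have gd t : Num.min 0 s <= t <= Num.max 0 s -> is_derive t 1 g ('D_v f (z + t *: v)).
  by move=> /fd; exact: is_derive_line.
have gc : {within `[Num.min 0 s, Num.max 0 s], continuous g}.
  apply: derivable_within_continuous => t; rewrite in_itv /= => /gd []//.
have mM : Num.min 0 s <= Num.max 0 s by rewrite le_max ge_min lexx.
have [t tI E] := MVT_segment mM (fun x xI => gd x (subset_itv_oo_cc xI)) gc.
exists t; first by move: tI; rewrite in_itv.
have g0 : f z = g 0 by rewrite /g scale0r addr0.
rewrite g0 -/(g s); case: (leP 0 s) E => s0 E; first by rewrite E subr0 mulrC.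
by apply: oppr_inj; rewrite opprB E sub0r mulrN mulrC.
Qed.

Section strict_diff.
Context {R : realType} {n : nat}.
Local Notation V := 'rV[R]_n.
Implicit Types (f : V -> R) (p g x y : V).

(** For [y = p] this is Fréchet differentiability. Letting both points move gives the strength of a
    continuous derivative at the single point [p]. *)
Definition strict_diff f p g := forall e : R, 0 < e ->
  exists2 d : R, 0 < d & forall x y, `|x - p| < d -> `|y - p| < d ->
    `|f x - f y - ip g (x - y)| <= e * `|x - y|.

(* Telescoping along the polygonal path that changes one coordinate at a time. *)
Lemma C1_strict_diff f p (r : R) : 0 < r ->
  (forall j x, `|x - p| < r -> derivable f x (ebasis R j)) ->
  (forall j, {for p, continuous (partial f j)}) -> strict_diff f p (grad f p).
Proof.
move=> r0 fd fc e e0.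
have e'0 : 0 < e / n.+1%:R by rewrite divr_gt0.
have /near_ballE[d1 d10 d1H] : \forall x \near p, forall j : 'I_n,
    `|partial f j p - partial f j x| <= e / n.+1%:R.
  have H (j : 'I_n) : \forall x \near p, `|partial f j p - partial f j x| <= e / n.+1%:R.
    by have /cvgrPdist_le := fc j; apply.
  exact: filter_forall H.
exists (Num.min d1 r) => [|x y]; first by rewrite lt_min d10.
rewrite !lt_min => /andP[xd xr] /andP[yd yr].
pose z k : V := \row_j (if (j < k)%N then x 0 j else y 0 j).
have -> : f x - f y = \sum_(k < n) (f (z k.+1) - f (z k)).
  rewrite -(big_mkord xpredT (fun k => f (z k.+1) - f (z k))) telescope_sumr//.
  by congr (f _ - f _); apply/rowP => j; rewrite mxE ?ltn_ord// ltn0.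
rewrite ipE -sumrB (le_trans (ler_norm_sum _ _ _))//.
apply: (@le_trans _ _ (\sum_(k < n) (e / n.+1%:R * `|x - y|))); last first.
  rewrite sumr_const card_ord -[leLHS]mulr_natl mulrA ler_wpM2r// mulrCA -ler_pdivlMl//.
  by rewrite mulVf ?gt_eqF// ler_pdivrMr// mul1r ler_nat.
apply: ler_sum => k _; pose s := x 0 k - y 0 k.
have zS : z k.+1 = z k + s *: ebasis R k.
  apply/rowP => j; rewrite !mxE ltnS leq_eqVlt val_eqE.
  have [->|jk] := eqVneq j k; first by rewrite ltnn mulr1 addrC subrK.
  by rewrite mulr0 addr0.
(* Each coordinate of an intermediate point lies between those of [x] and [y], so in the sup norm
   the path stays as close to [p] as the farther endpoint. *)
have mid t : Num.min 0 s <= t <= Num.max 0 s ->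
    `|z k + t *: ebasis R k - p| <= Num.max `|x - p| `|y - p|.
  move=> tI; apply: mx_norm_le => [|i j]; first by rewrite le_max normr_ge0.
  rewrite {i}ord1 !mxE; have xj := ler_mx_norm (x - p) 0 j.
  have yj := ler_mx_norm (y - p) 0 j; rewrite !mxE in xj yj.
  have [jk|jk] := eqVneq j k; last first.
    by rewrite mulr0 addr0 le_max; case: ifP => _; rewrite ?xj ?yj ?orbT.
  rewrite jk ltnn mulr1 in xj yj *; rewrite le_max.
  move: tI xj yj; rewrite /s ge_min le_max !ler_norml.
  move: (`|x - p|) (`|y - p|) => A B; move: (x 0 k) (y 0 k) (p 0 k) => a b c.
  clear; by move=> /andP[/orP[] ? /orP[] ?] /andP[? ?] /andP[? ?];
    case: (leP A B) => ?; apply/orP; [right|left|right|left|right|left|right|left];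
    apply/andP; split; lra.
have fdk t : Num.min 0 s <= t <= Num.max 0 s ->
    derivable f (z k + t *: ebasis R k) (ebasis R k).
  by move=> /mid tI; apply: fd; apply: le_lt_trans tI _; rewrite gt_max xr.
have [t tI E] := MVT_line fdk.
rewrite zS E !mxE -/s -/(partial f k _) [partial f k p * _]mulrC -mulrBr normrM mulrC.
apply: ler_pM => //; last by have := ler_mx_norm (x - y) 0 k; rewrite !mxE.
rewrite distrC; apply: d1H; apply: le_lt_trans (mid t tI) _; first by rewrite gt_max xd.
Qed.

Lemma strict_diff_curve f p g (c : R -> V) (t : R) v : c t = p -> strict_diff f p g ->
  is_derive t 1 c v -> is_derive t 1 (f \o c) (ip g v).
Proof.
move=> <- fg /is_deriveP cv; apply/is_deriveP => e e0.
have [K K0 gK] := ip_bounded g.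
pose M : R := `|v| + 1.
have M0 : 0 < M by rewrite ltr_wpDl.
have [d d0 dH] := fg (e / (2 * M)) ltac:(by rewrite divr_gt0// mulr_gt0).
have [d1 d10 d1H] := cv (Num.min 1 (e / (2 * K)))
  ltac:(by rewrite lt_min ltr01 divr_gt0// mulr_gt0).
exists (Num.min d1 (d / M)) => [|h]; first by rewrite lt_min d10 divr_gt0.
rewrite lt_min => /andP[/d1H cd hd].
have cL : `|c (t + h) - c t| <= M * `|h|.
  rewrite -[_ - _](subrK (h *: v)) (le_trans (ler_normD _ _))//.
  rewrite /M mulrDl addrC lerD ?normrZ 1?mulrC//.
  by rewrite mulrC (le_trans cd)// ler_wpM2r// ge_min lexx.
have cd1 : `|c (t + h) - c t| < d.
  by rewrite (le_lt_trans cL)// mulrC -ltr_pdivlMr.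
have := dH _ (c t) cd1; rewrite subrr normr0 => /(_ d0) fd.
have -> : (f \o c) (t + h) - (f \o c) t - h *: ip g v =
    (f (c (t + h)) - f (c t) - ip g (c (t + h) - c t)) +
    ip g (c (t + h) - c t - h *: v).
  rewrite [ip g (_ - h *: v)]ipBr ipZr /= -[h *: ip g v]/(h * ip g v); ring.
rewrite (le_trans (ler_normD _ _))// [e]splitr mulrDl; apply: lerD.
  apply: le_trans fd _; apply: (le_trans (ler_wpM2l _ cL)).
    by rewrite divr_ge0 ?mulr_ge0 ?ltW.
  by rewrite mulrA ler_wpM2r// invfM mulrA divfK ?gt_eqF.
apply: le_trans (gK _) _; apply: le_trans (ler_wpM2l (ltW K0) cd) _.
rewrite mulrA ler_wpM2r//.
rewrite -ler_pdivlMl// ge_min; apply/orP; right.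
by rewrite (_ : e / (2 * K) = K^-1 * (e / 2))//; field; rewrite gt_eqF.
Qed.

End strict_diff.

Section strict_diffV.
Context {R : realType} {n : nat}.
Local Notation V := 'rV[R]_n.

(** Vectors are rows and [M] acts on the right, so [M] is the transpose of the Jacobian matrix. *)
Definition strict_diffV (F : V -> V) (p : V) (M : 'M[R]_n) := forall e : R, 0 < e ->
  exists2 d : R, 0 < d & forall x y, `|x - p| < d -> `|y - p| < d ->
    `|F x - F y - (x - y) *m M| <= e * `|x - y|.

Lemma strict_diffV_coord (F : V -> V) p (M : 'M[R]_n) :
  (forall j, strict_diff (fun x => F x 0 j) p (row j M^T)) -> strict_diffV F p M.
Proof.
move=> FM e e0.
have /boolp.choice[d dP] : forall j, exists d : R, 0 < d /\
    forall x y, `|x - p| < d -> `|y - p| < d ->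
    `|F x 0 j - F y 0 j - ip (row j M^T) (x - y)| <= e * `|x - y|.
  by move=> j; have [d d0 dH] := FM j e e0; exists d.
exists (\big[Num.min/1]_j d j).
  by apply/bigmin_gtP; split=> // j _; case: (dP j).
move=> x y /bigmin_gtP[_ xd] /bigmin_gtP[_ yd].
apply: mx_norm_le => [|i j]; first by rewrite mulr_ge0 ?(ltW e0).
rewrite ord1; have := (dP j).2 _ _ (xd j isT) (yd j isT).
suff -> : (F x - F y - (x - y) *m M) 0 j = F x 0 j - F y 0 j - ip (row j M^T) (x - y) by [].
rewrite !mxE ipE; congr (_ - _); apply: eq_bigr => k _.
by rewrite !mxE mulrC.
Qed.

Lemma mulmxr_bounded (N : 'M[R]_n) :
  exists2 k : R, 0 < k & forall v : V, `|v *m N| <= k * `|v|.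
Proof.
exists (n%:R * `|N| + 1) => [|v]; first by rewrite ltr_wpDl ?mulr_ge0.
rewrite (le_trans (mulmx_norm_le _ _))// mulrAC ler_wpM2r//.
by rewrite lerDl.
Qed.

(** After composition with the inverse of [M] the map differs from the identity by a map with
    Lipschitz constant 1/2. Minimize the distance [G] to the target over a compact ball: a Newton
    step from the minimizer would halve [G], so the minimum is 0. *)
Lemma strict_diffV_locally_onto (F : V -> V) p (M : 'M[R]_n) :
  strict_diffV F p M -> M \in unitmx ->
  exists K r : R, [/\ 0 < K, 0 < r & forall z, `|z - F p| < r ->
    exists2 x, F x = z & `|x - p| <= K * `|z - F p|].
Proof.
move=> FM Mu; pose N := invmx M; have [k k0 kP] := mulmxr_bounded N.
have [d d0 dH] := FM (1 / (2 * k)) ltac:(by rewrite divr_gt0// mulr_gt0).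
pose Phi x := F x *m N.
have PhiP x y : `|x - p| < d -> `|y - p| < d ->
    `|Phi x - Phi y - (x - y)| <= 2^-1 * `|x - y|.
  move=> xd yd; have -> : Phi x - Phi y - (x - y) = (F x - F y - (x - y) *m M) *m N.
    by rewrite !mulmxBl !mulmxK.
  apply: le_trans (kP _) _; apply: le_trans (ler_wpM2l (ltW k0) (dH _ _ xd yd)) _.
  by rewrite mulrA (_ : k * _ = 2^-1)//; field; rewrite gt_eqF.
have PhiL x y : `|x - p| < d -> `|y - p| < d ->
    `|x - y| <= 2 * `|Phi x - Phi y| /\ `|Phi x - Phi y| <= 2 * `|x - y|.
  move=> xd yd; have := PhiP x y xd yd.
  have := ler_normB (Phi x - Phi y) (Phi x - Phi y - (x - y)); rewrite subKr.
  have := ler_normD (Phi x - Phi y - (x - y)) (x - y); rewrite subrK.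
  move: (`|x - y|) (`|Phi x - Phi y|) (`|Phi x - Phi y - (x - y)|) => A B C.
  by move=> ? ? ?; split; lra.
pose r := d / 2; have r0 : 0 < r by rewrite divr_gt0.
have rd : r < d by rewrite /r; lra.
(* The minimizer lies within [4 * G p] of [p] and the Newton step adds at most [G p]; with
   [G p <= r / 5] both points stay in the ball of radius [r]. *)
exists (4 * k), (r / (5 * k)); split; [by rewrite mulr_gt0|by rewrite divr_gt0// mulr_gt0|].
move=> z zr; pose G x := `|Phi x - z *m N|.
pose A := closed_ball p r.
have AE x : A x <-> `|x - p| <= r.
  by rewrite /A closed_ballE//= /closed_ball_ /= distrC.
have pd : `|p - p| < d by rewrite subrr normr0.
have Gc : {within A, continuous G}.
  apply: continuous_in_subspaceT => x; rewrite inE => /AE xr.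
  have xd : `|x - p| < d by exact: le_lt_trans rd.
  apply/continuous_forP => e e0.
  exists (Num.min (d - `|x - p|) (e / 2)) => [|y].
    by rewrite lt_min subr_gt0 xd divr_gt0.
  rewrite lt_min => /andP[yx ye].
  have yd : `|y - p| < d.
    by rewrite -[y](subrK x) -addrA (le_lt_trans (ler_normD _ _))// -ltrBrDr.
  rewrite (le_trans (ler_dist_dist _ _))// opprB addrA subrK.
  apply: le_trans (PhiL y x yd xd).2 _.
  by rewrite -ler_pdivlMl// mulrC ltW.
have cA : compact A.
  apply: bounded_closed_compact; last exact: closed_ball_closed.
  exists (`|p| + r); split; first exact: num_real.
  move=> M' MM x /AE xr; apply: ltW; apply: le_lt_trans MM.
  by rewrite -[x](subrK p) addrC (le_trans (ler_normD _ _))// lerD2l.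
have [x] := EVT_min_rV (ex_intro A p ((AE p).2 ltac:(by rewrite subrr normr0 ltW))) cA Gc.
rewrite inE => /AE xr Gmin.
have xd : `|x - p| < d by exact: le_lt_trans rd.
have Gp : G p <= k * `|z - F p|.
  by rewrite /G -mulmxBl distrC (le_trans (kP _))// distrC.
have kz : k * `|z - F p| <= r / 5.
  rewrite -ler_pdivlMl//; apply: ltW; rewrite (_ : k^-1 * (r / 5) = r / (5 * k))//.
  by field; rewrite gt_eqF.
have GxGp : G x <= G p by apply: Gmin; rewrite inE; apply/AE; rewrite subrr normr0 ltW.
have xp : `|x - p| <= 4 * G p.
  apply: le_trans (PhiL x p xd pd).1 _.
  have := ler_normB (Phi x - z *m N) (Phi p - z *m N); rewrite -/(G x) -/(G p).
  rewrite opprB addrA subrK; move: GxGp; move: (`| _ - _ |) (G x) (G p).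
  by move=> a b c ? ?; lra.
pose x' := x + (z *m N - Phi x).
have x'r : `|x' - p| <= r.
  rewrite /x' addrAC (le_trans (ler_normD _ _))// [X in _ + X]distrC -/(G x).
  by move: xp GxGp Gp kz; move: (`| _ |) (G x) (G p) (k * _) => ? ? ? ?; lra.
have x'd : `|x' - p| < d by exact: le_lt_trans rd.
have Gx' : G x' <= 2^-1 * G x.
  have := PhiP x' x x'd xd; rewrite /x' [x + _]addrC addrK opprB addrA subrK.
  by rewrite [`|z *m N - _|]distrC.
have Gx0 : G x = 0.
  have : G x <= G x' by apply: Gmin; rewrite inE; apply/AE.
  have : 0 <= G x by exact: normr_ge0.
  by move: Gx'; move: (G x) (G x') => a b ? ? ?; lra.
exists x; last by apply: le_trans xp _; rewrite -mulrA ler_wpM2l.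
move/eqP: Gx0; rewrite normr_eq0 subr_eq0 => /eqP H.
by rewrite -[F x](mulmxK Mu) -[F x *m M]/(F x *m M) -mulmxA mulmxV// mulmx1 -[F x](mulmxKV Mu) -/(Phi x) H mulmxKV.
Qed.

(** The error may involve the unknown increment of [c] itself. Since [M] is invertible, a first use
    with a small constant absorbs that term and gives a Lipschitz bound [L] at [t]; a second use
    then gives the derivative. *)
Lemma is_derive_preimage (c : R -> V) (t : R) (w : V) (M : 'M[R]_n) : M \in unitmx ->
  (forall e, 0 < e -> exists2 d : R, 0 < d & forall h : R, `|h| < d ->
    `|(c (t + h) - c t) *m M - h *: w| <= e * (`|c (t + h) - c t| + `|h|)) ->
  is_derive t 1 c (w *m invmx M).
Proof.
move=> Mu H; pose N := invmx M; have [k k0 kP] := mulmxr_bounded N.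
pose D h := c (t + h) - c t.
have DE h : D h - h *: (w *m N) = (D h *m M - h *: w) *m N.
  by rewrite mulmxBl mulmxK// scalemxAl.
pose L : R := 2 * `|w *m N| + 1.
have L0 : 0 < L by rewrite ltr_wpDl ?mulr_ge0.
have [d1 d10 d1H] := H (1 / (2 * k)) ltac:(by rewrite divr_gt0// mulr_gt0).
apply/is_deriveP => e e0.
have kL : 0 < k * (L + 1) by rewrite mulr_gt0// addr_gt0.
have [d2 d20 d2H] := H (e / (k * (L + 1))) ltac:(by rewrite divr_gt0).
exists (Num.min d1 d2) => [|h]; first by rewrite lt_min d10.
rewrite lt_min => /andP[/d1H h1 /d2H h2]; rewrite -/(D h) in h1 h2 *.
have DL : `|D h| <= L * `|h|.
  have : `|D h - h *: (w *m N)| <= 2^-1 * (`|D h| + `|h|).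
    rewrite DE; apply: le_trans (kP _) _; apply: le_trans (ler_wpM2l (ltW k0) h1) _.
    by rewrite mulrA (_ : k * _ = 2^-1)//; field; rewrite gt_eqF.
  have := ler_normD (D h - h *: (w *m N)) (h *: (w *m N)); rewrite subrK normrZ.
  have -> : L * `|h| = 2 * (`|h| * `|w *m N|) + `|h| by rewrite /L; ring.
  by move=> ? ?; lra.
rewrite DE; apply: le_trans (kP _) _; apply: le_trans (ler_wpM2l (ltW k0) h2) _.
apply: (@le_trans _ _ (k * (e / (k * (L + 1)) * ((L + 1) * `|h|)))).
  rewrite !ler_wpM2l ?(ltW k0) ?divr_ge0 ?(ltW e0) ?(ltW kL)//.
  by rewrite mulrDl mul1r lerD2r.
rewrite (_ : k * _ = e * `|h|)//; have := gt_eqF kL; rewrite mulf_eq0 => /norP[kn Ln]; field; rewrite ?kn ?Ln//.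
Qed.

End strict_diffV.

(** * First hitting times of continuous functions *)

Section first_hit.
Context {R : realType}.
Implicit Types (E : R -> R) (a b t : R).

Lemma within_itvP E a b : {within `[a, b], continuous E} ->
  forall x, a <= x <= b -> forall e, 0 < e -> exists2 d : R, 0 < d &
    forall y, a <= y <= b -> `|y - x| < d -> `|E y - E x| < e.
Proof.
move=> /subspace_continuousP Ec x xab e e0.
have /cvgrPdist_lt/(_ _ e0) := Ec x ltac:(by rewrite /= in_itv).
rewrite near_withinE => /near_ballE[d d0 dH]; exists d => // y yab yx.
by rewrite distrC; apply: dH => //=; rewrite in_itv.
Qed.

(** Turns estimates that hold only inside a ball into confinement: a curve that leaves meets the
    sphere at a first time, and the estimates are valid up to then. *)
Lemma first_hit E t b : 0 <= t -> {within `[0, t], continuous E} ->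
  E 0 < b -> b <= E t ->
  exists t1, [/\ 0 < t1 <= t, E t1 = b & forall s, 0 <= s < t1 -> E s < b].
Proof.
move=> t0 /within_itvP Ec E0 Et.
pose A := [set s | 0 <= s <= t /\ b <= E s].
have At : A t by rewrite /A /= t0 lexx.
have lbA : lbound A 0 by move=> s [/andP[]].
have hiA : has_inf A by split; [exists t|exists 0].
pose t1 := inf A.
have t10 : 0 <= t1 by apply: lb_le_inf => //; exists t.
have t1t : t1 <= t by apply: ge_inf => //; exists 0.
have t1I : 0 <= t1 <= t by rewrite t10.
have low s : 0 <= s < t1 -> E s < b.
  move=> /andP[s0 st]; rewrite ltNge; apply/negP => bs.
  have : t1 <= s by apply: ge_inf; [exists 0|split=> //; rewrite s0 (le_trans (ltW st))].
  by rewrite leNgt st.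
have bE : b <= E t1.
  rewrite leNgt; apply/negP => Eb.
  have [d d0 dH] := Ec _ t1I (b - E t1) ltac:(by rewrite subr_gt0).
  have [a [aI ba] ad] := inf_adherent d0 hiA.
  have t1a : t1 <= a by apply: ge_inf => //; exists 0.
  have := dH a aI; rewrite ger0_norm ?subr_ge0// ltrBlDl => /(_ ad).
  by move=> /(le_lt_trans (ler_norm _)); rewrite ltrD2r ltNge ba.
have t1p : 0 < t1.
  by rewrite lt_neqAle t10 andbT; apply/eqP => t1E; move: bE; rewrite -t1E leNgt E0.
exists t1; split=> //; first by rewrite t1p.
apply/eqP; rewrite eq_le bE andbT leNgt; apply/negP => Eb.
have [d d0 dH] := Ec _ t1I (E t1 - b) ltac:(by rewrite subr_gt0).
pose s := Num.max 0 (t1 - d / 2).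
have s0 : 0 <= s by rewrite le_max lexx.
have st1 : s < t1 by rewrite gt_max t1p ltrBlDr ltrDl divr_gt0.
have : `|E s - E t1| < E t1 - b.
  apply: dH; first by rewrite s0 (le_trans (ltW st1)).
  rewrite ltr0_norm ?subr_lt0// opprB ltrBlDr -ltrBlDl /s lt_max; apply/orP; right.
  by rewrite ltrD2l ltrN2; lra.
rewrite distrC => /(le_lt_trans (ler_norm _)); rewrite ltrD2l ltrN2 ltNge ltW//.
by apply: low; rewrite s0.
Qed.

End first_hit.

(** * Determinants and dual frames of the tangent plane *)

Section jacobi.
Context {R : comUnitRingType}.

Lemma det_mx2 (A : 'M[R]_2) : \det A = A 0 0 * A 1 1 - A 0 1 * A 1 0.
Proof.
rewrite (expand_det_row _ 0) big_ord_recl big_ord1 /cofactor !det_mx11 !mxE /=.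
rewrite (_ : lift 0 0 = 1); last exact/val_inj.
rewrite (_ : lift 1 0 = 0); last exact/val_inj.
by rewrite expr0 expr1 mul1r mulN1r mulrN.
Qed.

(** Replace the last two columns of the identity by those of [Q]. Multiplying [W] by this matrix
    gives a block lower triangular one whose determinant is the leading minor of [W], while the
    determinant of the factor is the trailing minor of [Q]. *)
Lemma jacobi_minor2 k n (W Q : 'M[R]_n) (f : 'I_k -> 'I_n) (i1 i2 : 'I_n) :
  n = (k + 2)%N -> (forall i, val (f i) = val i) -> val i1 = k -> val i2 = k.+1 ->
  W *m Q = 1%:M ->
  \det (\matrix_(i < k, j < k) W (f i) (f j)) =
  \det W * (Q i1 i1 * Q i2 i2 - Q i1 i2 * Q i2 i1).
Proof.
move=> nk; move: W Q f i1 i2; rewrite nk => W Q f i1 i2 fi i1k i2k WQ.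
have -> : (\matrix_(i < k, j < k) W (f i) (f j)) = ulsubmx W.
  by apply/matrixP => i j; rewrite !mxE; congr (W _ _); apply/val_inj; rewrite fi.
have e1 : i1 = rshift k 0 by apply/val_inj; rewrite i1k /= addn0.
have e2 : i2 = rshift k 1 by apply/val_inj; rewrite i2k /= addn1.
have -> : Q i1 i1 * Q i2 i2 - Q i1 i2 * Q i2 i1 = \det (drsubmx Q).
  by rewrite det_mx2 !mxE e1 e2.
have E : W *m block_mx 1%:M (ursubmx Q) 0 (drsubmx Q) =
    block_mx (ulsubmx W) 0 (dlsubmx W) 1%:M.
  move: WQ; rewrite -[W in LHS]submxK -[Q in LHS]submxK mulmx_block.
  rewrite scalar_mx_block => /eq_block_mx[_ E12 _ E22].
  by rewrite -[W in LHS]submxK mulmx_block !mulmx1 !mulmx0 !addr0 E12 E22.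
have := congr1 determinant E.
by rewrite det_mulmx det_ublock det_lblock !det1 mul1r mulr1 => ->.
Qed.

End jacobi.

Section bmx.
Context {R : realType} {n : nat} (n2 : (2 <= n)%N).
Local Notation V := 'rV[R]_n.
Implicit Types (a : nat -> V) (m l v : V).

(** With the Casimir gradients as [a], this is both the Jacobian matrix behind the field and the
    matrix of a frame. Its determinant is an alternating form in [(m1, m2)] that vanishes as soon as
    one argument is some [a k] with [k < n - 2]. *)
Definition bmx a m1 m2 : 'M[R]_n := \matrix_(r < n)
  if (r < n - 2)%N then a r else if (r == n - 2 :> nat)%N then m1 else m2.

Lemma bmx_ltn1 : (n - 2 < n)%N. Proof. by rewrite ltn_subrL (leq_trans _ n2). Qed.
Lemma bmx_ltn2 : (n - 1 < n)%N. Proof. by rewrite ltn_subrL (leq_trans _ n2). Qed.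
Definition bmx_i1 := Ordinal bmx_ltn1.
Definition bmx_i2 := Ordinal bmx_ltn2.

Lemma bmx_n1E : (n - 1)%N = (n - 2).+1.
Proof. by rewrite -subSn// subSS. Qed.

Lemma bmx_i12 : bmx_i1 != bmx_i2.
Proof. by rewrite -val_eqE /= bmx_n1E ltn_eqF. Qed.

Lemma bmx_ordP (r : 'I_n) : [\/ (r < n - 2)%N, r = bmx_i1 | r = bmx_i2].
Proof.
have [rn|rn] := ltnP r (n - 2); first exact: Or31.
have : (r < (n - 2).+2)%N by rewrite -bmx_n1E -subSn ?(leq_trans _ n2)// subSS subn0.
rewrite ltnS leq_eqVlt => /orP[/eqP rE|]; first by apply: Or33; apply/val_inj; rewrite /= rE bmx_n1E.
by rewrite ltnS => r1; apply: Or32; apply/val_inj/eqP; rewrite eqn_leq r1.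
Qed.

Lemma row_bmx a m1 m2 r : row r (bmx a m1 m2) =
  if (r < n - 2)%N then a r else if (r == n - 2 :> nat)%N then m1 else m2.
Proof. by rewrite rowK. Qed.

Lemma row_bmx1 a m1 m2 : row bmx_i1 (bmx a m1 m2) = m1.
Proof. by rewrite row_bmx /= ltnn eqxx. Qed.

Lemma row_bmx2 a m1 m2 : row bmx_i2 (bmx a m1 m2) = m2.
Proof. by rewrite row_bmx /= bmx_n1E ltnNge leqnSn /= gtn_eqF. Qed.

Lemma mul_bmxT a m1 m2 v r :
  (v *m (bmx a m1 m2)^T) 0 r = ip v (row r (bmx a m1 m2)).
Proof.
rewrite ipE mxE; apply: eq_bigr => j _; rewrite !mxE.
by case: ifP => // _; case: ifP.
Qed.

(** A generalized cross product: the vector representing the linear form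
    [m1 |-> \det (bmx a m1 m2)]. The cofactors of that row ignore its content, hence the 0. For the
    gradients of the Casimirs and of [H] it is the field divided by [nu]. *)
Definition bcof a m2 : V := \row_j cofactor (bmx a 0 m2) bmx_i1 j.

Lemma mx_rowE p q (A : 'M[R]_(p, q)) i j : A i j = row i A 0 j.
Proof. by rewrite mxE. Qed.

Lemma det_bmx a m1 m2 : \det (bmx a m1 m2) = ip m1 (bcof a m2).
Proof.
rewrite (expand_det_row _ bmx_i1) ipE; apply: eq_bigr => j _; rewrite [bcof _ _ _ _]mxE.
congr (_ * _); first by rewrite mxE /= ltnn eqxx.
rewrite /cofactor; congr (_ * \det _); apply/matrixP => r c; rewrite !mxE.
have := neq_lift bmx_i1 r; rewrite -val_eqE eq_sym /= => /negPf rn.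
by case: ifP => //; rewrite rn.
Qed.

Lemma det_bmx_alt a m : \det (bmx a m m) = 0.
Proof.
apply: (@determinant_alternate _ _ _ bmx_i1 bmx_i2); first exact: bmx_i12.
by move=> j; rewrite [LHS]mx_rowE [RHS]mx_rowE row_bmx1 row_bmx2.
Qed.

Lemma det_bmx_alt1 a k m : (k < n - 2)%N -> \det (bmx a (a k) m) = 0.
Proof.
move=> kn; have kn' : (k < n)%N := ltn_trans kn bmx_ltn1.
apply: (@determinant_alternate _ _ _ (Ordinal kn') bmx_i1).
  by rewrite -val_eqE /= ltn_eqF.
by move=> j; rewrite !mxE /= kn ltnn eqxx.
Qed.

Lemma det_bmxN a m1 m2 : \det (bmx a m1 m2) = - \det (bmx a m2 m1).
Proof.
have -> : bmx a m1 m2 = xrow bmx_i1 bmx_i2 (bmx a m2 m1).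
  apply/row_matrixP => r; rewrite (_ : row r (xrow _ _ _) =
    row (tperm bmx_i1 bmx_i2 r) (bmx a m2 m1)); last by apply/rowP => j; rewrite !mxE.
  have [rn|->|->] := bmx_ordP r; rewrite ?tpermL ?tpermR ?row_bmx1 ?row_bmx2//.
  rewrite tpermD ?row_bmx ?rn//; rewrite -val_eqE /= gtn_eqF// bmx_n1E ltnS ltnW//.
by rewrite xrowE det_mulmx det_perm odd_tperm bmx_i12 expr1 mulN1r.
Qed.

(* [(x1, x2)] is the basis of the common kernel of the [ip (a k)] that is dual to [(l1, l2)]. *)
Definition frame a l1 l2 x1 x2 := [/\ \det (bmx a l1 l2) != 0,
  forall k, (k < n - 2)%N -> ip (a k) x1 = 0 /\ ip (a k) x2 = 0,
  ip l1 x1 = 1 /\ ip l1 x2 = 0 & ip l2 x1 = 0 /\ ip l2 x2 = 1].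

Lemma bmx_inj a l1 l2 v : \det (bmx a l1 l2) != 0 ->
  (forall k, (k < n - 2)%N -> ip (a k) v = 0) -> ip l1 v = 0 -> ip l2 v = 0 -> v = 0.
Proof.
move=> d0 av l1v l2v; have Nu : (bmx a l1 l2)^T \in unitmx.
  by rewrite unitmx_tr unitmxE unitfE.
rewrite -[v](mulmxK Nu); suff -> : v *m (bmx a l1 l2)^T = 0 by rewrite mul0mx.
apply/rowP => r; rewrite mul_bmxT mxE ipC.
by have [rn|->|->] := bmx_ordP r; rewrite ?row_bmx1 ?row_bmx2// row_bmx rn av.
Qed.

Lemma frame_ker a l1 l2 x1 x2 v : frame a l1 l2 x1 x2 ->
  (forall k, (k < n - 2)%N -> ip (a k) v = 0) -> v = ip l1 v *: x1 + ip l2 v *: x2.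
Proof.
move=> [d0 ax [l11 l12] [l21 l22]] av.
apply/eqP; rewrite -subr_eq0; apply/eqP; apply: (bmx_inj d0) => [k kn||].
- by have [x1k x2k] := ax k kn; rewrite ipBr ipDr !ipZr x1k x2k av// !mulr0 addr0 subrr.
- by rewrite ipBr ipDr !ipZr l11 l12 mulr1 mulr0 addr0 subrr.
- by rewrite ipBr ipDr !ipZr l21 l22 mulr1 mulr0 add0r subrr.
Qed.

(** The determinant kills the [a k] in either slot, so it descends to an alternating form on the
    dual of a plane, determined by its value at [(l1, l2)]. Concretely, the vector [bcof a m2] lies
    in the common kernel and is expanded in the frame. *)
Lemma det_frame a l1 l2 x1 x2 m1 m2 : frame a l1 l2 x1 x2 ->
  \det (bmx a m1 m2) =
  \det (bmx a l1 l2) * (ip m1 x1 * ip m2 x2 - ip m1 x2 * ip m2 x1).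
Proof.
move=> fr.
have E m m' : \det (bmx a m m') =
    \det (bmx a l1 m') * ip m x1 + \det (bmx a l2 m') * ip m x2.
  have K k : (k < n - 2)%N -> ip (a k) (bcof a m') = 0.
    by move=> kn; rewrite -det_bmx det_bmx_alt1.
  by rewrite !det_bmx {1}(frame_ker fr K) ipDr !ipZr.
rewrite E [\det (bmx a l1 m2)]det_bmxN [\det (bmx a l2 m2)]det_bmxN !(E m2).
by rewrite !det_bmx_alt [\det (bmx a l2 l1)]det_bmxN; ring.
Qed.

Lemma frame_exists a :
  row_free (\matrix_(r < n - 2) a r) -> exists l1 l2 x1 x2, frame a l1 l2 x1 x2.
Proof.
set D := \matrix_r _ => Dfree.
have ext p (A : 'M[R]_(p, n)) : (\rank A < n)%N -> exists v : V, (\rank A < \rank (col_mx A v))%N.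
  move=> An; have : ~~ (1%:M <= A)%MS.
    apply/negP => /mxrankS; rewrite mxrank1 leqNgt An//.
  move=> /row_subPn[i iA]; exists (row i 1%:M); apply: rank_ltmx.
  by rewrite ltmxE col_mx_sub (negPf iA) andbF andbT -addsmxE addsmxSl.
have rD : \rank D = (n - 2)%N by apply/eqP.
have [l1 l1P] := ext _ D ltac:(by rewrite rD bmx_ltn1).
have [l2 l2P] : exists v : V, (n <= \rank (col_mx (col_mx D l1) v))%N.
  (* The first case cannot occur, as the matrix has [n - 1] rows; it is closed with the vector 0
     instead of being refuted. *)
  have [nr|nr] := leqP n (\rank (col_mx D l1)).
    exists 0; apply: (leq_trans nr); rewrite mxrankS//.
    by apply: submx_trans (addsmxSl _ (0 : V)) _; rewrite addsmxE.
  have [v vP] := ext _ _ nr; exists v.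
  rewrite rD in l1P; apply: leq_trans vP; rewrite -{1}(subnK n2) addn2.
  by rewrite ltnS.
have d0 : \det (bmx a l1 l2) != 0.
  rewrite -unitfE -unitmxE -row_full_unit /row_full eqn_leq rank_leq_col /=.
  apply: leq_trans l2P _; rewrite mxrankS// !col_mx_sub.
  have rs r : (row r (bmx a l1 l2) <= bmx a l1 l2)%MS by exact: row_sub.
  apply/andP; split; last by rewrite -{1}(row_bmx2 a l1 l2).
  apply/andP; split; last by rewrite -{1}(row_bmx1 a l1 l2).
  apply/row_subP => r; rewrite rowK.
  have := rs (Ordinal (ltn_trans (ltn_ord r) bmx_ltn1)).
  by rewrite row_bmx /= ltn_ord.
have Nu : (bmx a l1 l2)^T \in unitmx by rewrite unitmx_tr unitmxE unitfE.
pose x i : V := delta_mx 0 i *m invmx (bmx a l1 l2)^T.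
have xP i r : ip (row r (bmx a l1 l2)) (x i) = (r == i)%:R.
  by rewrite ipC -mul_bmxT mulmxKV// mxE eqxx.
exists l1, l2, (x bmx_i1), (x bmx_i2); split=> // [k kn||].
- have kn' := ltn_trans kn bmx_ltn1.
  have := xP bmx_i1 (Ordinal kn'); have := xP bmx_i2 (Ordinal kn').
  rewrite !row_bmx /= kn -!val_eqE /= !ltn_eqF// ?bmx_n1E ?ltnS ?(ltnW kn)//.
- have := xP bmx_i1 bmx_i1; have := xP bmx_i2 bmx_i1.
  by rewrite row_bmx1 eqxx (negPf bmx_i12).
- have := xP bmx_i1 bmx_i2; have := xP bmx_i2 bmx_i2.
  by rewrite row_bmx2 eqxx eq_sym (negPf bmx_i12).
Qed.

Lemma frame_change a l1 l2 x1 x2 (b g : R) : frame a l1 l2 x1 x2 -> g != 0 ->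
  let l1' := l1 - (b / g) *: l2 in let l2' := g^-1 *: l2 in
  frame a l1' l2' x1 (b *: x1 + g *: x2) /\
  \det (bmx a l1' l2') = \det (bmx a l1 l2) / g.
Proof.
move=> fr g0 l1' l2'; have E : \det (bmx a l1' l2') = \det (bmx a l1 l2) / g.
  case: (fr) => _ _ [l11 l12] [l21 l22].
  rewrite (det_frame _ _ fr) /l1' /l2' !ipBl !ipZl l11 l12 l21 l22; by field.
split=> //; case: (fr) => d0 ax [l11 l12] [l21 l22].
split; first by rewrite E mulf_neq0// invr_eq0.
- by move=> k /ax[x1k x2k]; rewrite ipDr !ipZr x1k x2k !mulr0 addr0.
- rewrite /l1' !ipBl !ipZl !ipDr !ipZr l11 l12 l21 l22; split; first by ring.
  by field.
- rewrite /l2' !ipZl !ipDr !ipZr l21 l22; split; first by ring.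
  by field.
Qed.

End bmx.

(** * Quadrature of a scalar equation *)

Section quadrature.
Context {R : realType}.
Implicit Types (f w : R -> R) (a b c x y t : R).

Lemma MVT_derive (f df : R -> R) a b : a < b ->
  (forall x, a <= x <= b -> is_derive x 1 f (df x)) ->
  exists2 c, a < c < b & f b - f a = df c * (b - a).
Proof.
move=> ab fd.
have fc : {within `[a, b], continuous f}.
  by apply: derivable_within_continuous => x; rewrite in_itv /= => /fd[].
have [|c] := @MVT _ f df a b ab _ fc.
  by move=> x /subset_itv_oo_cc; rewrite in_itv /= => /fd.
by rewrite in_itv /= => cI E; exists c.
Qed.

Lemma is_derive_itv_eq f g (d : R -> R) a b : a <= b ->
  (forall x, a <= x <= b -> is_derive x 1 f (d x)) ->
  (forall x, a <= x <= b -> is_derive x 1 g (d x)) -> f b - f a = g b - g a.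
Proof.
rewrite le_eqVlt => /predU1P[->|ab] fd gd; first by rewrite !subrr.
have [|c _] := @MVT_derive (f - g) (fun=> 0) a b ab.
  move=> x xI; rewrite -(subrr (d x)).
  by apply: is_deriveB; [exact: fd|exact: gd].
rewrite mul0r !fctE /= => E; apply/eqP; rewrite -subr_eq0 -[X in _ == X]E.
by apply/eqP; ring.
Qed.

Lemma antiderivative_itv f b : 0 < b -> continuous f ->
  exists F : R -> R, F 0 = 0 /\ forall x, `|x| < b -> is_derive x 1 F (f x).
Proof.
move=> b0 fc; pose mu := @lebesgue_measure R.
pose F x := (\int[mu]_(t in `[- b, x]) f t)%R.
exists (fun x => F x - F 0); split=> [|x]; first by rewrite subrr.
rewrite ltr_norml => /andP[bx xb].
have fi : mu.-integrable `[- b, b] (EFin \o f).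
  apply: continuous_compact_integrable; first exact: segment_compact.
  exact: continuous_subspaceT.
have [Fd FE] := @continuous_FTC1_closed R f (- b) x b xb fi bx (fc x).
have Fx : is_derive x 1 F (f x) by exact: (DeriveDef Fd (etrans (esym (derive1E F x)) FE)).
by rewrite -[f x]subr0; apply: is_deriveB.
Qed.

(** Primitives on growing intervals, all normalized by the value 0 at 0, agree on overlaps; at [x]
    the one indexed by the truncation of [|x|] is taken. *)
Lemma antiderivative f : continuous f ->
  exists F : R -> R, F 0 = 0 /\ forall x, is_derive x 1 F (f x).
Proof.
move=> fc.
have /choice[G GP] : forall N : nat, exists F : R -> R, F 0 = 0 /\
    forall x, `|x| < N.+1%:R -> is_derive x 1 F (f x).
  by move=> N; exact: antiderivative_itv.
have GE N M x : (N <= M)%N -> `|x| < N.+1%:R -> G N x = G M x.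
  move=> NM xN; have [G0 GN] := GP N; have [G0' GM] := GP M.
  have NMR : N.+1%:R <= M.+1%:R :> R by rewrite ler_nat.
  have [x0|/ltW x0] := leP 0 x.
    have := @is_derive_itv_eq (G N) (G M) f 0 x x0; rewrite G0 G0' !subr0; apply.
      move=> y /andP[y0 yx]; apply: GN; rewrite ger0_norm//.
      by rewrite (le_lt_trans yx)// (le_lt_trans (ler_norm _)).
    move=> y /andP[y0 yx]; apply: GM; rewrite ger0_norm// (lt_le_trans _ NMR)//.
    by rewrite (le_lt_trans yx)// (le_lt_trans (ler_norm _)).
  have := @is_derive_itv_eq (G N) (G M) f x 0 x0; rewrite G0 G0' !sub0r => H.
  apply: oppr_inj; apply: H.
    move=> y /andP[xy y0]; apply: GN; rewrite ler0_norm//.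
    by rewrite (le_lt_trans _ xN)// ler0_norm// lerN2.
  move=> y /andP[xy y0]; apply: GM; rewrite ler0_norm// (lt_le_trans _ NMR)//.
  by rewrite (le_lt_trans _ xN)// ler0_norm// lerN2.
pose N x := Num.truncn `|x|.
have NP x : `|x| < (N x).+1%:R by exact: truncnS_gt.
exists (fun x => G (N x) x); split; first by case: (GP (N 0)).
move=> x; have [_ Gx] := GP (N x).+1.
apply: near_eq_is_derive (Gx x _); last by rewrite (lt_trans (NP x))// ltr_nat.
apply/near_ballE; exists ((N x).+1%:R - `|x|); first by rewrite subr_gt0.
move=> y yx; have yN : `|y| < (N x).+1%:R.
  rewrite -[y](subrK x) (le_lt_trans (ler_normD _ _))//.
  by rewrite -ltrBrDr.
apply/esym/GE; last exact: NP.
by rewrite leqW// /N truncn_le_nat// (lt_le_trans yN)// ler_nat.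
Qed.

(** Separation of variables for [th' = 1 / w (th)]: a primitive [F] of [w] is the time as a function
    of the position, increasing and onto because [w >= c > 0], and [th] is its inverse. Periodicity
    of [w] gives [F (x + p) = F x + F p], so [T = F p]; the mean value form of [T] suffices to
    compute the limit of the periods. *)
Lemma quadrature w p c : 0 < p -> 0 < c -> continuous w ->
  (forall x, w (x + p) = w x) -> (forall x, c <= w x) ->
  exists (th : R -> R) (T : R),
   [/\ 0 < T, forall t, is_derive t 1 th (w (th t))^-1 & forall t, th (t + T) = th t + p] /\
   [/\ th 0 = 0, forall x, exists t, th t = x, forall s, 0 < s < T -> 0 < th s < p &
     exists x, T = p * w x].
Proof.
move=> p0 c0 wc wp cw; have [F [F0 Fd]] := antiderivative wc.
have FL x y : x < y -> c * (y - x) <= F y - F x.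
  move=> xy; have [z _ ->] := MVT_derive xy (fun z _ => Fd z).
  by rewrite ler_wpM2r// subr_ge0 ltW.
have Fmono x y : x < y -> F x < F y.
  by move=> xy; rewrite -subr_gt0 (lt_le_trans _ (FL _ _ xy))// mulr_gt0// subr_gt0.
have Finj x y : F x = F y -> x = y.
  by move=> E; case: (ltgtP x y) => // /Fmono; rewrite E ltxx.
have Fc : continuous F.
  by move=> x; apply: differentiable_continuous; apply/derivable1_diffP; case: (Fd x).
have Fsurj t : exists x, F x = t.
  pose a := `|t| / c + 1; have a0 : 0 < a by rewrite ltr_wpDl// divr_ge0// ltW.
  have ca : `|t| <= c * a by rewrite /a mulrDr mulrC divfK ?gt_eqF// lerDl mulr1 ltW.
  have := FL _ _ a0; rewrite F0 !subr0 => /(le_trans ca) Fa.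
  have := FL (- a) 0; rewrite F0 oppr_lt0 sub0r opprK add0r => /(_ a0) /(le_trans ca) FNa.
  have aNa : - a <= a by rewrite ge0_cp// ltW.
  have [||x _ <-] := @IVT R F (- a) a t aNa; [exact: continuous_subspaceT| |by exists x].
  rewrite ge_min le_max; apply/andP; split; apply/orP.
    by left; rewrite lerNr in FNa; rewrite (le_trans FNa)// lerNl -normrN ler_norm.
  by right; exact: le_trans (ler_norm _) Fa.
have /choice[th thP] := Fsurj.
have thK : cancel F th by move=> x; apply: Finj; rewrite thP.
have FD x : F (x + p) = F x + F p.
  pose D x := F (x + p) - F x.
  have : D x = D 0.
    apply: is_derive_0_is_cst => y; rewrite -(subrr (w y)).
    have Fyp : is_derive (y + p) 1 F (w y) by rewrite -(wp y); exact: Fd.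
    have sh : is_derive y 1 (fun z => z + p) 1 by rewrite -[X in is_derive _ _ _ X]addr0; apply: is_deriveD.
    have H : is_derive y 1 (fun z => F (z + p)) (w y).
      by have := @is_derive1_comp _ F (fun z => z + p) y (w y) 1 Fyp sh; rewrite mulr1.
    exact: (@is_deriveB _ _ _ (fun z => F (z + p)) F y 1 _ _ H (Fd y)).
  by rewrite /D F0 subr0 add0r => /eqP; rewrite subr_eq => /eqP ->; rewrite addrC.
have T0 : 0 < F p by rewrite -F0; exact: Fmono.
exists th, (F p); split; split=> //.
- move=> t; rewrite -{1}(thP t).
  have K : {near th t, cancel F th} by apply/near_ballE; exists 1 => // y _; exact: thK.
  have C : {near th t, continuous F} by apply/near_ballE; exists 1 => // y _; exact: Fc.
  apply: (is_derive_inverse K C (Fd (th t))).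
  by rewrite gt_eqF// (lt_le_trans c0).
- by move=> t; apply: Finj; rewrite thP FD thP.
- by apply: Finj; rewrite thP F0.
- by move=> x; exists (F x).
- move=> s /andP[s0 sT]; apply/andP; split; rewrite ltNge; apply/negP => H.
    move: s0; rewrite -(thP s) -F0 ltNge => /negP; apply.
    by move: H; rewrite le_eqVlt => /predU1P[->//|/Fmono/ltW].
  move: sT; rewrite -(thP s) ltNge => /negP; apply.
  by move: H; rewrite le_eqVlt => /predU1P[->//|/Fmono/ltW].
- have [z _] := MVT_derive p0 (fun z _ => Fd z).
  by rewrite F0 !subr0 mulrC => ->; exists z.
Qed.

End quadrature.

(** * Level curves in polar coordinates *)

Section trig.
Context {R : realType}.
Implicit Types (a b x y s t : R).

Lemma is_derive_le1_lipschitz (g dg : R -> R) : (forall x, is_derive x 1 g (dg x)) ->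
  (forall x, `|dg x| <= 1) -> forall x y, `|g x - g y| <= `|x - y|.
Proof.
move=> gd dg1; suff H x y : x < y -> `|g y - g x| <= `|y - x|.
  move=> x y; case: (ltgtP x y) => [xy|yx|->]; last by rewrite !subrr.
    by rewrite distrC [leRHS]distrC; exact: H.
  exact: H.
move=> xy; have [z _ ->] := MVT_derive xy (fun z _ => gd z).
by rewrite normrM ler_piMl.
Qed.

Lemma cos_lipschitz x y : `|cos x - cos y| <= `|x - y|.
Proof.
apply: (@is_derive_le1_lipschitz cos (fun x => - sin x)) => z.
by rewrite normrN ler_norml sin_geN1 sin_le1.
Qed.

Lemma sin_lipschitz x y : `|sin x - sin y| <= `|x - y|.
Proof.
apply: (@is_derive_le1_lipschitz sin cos) => z.
by rewrite ler_norml cos_geN1 cos_le1.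
Qed.

Lemma norm_sin_le x : `|sin x| <= `|x|.
Proof. by have := sin_lipschitz x 0; rewrite sin0 !subr0. Qed.

Lemma polar_coord a b : exists th,
  a = Num.sqrt (a ^+ 2 + b ^+ 2) * cos th /\ b = Num.sqrt (a ^+ 2 + b ^+ 2) * sin th.
Proof.
set s := Num.sqrt _; have s2 : s ^+ 2 = a ^+ 2 + b ^+ 2 by rewrite sqr_sqrtr ?addr_ge0 ?sqr_ge0.
have [s0|s0] := eqVneq s 0.
  move: s2; rewrite s0 expr0n /= => /esym/eqP; rewrite paddr_eq0 ?sqr_ge0// !sqrf_eq0.
  by move=> /andP[/eqP -> /eqP ->]; exists 0; rewrite !mul0r.
have sp : 0 < s by rewrite lt_neqAle eq_sym s0 sqrtr_ge0.
have as1 : -1 <= a / s <= 1.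
  have : `|a| <= s by rewrite -sqrtr_sqr ler_sqrt ?addr_ge0 ?sqr_ge0// lerDl sqr_ge0.
  by rewrite ler_norml -ler_norml ler_norml ler_pdivrMr// ler_pdivlMr// mul1r mulN1r.
have cE : s * cos (acos (a / s)) = a by rewrite acosK ?in_itv//= mulrC divfK.
have sE : s * sin (acos (a / s)) = `|b|.
  have s_ge0 : 0 <= s * sin (acos (a / s)).
    by rewrite mulr_ge0// ?sqrtr_ge0// sin_ge0_pi// acos_ge0//= acos_lepi.
  apply/eqP; rewrite -(@eqrXn2 _ 2)// ?real_normK ?num_real// exprMn.
  by rewrite sin2cos2 mulrBr mulr1 -exprMn cE s2 [_ + b ^+ 2]addrC addrK.
have [b0|b0] := leP 0 b.
  by exists (acos (a / s)); rewrite cE sE ger0_norm.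
by exists (- acos (a / s)); rewrite cosN sinN cE mulrN sE ltr0_norm// opprK.
Qed.

End trig.

Lemma continuous_ip (R : realType) n (l : 'rV[R]_n) : continuous (ip l).
Proof.
move=> x; apply/continuous_forP => e e0; have [K K0 lK] := ip_bounded l.
exists (e / K) => [|y]; first by rewrite divr_gt0.
by rewrite ltr_pdivlMr// -ipBr mulrC => yx; rewrite (le_trans (lK _))// ltW.
Qed.

Lemma lipschitz_within_continuous (R : realType) (V : normedModType R) (g : R -> V) (a b L : R) :
  (forall x y, a <= x <= b -> a <= y <= b -> `|g x - g y| <= L * `|x - y|) ->
  {within `[a, b], continuous g}.
Proof.
move=> gL; apply/subspace_continuousP => x; rewrite /= in_itv /= => xI.
apply/cvgrPdist_le => e e0; rewrite near_withinE.
suff : \forall y \near x, `[a, b]%classic y -> `|g x - g y| <= e by [].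
apply/near_ballE.
have L0 : 0 < `|L| + 1 by rewrite ltr_wpDl.
exists (e / (`|L| + 1)) => [|y]; first by rewrite divr_gt0.
rewrite ltr_pdivlMr// /= in_itv /= => yx yI; rewrite (le_trans (gL _ _ xI yI))//.
rewrite distrC; apply: le_trans (ltW yx); rewrite mulrC ler_wpM2l//.
by rewrite (le_trans (ler_norm _))// lerDl.
Qed.

Lemma is_derive_compr (R : realType) (W : normedModType R) (c : R -> W) (g : R -> R) (t a : R) v :
  is_derive (g t) 1 c v -> is_derive t 1 g a -> is_derive t 1 (c \o g) (a *: v).
Proof.
move=> [/derivable1_diffP dc cE] [/derivable1_diffP dg gE].
have dcg : differentiable (c \o g) t by exact: differentiable_comp.
split; first exact/derivable1_diffP.
rewrite deriveE// diff_comp//= -[in 'd g t 1]deriveE// gE.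
by rewrite -[X in 'd c (g t) X]mulr1 [LHS]linearZ -deriveE// cE.
Qed.

(** Matches [fwd_sol] and [sol_on], which ask for derivatives at positive times and only for a right
    limit at 0. *)
Lemma right_ray_continuous (R : realType) (V : normedModType R) (c : R -> V) (v : R -> V) (t : R) :
  (forall s, 0 < s <= t -> is_derive s 1 c (v s)) -> c s @[s --> 0^'+] --> c 0 ->
  {within `[0, t], continuous c}.
Proof.
move=> cd c0; apply/subspace_continuousP => x; rewrite /= in_itv /= => /andP[x0 xt].
apply/cvgrPdist_le => e e0; rewrite near_withinE.
suff : \forall y \near x, `[0, t]%classic y -> `|c x - c y| <= e by [].
move: x0; rewrite le_eqVlt => /predU1P[<-|x0]; last first.
  have cx : {for x, continuous c}.
    apply: differentiable_continuous; apply/derivable1_diffP.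
    by have [] := cd x; rewrite ?x0 ?xt.
  have /continuous_forP/(_ _ e0)[d dd0 dH] := cx.
  by apply/near_ballE; exists d => // y /dH; rewrite distrC.
have /cvgrPdist_le/(_ _ e0) := c0; rewrite near_withinE => H.
have /near_ballE[d dd0 dH] : \forall y \near (0 : R), 0 < y -> `|c 0 - c y| <= e by exact: H.
apply/near_ballE; exists d => // y yd; rewrite /= in_itv /= => /andP[y0 _].
move: y0; rewrite le_eqVlt => /predU1P[<-|y0]; first by rewrite subrr normr0 ltW.
exact: dH.
Qed.

Section polar.
Context {R : realType} {n : nat} (X : 'rV[R]_n -> 'rV[R]_n) (S : set 'rV[R]_n).
Context (xe l1 l2 : 'rV[R]_n) (f : 'rV[R]_n -> R) (om : R).
Context (P : R -> R -> 'rV[R]_n) (r d0 M : R).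
Hypotheses (om0 : 0 < om) (r0 : 0 < r) (M0 : 0 < M) (Mr : M * r < d0).
Hypotheses (Sxe : S xe) (fxe : f xe = 0) (Xxe : X xe = 0).
(* [P s th] is the point of [S] whose coordinates [(ip l1, ip l2)] relative to [xe] are
   [(s * cos th, s * sin th)]; in these coordinates [f] is close to half the squared radius. *)
Hypothesis PS : forall s th, 0 <= s <= r ->
  [/\ S (P s th), ip l1 (P s th - xe) = s * cos th,
      ip l2 (P s th - xe) = s * sin th & `|P s th - xe| <= M * s].
Hypothesis P2pi : forall s th, P s (th + pi *+ 2) = P s th.
Hypothesis PL : forall s s' th th', 0 <= s <= r -> 0 <= s' <= r ->
  `|P s th - P s' th'| <= M * (`|s - s'| + s' * `|th - th'|).
Hypothesis Pf : forall s s' th th', 0 <= s <= r -> 0 <= s' <= r ->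
  `|f (P s th) - f (P s' th') - (s ^+ 2 - s' ^+ 2) / 2| <=
  8^-1 * Num.max s s' * (`|s - s'| + s' * `|th - th'|).
Hypothesis Pinj : forall x, S x -> `|x - xe| < d0 -> forall s th, 0 <= s <= r ->
  ip l1 (x - xe) = s * cos th -> ip l2 (x - xe) = s * sin th -> x = P s th.
Hypothesis f_low : forall x, S x -> `|x - xe| < d0 ->
  (ip l1 (x - xe) ^+ 2 + ip l2 (x - xe) ^+ 2) / 4 <= f x /\
  `|x - xe| ^+ 2 <= M ^+ 2 * (ip l1 (x - xe) ^+ 2 + ip l2 (x - xe) ^+ 2).
Hypothesis fc : forall x, `|x - xe| < d0 -> {for x, continuous f}.
Hypothesis fX : forall (c : R -> 'rV[R]_n) (t : R), `|c t - xe| < d0 ->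
  is_derive t 1 c (X (c t)) -> is_derive t 1 (f \o c) 0.
Hypothesis Xc : forall x, `|x - xe| < d0 -> {for x, continuous X}.
Hypothesis Xcurve : forall (c : R -> 'rV[R]_n) (t : R) m (k : R),
  (forall s, S (c s)) -> `|c t - xe| < d0 -> {for t, continuous c} ->
  (forall s, f (c s) = f (c t)) -> is_derive t 1 (fun s => ip m (c s)) k ->
  ip m (X (c t)) != 0 -> is_derive t 1 c ((k / ip m (X (c t))) *: X (c t)).
Hypothesis Xfield : forall e, 0 < e -> exists2 d : R, 0 < d &
  forall x, S x -> `|x - xe| < d ->
    `|ip l1 (X x) + om * ip l2 (x - xe)| <= e * `|x - xe| /\
    `|ip l2 (X x) - om * ip l1 (x - xe)| <= e * `|x - xe|.
Hypothesis Xfield0 : forall x, S x -> `|x - xe| < d0 ->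
    `|ip l1 (X x) + om * ip l2 (x - xe)| <= om / (4 * M) * `|x - xe| /\
    `|ip l2 (X x) - om * ip l1 (x - xe)| <= om / (4 * M) * `|x - xe|.

Let d00 : 0 < d0. Proof. by rewrite (lt_trans _ Mr)// mulr_gt0. Qed.

Let rr : 0 <= r <= r. Proof. by rewrite lexx ltW. Qed.

Let zr : 0 <= (0 : R) <= r. Proof. by rewrite lexx ltW. Qed.

Lemma polar_ball s th : 0 <= s <= r -> `|P s th - xe| < d0.
Proof.
move=> sr; have [_ _ _ Ps] := PS th sr; rewrite (le_lt_trans Ps)//.
by rewrite (le_lt_trans _ Mr)// ler_pM2l//; case/andP: sr.
Qed.

Lemma polar0 th : P 0 th = xe.
Proof.
have [_ _ _] := PS th zr; rewrite mulr0 normr_le0 subr_eq0.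
by move/eqP.
Qed.

(** Half the squared radius increases by at least [s * (s - s') / 2], and the constant 1/8 in [Pf]
    costs at most [s * (s - s') / 8]. *)
Lemma polar_incr s s' th : 0 <= s' -> s' <= s -> s <= r ->
  3 / 8 * s * (s - s') <= f (P s th) - f (P s' th).
Proof.
move=> s'0 s's sr; have sI : 0 <= s <= r by rewrite sr (le_trans s'0).
have s'I : 0 <= s' <= r by rewrite s'0 (le_trans s's).
have := Pf th th sI s'I; rewrite subrr normr0 mulr0 addr0 max_l// [`|s - s'|]ger0_norm ?subr_ge0//.
rewrite ler_norml => /andP[+ _]; move: (f (P s th)) (f (P s' th)) => A B.
have : 0 <= s' * (s - s') by rewrite mulr_ge0// subr_ge0.
by move=> ? ?; nra.
Qed.

Lemma polar_bounds s th : 0 <= s <= r ->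
  3 / 8 * s ^+ 2 <= f (P s th) <= 5 / 8 * s ^+ 2.
Proof.
move=> sI; have s0 : 0 <= s by case/andP: sI.
have := Pf th th sI zr; rewrite polar0 fxe expr0n /= !subr0 mul0r addr0.
rewrite max_l// [`|s|]ger0_norm// ler_norml => /andP[? ?]; apply/andP; split; nra.
Qed.

(* [rad e th] is the radius at which the ray of angle [th] meets the level set [f = e]
   ([0] when it does not), so that [loop e] parametrizes that level set by the angle. *)
Definition rad (e th : R) : R := xget 0 [set s | 0 <= s <= r /\ f (P s th) = e].

(** On the circle of radius [r] the function is at least [3 / 8 * r ^+ 2], which exceeds
    [r ^+ 2 / 4], so the intermediate value theorem applies on the ray. *)
Lemma radP e th : 0 <= e <= r ^+ 2 / 4 -> 0 <= rad e th <= r /\ f (P (rad e th) th) = e.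
Proof.
move=> /andP[e0 er]; rewrite /rad; case: xgetP => [s -> //|H]; exfalso.
have gc : {within `[0, r], continuous (fun s => f (P s th))}.
  apply: (@lipschitz_within_continuous _ _ _ _ _ (2 * r)) => s s' sI s'I.
  have := Pf th th sI s'I; rewrite subrr normr0 mulr0 addr0 -mulrA.
  have m0 : 0 <= Num.max s s' <= r.
    by move: sI s'I => /andP[s0 sr] /andP[? ?]; rewrite le_max s0 ge_max sr.
  have : Num.max s s' * `|s - s'| <= r * `|s - s'|.
    by rewrite ler_wpM2r//; case/andP: m0.
  have : `|(s ^+ 2 - s' ^+ 2) / 2| <= r * `|s - s'|.
    rewrite subr_sqr -mulrA normrM mulrC ler_wpM2r//.
    move: sI s'I => /andP[? ?] /andP[? ?].
    by rewrite ger0_norm ?divr_ge0 ?addr_ge0//; lra.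
  move: (Num.max _ _ * _) => q.
  have := ler_normD (f (P s th) - f (P s' th) - (s ^+ 2 - s' ^+ 2) / 2) ((s ^+ 2 - s' ^+ 2) / 2).
  rewrite subrK; have : 0 <= r * `|s - s'| by rewrite mulr_ge0// ltW.
  rewrite -mulrA; move: (r * _) => q' ? ? ? ? ?; lra.
have [|s] := @IVT R (fun s => f (P s th)) 0 r e (ltW r0) gc.
  rewrite polar0 fxe ge_min e0 /= le_max; apply/orP; right.
  have /andP[] := polar_bounds th rr; have : 0 <= r ^+ 2 by rewrite sqr_ge0.
  by lra.
by rewrite in_itv /= => sI sE; apply: (H s).
Qed.

Lemma radE e s th : 0 <= s <= r -> f (P s th) = e -> rad e th = s.
Proof.
move=> /[dup] sI /andP[s0 sr] sE.
have [/andP[t0 tr] tE] : 0 <= rad e th <= r /\ f (P (rad e th) th) = e.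
  by rewrite /rad; case: xgetP => [t -> //|/(_ s)[]].
move: (rad e th) t0 tr tE => t t0 tr tE.
have aux u v : 0 <= u -> v <= r -> f (P u th) = e -> f (P v th) = e -> u < v -> False.
  move=> u0 vr uE vE uv; have v0 : 0 < v by exact: le_lt_trans uv.
  have := polar_incr th u0 (ltW uv) vr; rewrite uE vE subrr leNgt.
  by rewrite !mulr_gt0// subr_gt0.
by case: (ltgtP t s) => // [ts|st]; [case: (aux t s)|case: (aux s t)].
Qed.

Lemma rad_periodic e th : rad e (th + pi *+ 2) = rad e th.
Proof.
by rewrite /rad; congr xget; apply/funext => s /=; rewrite P2pi.
Qed.

Lemma rad_sqr e th : 0 <= e <= r ^+ 2 / 4 -> rad e th ^+ 2 <= 4 * e.
Proof.
move=> eI; have [sI sE] := radP th eI; have /andP[+ _] := polar_bounds th sI; rewrite sE.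
have : 0 <= rad e th ^+ 2 by rewrite sqr_ge0.
by move: (_ ^+ 2) => q; lra.
Qed.

Lemma rad_gt0 e th : 0 < e <= r ^+ 2 / 4 -> 0 < rad e th.
Proof.
move=> /andP[e0 er]; have [] := @radP e th; first by rewrite (ltW e0).
move=> /andP[s0 _] sE; rewrite lt_neqAle s0 andbT; apply/eqP => E.
by move: e0; rewrite -sE -E polar0 fxe ltxx.
Qed.

(** For radii [s' <= s] on the same level, the radial gain of [f] from [s'] to [s], at least
    [3 / 8 * s * (s - s')], equals its angular variation at radius [s'], at most
    [s' ^+ 2 * |th - th'| / 8]. Dividing by [s >= s'] leaves a Lipschitz bound. *)
Lemma rad_lipschitz e th th' : 0 < e <= r ^+ 2 / 4 ->
  `|rad e th - rad e th'| <= r * `|th - th'|.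
Proof.
move=> eI; have eI' : 0 <= e <= r ^+ 2 / 4 by case/andP: eI => /ltW -> ->.
suff H t t' : rad e t' <= rad e t -> `|rad e t - rad e t'| <= r * `|t - t'|.
  have [/H//|/ltW/H] := leP (rad e th') (rad e th).
  by rewrite distrC [`|th' - _|]distrC.
move=> s's; have [/[dup] sI /andP[s0 sr] sE] := radP t eI'.
have [/[dup] s'I /andP[s'0 s'r] s'E] := radP t' eI'.
have sp := rad_gt0 t eI; move: s's sI s0 sr sE s'I s'0 s'r s'E sp.
move: (rad e t) (rad e t') => s s' s's sI s0 sr sE s'I s'0 s'r s'E sp.
rewrite ger0_norm ?subr_ge0//.
have := polar_incr t s'0 s's sr; rewrite sE -s'E.
have := Pf t' t s'I s'I; rewrite !subrr normr0 mul0r subr0 add0r max_l//.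
rewrite [`|t' - t|]distrC => H1 H2.
have H3 := le_trans H2 (le_trans (ler_norm _) H1).
have d0' : 0 <= `|t - t'| by [].
have : s * (3 / 8 * (s - s')) <= s * (8^-1 * (s' * `|t - t'|)).
  have : s' * (s' * `|t - t'|) <= s * (s' * `|t - t'|) by rewrite ler_wpM2r// mulr_ge0.
  by move: H3; move: (`|t - t'|) => q ? ?; lra.
rewrite ler_pM2l// => H4; have H5 : s' * `|t - t'| <= r * `|t - t'| by rewrite ler_wpM2r.
have H6 : 0 <= s' * `|t - t'| by rewrite mulr_ge0.
lra.
Qed.

Definition loop e th := P (rad e th) th.

Lemma loop_periodic e th : loop e (th + pi *+ 2) = loop e th.
Proof. by rewrite /loop rad_periodic P2pi. Qed.

Lemma loopP e th : 0 <= e <= r ^+ 2 / 4 ->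
  [/\ S (loop e th), `|loop e th - xe| <= M * rad e th, `|loop e th - xe| < d0 &
      f (loop e th) = e].
Proof.
move=> eI; have [sI sE] := radP th eI; have [Sl _ _ lM] := PS th sI.
by split=> //; exact: polar_ball.
Qed.

Lemma loop_continuous e : 0 < e <= r ^+ 2 / 4 -> continuous (loop e).
Proof.
move=> eI th; have eI' : 0 <= e <= r ^+ 2 / 4 by case/andP: eI => /ltW -> ->.
apply/continuous_forP => a a0.
have L0 : 0 < M * (2 * r) by rewrite !mulr_gt0.
exists (a / (M * (2 * r))) => [|t]; first by rewrite divr_gt0.
rewrite ltr_pdivlMr// => td.
have [sI _] := radP th eI'; have [tI _] := radP t eI'.
apply: le_trans (PL t th tI sI) _; apply: le_trans (ltW td).
rewrite mulrCA ler_wpM2l ?(ltW M0)//.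
have := rad_lipschitz t th eI.
have : rad e th * `|t - th| <= r * `|t - th| by rewrite ler_wpM2r//; case/andP: sI.
by move=> ? ?; nra.
Qed.

(** The component of the field in the direction of increasing angle at [loop e th], that is, the
    radius times the angular velocity. *)
Definition speed e th := - sin th * ip l1 (X (loop e th)) + cos th * ip l2 (X (loop e th)).

Lemma speed_near e th k : 0 <= k -> 0 <= e <= r ^+ 2 / 4 ->
  `|ip l1 (X (loop e th)) + om * ip l2 (loop e th - xe)| <= k * `|loop e th - xe| ->
  `|ip l2 (X (loop e th)) - om * ip l1 (loop e th - xe)| <= k * `|loop e th - xe| ->
  `|speed e th - om * rad e th| <= 2 * k * M * rad e th.
Proof.
move=> k0 eI H1 H2; have [sI sE] := radP th eI.
have [Sl a1 a2 lM] := PS th sI; rewrite -/(loop e th) in Sl a1 a2 lM.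
move: H1 H2; rewrite /speed a1 a2.
set A := ip l1 _; set B := ip l2 _ => H1 H2.
have -> : - sin th * A + cos th * B - om * rad e th =
    - sin th * (A + om * (rad e th * sin th)) + cos th * (B - om * (rad e th * cos th)).
  have -> : om * rad e th = om * rad e th * (cos th ^+ 2 + sin th ^+ 2) by rewrite cos2Dsin2 mulr1.
  by ring.
apply: le_trans (ler_normD _ _) _; rewrite !normrM normrN.
have kM : k * `|loop e th - xe| <= k * M * rad e th by rewrite -mulrA ler_wpM2l.
have s1 : `|sin th| <= 1 by rewrite ler_norml sin_geN1 sin_le1.
have c1 : `|cos th| <= 1 by rewrite ler_norml cos_geN1 cos_le1.
have -> : 2 * k * M * rad e th = 1 * (k * M * rad e th) + 1 * (k * M * rad e th) by ring.
by rewrite lerD// ler_pM// (le_trans _ kM).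
Qed.

(** The constant [om / (4 * M)] in [Xfield0] makes the error of [speed_near] exactly half of the
    main term [om * rad e th]. *)
Lemma speed_bounds e th : 0 <= e <= r ^+ 2 / 4 ->
  om / 2 * rad e th <= speed e th <= 3 / 2 * om * rad e th.
Proof.
move=> eI; have [Sl _ ld _] := loopP th eI; have [H1 H2] := Xfield0 Sl ld.
have k0 : 0 <= om / (4 * M) by rewrite divr_ge0 ?mulr_ge0// ltW.
have := speed_near k0 eI H1 H2.
have -> : 2 * (om / (4 * M)) * M * rad e th = om * rad e th / 2 by field; rewrite gt_eqF.
by rewrite ler_norml => /andP[? ?]; apply/andP; split; lra.
Qed.

Lemma speed_gt0 e th : 0 < e <= r ^+ 2 / 4 -> 0 < speed e th.
Proof.
move=> eI; have eI' : 0 <= e <= r ^+ 2 / 4 by case/andP: eI => /ltW -> ->.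
have /andP[+ _] := speed_bounds th eI'; apply: lt_le_trans.
by rewrite mulr_gt0 ?divr_gt0//; exact: rad_gt0.
Qed.

(* The time density [dt / dth] of the solution running along [loop e]. *)
Definition dtime e th := rad e th / speed e th.

(** Freeze the angular direction [m] at [th]. Then [ip m (loop e t)] is a constant plus
    [rad e t * sin (t - th)], which has derivative [rad e th] at [th] although [rad] is only
    Lipschitz, because the sine vanishes there. [Xcurve] recovers the whole velocity from this
    component. *)
Lemma is_derive_loop e (th : R) : 0 < e <= r ^+ 2 / 4 ->
  is_derive th 1 (loop e) (dtime e th *: X (loop e th)).
Proof.
move=> eI; have eI' : 0 <= e <= r ^+ 2 / 4 by case/andP: eI => /ltW -> ->.
pose m := - sin th *: l1 + cos th *: l2.
have mX : ip m (X (loop e th)) = speed e th by rewrite /m ipDl !ipZl.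
rewrite /dtime -mX; apply: Xcurve.
- by move=> s; case: (loopP s eI').
- by case: (loopP th eI').
- exact: loop_continuous.
- by move=> s; case: (loopP s eI') => _ _ _ ->; case: (loopP th eI').
- have E t : ip m (loop e t) = ip m xe + rad e t * sin (t - th).
    have [sI _] := radP t eI'; have [_ a1 a2 _] := PS t sI; rewrite -/(loop e t) in a1 a2.
    rewrite -[loop e t](subrK xe) ipDr addrC; congr (_ + _).
    by rewrite /m ipDl !ipZl a1 a2 sinB; ring.
  apply/is_deriveP => a a0.
  have [d1 d10 sd] := (is_deriveP sin 0 (cos 0)).1 (is_derive_sin 0) (a / (2 * r))
    ltac:(by rewrite divr_gt0// mulr_gt0).
  exists (Num.min d1 (a / (2 * r))) => [|h]; first by rewrite lt_min d10 divr_gt0// mulr_gt0.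
  rewrite lt_min => /andP[/sd]; rewrite add0r sin0 cos0 subr0 [h *: 1]mulr1 => sh ha.
  rewrite !E subrr sin0 mulr0 addr0 [ip m xe + _]addrC addrK addrAC subrr add0r.
  rewrite -[h *: rad e th]/(h * rad e th).
  have -> : rad e (th + h) * sin h - h * rad e th =
    (rad e (th + h) - rad e th) * sin h + rad e th * (sin h - h) by ring.
  apply: le_trans (ler_normD _ _) _; rewrite !normrM.
  have [/andP[s0 sr] _] := radP th eI'.
  have := rad_lipschitz (th + h) th eI; rewrite [th + h]addrC addrK => rl.
  have A1 : `|rad e (h + th) - rad e th| * `|sin h| <= r * `|h| * `|h|.
    by rewrite ler_pM// norm_sin_le.
  have A2 : r * `|h| * `|h| <= a / 2 * `|h|.
    rewrite ler_wpM2r// -ler_pdivlMl// ltW//.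
    by rewrite (_ : r^-1 * (a / 2) = a / (2 * r))//; field; rewrite gt_eqF.
  have A3 : `|rad e th| * `|sin h - h| <= r * (a / (2 * r) * `|h|).
    by rewrite ler_pM// ger0_norm.
  have A4 : r * (a / (2 * r) * `|h|) = a / 2 * `|h| by field; rewrite gt_eqF.
  by move: A1 A2 A3; rewrite A4; lra.
- by rewrite mX gt_eqF// speed_gt0.
Qed.

Lemma dtime_periodic e th : dtime e (th + pi *+ 2) = dtime e th.
Proof. by rewrite /dtime /speed rad_periodic loop_periodic sinD2pi cosD2pi. Qed.

Lemma dtime_continuous e : 0 < e <= r ^+ 2 / 4 -> continuous (dtime e).
Proof.
move=> eI th; have eI' : 0 <= e <= r ^+ 2 / 4 by case/andP: eI => /ltW -> ->.
have radc : {for th, continuous (rad e)}.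
  apply/continuous_forP => a a0; exists (a / r) => [|t]; first by rewrite divr_gt0.
  rewrite ltr_pdivlMr// => td; apply: le_trans (rad_lipschitz t th eI) _.
  by rewrite mulrC ltW.
have lc l : {for th, continuous (fun t => ip l (X (loop e t)))}.
  apply: (@continuous_comp _ _ _ (X \o loop e) (ip l)); last exact: continuous_ip.
  apply: continuous_comp; first exact: loop_continuous.
  by apply: Xc; case: (loopP th eI').
apply: cvgM; first exact: radc.
apply: cvgV; first by rewrite gt_eqF// speed_gt0.
apply: cvgD; apply: cvgM; try exact: lc.
  by apply: cvgN; exact: continuous_sin.
exact: continuous_cos.
Qed.

Lemma dtime_ge e th : 0 < e <= r ^+ 2 / 4 -> 2 / (3 * om) <= dtime e th.
Proof.
move=> eI; have eI' : 0 <= e <= r ^+ 2 / 4 by case/andP: eI => /ltW -> ->.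
rewrite /dtime ler_pdivlMr ?speed_gt0//; have /andP[_] := speed_bounds th eI'.
rewrite -(ler_pM2l (_ : 0 < 2 / (3 * om))); last by rewrite divr_gt0// mulr_gt0.
move=> H; apply: le_trans H _; rewrite le_eqVlt; apply/orP; left; apply/eqP.
by field; rewrite gt_eqF.
Qed.

Lemma dtime_limit a : 0 < a -> exists2 d : R, 0 < d &
  forall e th, 0 < e <= r ^+ 2 / 4 -> e < d -> `|dtime e th - om^-1| <= a.
Proof.
(* With this [k], [speed] differs from [om * rad] by at most [a * om ^+ 2 * rad / 2], and the
   denominator [speed * om] is at least [om ^+ 2 * rad / 2]. The bound on [e] below keeps the loop
   within [d], as its radius is at most [2 * sqrt e]. *)
move=> a0; pose k := a * om ^+ 2 / (4 * M).
have k0 : 0 < k by rewrite divr_gt0 ?mulr_gt0 ?exprn_gt0.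
have [d dd0 dH] := Xfield k0.
have M2 : 0 < M ^+ 2 * 4 by rewrite mulr_gt0// exprn_gt0.
exists (d ^+ 2 / (M ^+ 2 * 4)) => [|e th eI]; first by rewrite divr_gt0// exprn_gt0.
rewrite ltr_pdivlMr// => ed.
have eI' : 0 <= e <= r ^+ 2 / 4 by case/andP: eI => /ltW -> ->.
have [Sl lM ld _] := loopP th eI'; have rp := rad_gt0 th eI; have sp := speed_gt0 th eI.
have lxd : `|loop e th - xe| < d.
  apply: le_lt_trans lM _; rewrite -(@ltr_pXn2r _ 2)// ?nnegrE ?mulr_ge0 ?(ltW M0) ?(ltW rp) ?(ltW dd0)//.
  rewrite exprMn; apply: le_lt_trans ed.
  by rewrite (_ : e * _ = M ^+ 2 * (4 * e)) ?ler_wpM2l ?sqr_ge0 ?rad_sqr//; ring.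
have [H1 H2] := dH _ Sl lxd; have := speed_near (ltW k0) eI' H1 H2.
have /andP[+ _] := speed_bounds th eI'.
have -> : dtime e th - om^-1 = - (speed e th - om * rad e th) / (speed e th * om).
  by rewrite /dtime; field; rewrite !gt_eqF.
have -> : 2 * k * M * rad e th = a * (om ^+ 2 * rad e th / 2).
  by rewrite /k; field; rewrite gt_eqF.
rewrite normrM normrN normfV [`|_ * om|]ger0_norm; last by rewrite mulr_ge0// ltW.
rewrite ler_pdivrMr ?mulr_gt0// => H3 H4; apply: le_trans H4 _; rewrite ler_wpM2l ?(ltW a0)//.
have := ler_wpM2r (ltW om0) H3; move: (rad e th) (speed e th) => ? ?; lra.
Qed.

Lemma loop_inj e th th' : 0 < e <= r ^+ 2 / 4 -> loop e th = loop e th' ->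
  ~ 0 < th' - th < pi *+ 2.
Proof.
move=> eI E /andP[h0 h2]; have eI' : 0 <= e <= r ^+ 2 / 4 by case/andP: eI => /ltW -> ->.
have [sI _] := radP th eI'; have [_ a1 a2 _] := PS th sI.
have [tI _] := radP th' eI'; have [_ b1 b2 _] := PS th' tI.
rewrite -/(loop e th) in a1 a2; rewrite -/(loop e th') -E a1 a2 in b1 b2.
have sp := rad_gt0 th eI; have tp := rad_gt0 th' eI.
have q (x : R) : x ^+ 2 = x ^+ 2 * (cos th ^+ 2 + sin th ^+ 2) by rewrite cos2Dsin2 mulr1.
have q' (x : R) : x ^+ 2 = x ^+ 2 * (cos th' ^+ 2 + sin th' ^+ 2) by rewrite cos2Dsin2 mulr1.
have ss : rad e th = rad e th'.
  apply/eqP; rewrite -(@eqrXn2 _ 2) ?(ltW sp) ?(ltW tp)//; apply/eqP.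
  by rewrite q [RHS]q' !mulrDr -!exprMn b1 b2.
have sn : rad e th' != 0 by rewrite gt_eqF.
rewrite ss in b1 b2.
have c1 : cos (th' - th) = 1.
  rewrite cosB -(mulfI sn b1) -(mulfI sn b2) -!expr2; exact: cos2Dsin2.
(* The half angle lies strictly between 0 and [pi], where the sine is positive, while
   [cos (2 * y) = 1] forces it to vanish. *)
pose y := (th' - th) / 2.
have : 0 < sin y.
  apply: sin_gt0_pi; rewrite /y divr_gt0//=.
  by rewrite ltr_pdivrMr// mulr_natr.
have yE : th' - th = y *+ 2 by rewrite -mulr_natr /y divfK.
move: c1; rewrite yE mulr2n cosD -!expr2 => c1 sy.
have := cos2Dsin2 y; have : 0 < sin y ^+ 2 by rewrite exprn_gt0.
by move: c1; lra.
Qed.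

Lemma loop_orbit e : 0 < e <= r ^+ 2 / 4 ->
  exists (T x : R), periodic_orbit X S (range (loop e)) T /\ T = pi *+ 2 * dtime e x.
Proof.
move=> eI; have eI' : 0 <= e <= r ^+ 2 / 4 by case/andP: eI => /ltW -> ->.
have pi2 : 0 < pi *+ 2 :> R by rewrite mulrn_wgt0// pi_gt0.
have c0 : 0 < 2 / (3 * om) by rewrite divr_gt0// mulr_gt0.
have [th [T [[T0 thd thT] [th0 ths thi [x xE]]]]] := quadrature pi2 c0
  (dtime_continuous eI) (dtime_periodic e) (fun x => dtime_ge x eI).
exists T, x; split=> //; split=> //; exists (loop e \o th); split.
  by move=> t; case: (loopP (th t) eI').
split.
  move=> t; have wn : dtime e (th t) != 0.
    by rewrite gt_eqF// divr_gt0 ?rad_gt0 ?speed_gt0.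
  have := is_derive_compr (is_derive_loop (th t) eI) (thd t).
  by rewrite scalerA mulVf// scale1r.
split; first by move=> t /=; rewrite thT loop_periodic.
split.
  move=> s sT /=; apply/eqP; rewrite th0 => /esym E.
  by apply: (loop_inj eI E); rewrite subr0; exact: thi.
apply/seteqP; split=> [y [z _ <-]|y [t _ <-]]; last by exists (th t).
by have [t tz] := ths z; exists t => //=; rewrite tz.
Qed.

(** By [f_low] the squared radius is at most [4 * f x], so [e <= r ^+ 2 / 4] puts the point in the
    range of [P]. *)
Lemma level_loop e x : 0 < e <= r ^+ 2 / 4 -> S x -> `|x - xe| < d0 -> f x = e ->
  range (loop e) x.
Proof.
move=> /andP[e0 er] Sx xd fx; have [lo _] := f_low Sx xd.
have [th [c1 c2]] := polar_coord (ip l1 (x - xe)) (ip l2 (x - xe)).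
set s := Num.sqrt _ in c1 c2.
have s2 : s ^+ 2 = ip l1 (x - xe) ^+ 2 + ip l2 (x - xe) ^+ 2.
  by rewrite sqr_sqrtr ?addr_ge0 ?sqr_ge0.
have sI : 0 <= s <= r.
  rewrite sqrtr_ge0 /= -(@ler_pXn2r _ 2) ?nnegrE ?sqrtr_ge0 ?(ltW r0)// s2.
  by move: lo er; rewrite fx; lra.
have xE := Pinj Sx xd sI c1 c2; exists th => //.
by rewrite /loop (radE sI)// -xE.
Qed.

Lemma f_gt0 x : S x -> `|x - xe| < d0 -> x != xe -> 0 < f x.
Proof.
move=> Sx xd xn; have [H1 H2] := f_low Sx xd.
have : 0 < `|x - xe| ^+ 2 by rewrite exprn_gt0// normr_gt0 subr_eq0.
move=> /lt_le_trans/(_ H2); rewrite pmulr_rgt0 ?exprn_gt0// => q0.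
by apply: lt_le_trans H1; rewrite divr_gt0.
Qed.

Lemma f_small a : 0 < a -> exists2 d : R, 0 < d &
  forall x, S x -> `|x - xe| < d0 -> f x < d -> `|x - xe| < a.
Proof.
move=> a0; have M2 : 0 < M ^+ 2 by rewrite exprn_gt0.
exists (a ^+ 2 / (M ^+ 2 * 4)) => [|x Sx xd]; first by rewrite divr_gt0 ?mulr_gt0 ?exprn_gt0.
rewrite ltr_pdivlMr ?mulr_gt0// => fa; have [H1 H2] := f_low Sx xd.
rewrite -(@ltr_pXn2r _ 2) ?nnegrE ?(ltW a0)//; apply: le_lt_trans H2 _; apply: le_lt_trans fa.
by rewrite mulrCA ler_wpM2l ?(ltW M2)// -ler_pdivrMr.
Qed.

(** A time shift of the periodic parametrization of the loop through [y] starts at [y]. *)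
Lemma solution_through y : S y -> `|y - xe| < d0 -> f y <= r ^+ 2 / 4 ->
  exists gam, gam 0 = y /\ fwd_sol X S gam.
Proof.
move=> Sy yd fy; have [->|yn] := eqVneq y xe.
  exists (cst xe); split=> //; split=> //; split; last exact: cvg_cst.
  by move=> t _ /=; rewrite Xxe; exact: is_derive_cst.
have eI : 0 < f y <= r ^+ 2 / 4 by rewrite f_gt0.
have [T [_ [[_ [c [cS [cX [_ [_ cE]]]]]] _]]] := loop_orbit eI.
have : range c y by rewrite -cE; exact: level_loop.
move=> [t0 _ <-]; exists (fun t => c (t + t0)); split; first by rewrite add0r.
have cd (t : R) : is_derive t 1 (fun s => c (s + t0)) (X (c (t + t0))).
  have sh : is_derive t 1 (fun z => z + t0) 1.
    by rewrite -[X in is_derive _ _ _ X]addr0; apply: is_deriveD.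
  have := @is_derive_compr _ _ c (fun z => z + t0) t 1 (X (c (t + t0))) (cX _) sh.
  by rewrite scale1r.
split=> //; split=> //; apply: cvg_at_right_filter.
by apply: differentiable_continuous; apply/derivable1_diffP; case: (cd 0).
Qed.

(** Any solution conserves [f] up to the first time it meets the sphere of radius [d2]; there its
    small value of [f] forces it strictly inside, a contradiction. *)
Lemma polar_lyapunov : lyap_stable X S xe.
Proof.
move=> eps eps0; pose d2 := Num.min eps d0 / 2.
have m0 : 0 < Num.min eps d0 by rewrite lt_min eps0.
have d20 : 0 < d2 by rewrite divr_gt0.
have d2m : d2 < Num.min eps d0 by rewrite /d2; lra.
have [d2e d2d] : d2 < eps /\ d2 < d0 by move: d2m; rewrite lt_min => /andP.
have [h h0 hH] := f_small d20.
have hr : 0 < Num.min h (r ^+ 2 / 4) by rewrite lt_min h0 divr_gt0// exprn_gt0.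
have xed : `|xe - xe| < d0 by rewrite subrr normr0.
have /continuous_forP/(_ (Num.min h (r ^+ 2 / 4) / 2))[] := fc xed; first by rewrite divr_gt0.
move=> d3 d30 d3H; exists (Num.min d3 d2) => [|y Sy]; first by rewrite lt_min d30.
rewrite lt_min => /andP[/d3H yd3 yd2]; have yd := lt_trans yd2 d2d.
have : f y < Num.min h (r ^+ 2 / 4).
  by move: yd3; rewrite fxe subr0 => /(le_trans (ler_norm _)); lra.
rewrite lt_min => /andP[fyh fyr]; split; first by apply: solution_through => //; rewrite ltW.
move=> T gam g0 [gS [gX gc]] t /andP[t0 tT]; rewrite ltNge; apply/negP => gt.
have gcw u : 0 <= u -> u <= t -> {within `[0, u], continuous gam}.
  move=> u0 ut; apply: (@right_ray_continuous _ _ gam (X \o gam)) gc => s /andP[s0 su].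
  by apply: gX; rewrite s0 (le_lt_trans su)// (le_lt_trans ut).
have Ec : {within `[0, t], continuous (fun s => `|gam s - xe|)}.
  have /subspace_continuousP H := gcw t t0 (lexx t); apply/subspace_continuousP => s sI.
  by apply: cvg_norm; apply: cvgB; [exact: H|exact: cvg_cst].
have [||t1 [/andP[t10 t1t] Et1 lo]] := @first_hit R _ t d2 t0 Ec.
- by rewrite g0.
- by rewrite (le_trans (ltW d2e)).
have gt1 : f (gam t1) = f y.
  have fgc : {within `[0, t1], continuous (f \o gam)}.
    have := gcw t1 (ltW t10) t1t.
    move=> /subspace_continuousP H; apply/subspace_continuousP => s sI.
    apply: (@cvg_comp _ _ _ gam f _ (nbhs (gam s))); first exact: H.
    apply: fc; move: sI; rewrite /= in_itv /= => /andP[s0]; rewrite le_eqVlt => /predU1P[->|st].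
      by rewrite Et1.
    by rewrite (lt_trans _ d2d)// lo// s0.
  have [|c _] := @MVT R (f \o gam) (fun=> 0) 0 t1 t10 _ fgc.
    move=> s; rewrite in_itv /= => /andP[s0 st]; apply: fX.
      by rewrite (lt_trans _ d2d)// lo// ltW.
    by apply: gX; rewrite s0 (lt_trans st)// (le_lt_trans t1t).
  by rewrite mul0r => /eqP; rewrite subr_eq0 /= g0 => /eqP.
have : `|gam t1 - xe| < d2.
  apply: hH; rewrite ?gt1 ?Et1//.
  by apply: gS; rewrite (ltW t10) (le_lt_trans t1t).
by rewrite Et1 ltxx.
Qed.

Lemma loops_union e0 : 0 < e0 <= r ^+ 2 / 4 ->
  xe |` \bigcup_(e in [set e | 0 < e < e0]) range (loop e) =
  [set x | [/\ S x, `|x - xe| < d0 & f x < e0]].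
Proof.
move=> /andP[e00 e0r]; apply/seteqP; split=> x.
  case=> [->|[e /= /andP[ep ee] [th _ <-]]]; first by rewrite /= subrr normr0 fxe.
  have eI : 0 <= e <= r ^+ 2 / 4 by rewrite (ltW ep) (le_trans (ltW ee)).
  by have [? _ ? ->] := loopP th eI.
move=> [Sx xd fx]; have [->|xn] := eqVneq x xe; first by left.
right; exists (f x); first by rewrite /= f_gt0.
by apply: level_loop => //; rewrite f_gt0//= (le_trans (ltW fx)).
Qed.

(* The sublevel set [f < e0] is open and closed in the complement of the level curve [f = e0],
   and it is connected because each of its points is joined to [xe] by a ray. *)
Lemma loops_component e0 : 0 < e0 <= r ^+ 2 / 4 ->
  (forall x, S x -> `|x - xe| < d0 -> f x <= e0 -> `|x - xe| <= d0 / 2) ->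
  xe |` \bigcup_(e in [set e | 0 < e < e0]) range (loop e) =
  connected_component (S `\` range (loop e0)) xe.
Proof.
move=> e0I e0d; rewrite loops_union//; case/andP: (e0I) => e00 e0r.
have fe0 x : range (loop e0) x -> f x = e0.
  by move=> [th _ <-]; have [_ _ _ ->] := loopP th (ltac:(by rewrite (ltW e00)) : 0 <= e0 <= r ^+ 2 / 4).
apply/seteqP; split.
  move=> x [Sx xd fx].
  have [s [th [/[dup] sI /andP[s0 sr] xE]]] : exists s th, 0 <= s <= r /\ x = P s th.
    have [->|xn] := eqVneq x xe; first by exists 0, 0; rewrite polar0.
    have eI : 0 < f x <= r ^+ 2 / 4 by rewrite f_gt0//= (le_trans (ltW fx)).
    have [th _ <-] := level_loop eI Sx xd erefl.
    exists (rad (f x) th), th; split=> //.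
    by have [] := @radP (f x) th ltac:(by case/andP: eI => /ltW -> ->).
  pose L := (fun u => P u th) @` `[0, s].
  have LC : L `<=` connected_component (S `\` range (loop e0)) xe.
    apply: connected_component_max.
    - by exists 0; rewrite ?polar0//= in_itv /= lexx.
    - move=> y [u]; rewrite /= in_itv /= => /andP[u0 us] <-.
      have uI : 0 <= u <= r by rewrite u0 (le_trans us).
      split; first by case: (PS th uI).
      move=> /fe0 fu; have := polar_incr th u0 us sr; rewrite fu -xE.
      have : 0 <= s * (s - u) by rewrite mulr_ge0// subr_ge0.
      by move: fx; nra.
    - apply: connected_continuous_connected; first exact: segment_connected.
      apply: (@lipschitz_within_continuous _ _ _ _ _ M) => u v /andP[u0 us] /andP[v0 vs].
      have := @PL u v th th; rewrite u0 v0 (le_trans us)// (le_trans vs)//.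
      by rewrite subrr normr0 mulr0 addr0; apply.
  by apply: LC; exists s => //=; rewrite in_itv /= s0 lexx.
have Cc : connected (connected_component (S `\` range (loop e0)) xe).
  exact: component_connected.
set C0 := connected_component _ _ in Cc *.
have C0S : C0 `<=` S `\` range (loop e0) by exact: connected_component_sub.
have C0xe : C0 xe.
  apply: connected_component_refl; split=> // /fe0; rewrite fxe => E.
  by move: e00; rewrite -E ltxx.
(* On the component the open set [U] and the closed set [K] agree: [e0d] keeps the sublevel set away
   from the sphere of radius [d0], and points at level [e0] have been removed. *)
pose U := [set x | `|x - xe| < d0 /\ f x < e0].
pose K := [set x | `|x - xe| <= d0 / 2 /\ f x <= e0].
have E : C0 `&` U = C0.
  apply: Cc.
  - by exists xe; split=> //; rewrite /U /= subrr normr0 fxe.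
  - exists U => //; rewrite openE => x [xd fx].
    suff : \forall y \near x, U y by [].
    have /continuous_forP/(_ ((e0 - f x) / 2))[] := fc xd; first by rewrite divr_gt0// subr_gt0.
    move=> d dd0 dH; apply/near_ballE; exists (Num.min d (d0 - `|x - xe|)).
      by rewrite lt_min dd0 subr_gt0.
    move=> y; rewrite lt_min => /andP[/dH yd yx]; split.
      rewrite -[y](subrK x) -addrA (le_lt_trans (ler_normD _ _))//.
      by rewrite -ltrBrDr.
    by move: yd => /(le_trans (ler_norm _)); lra.
  - exists K; last first.
      apply/seteqP; split=> x [C0x [xd fx]]; split=> //.
        by split; [apply: e0d => //; [case: (C0S _ C0x)|exact: ltW]|exact: ltW].
      have [Sx nx] := C0S _ C0x.
      have xd0 : `|x - xe| < d0 by apply: (le_lt_trans xd); move: d00; lra.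
      split=> //; rewrite lt_neqAle fx andbT; apply/eqP => fE; apply: nx.
      exact: level_loop.
    rewrite -openC openE => x xK.
    suff : \forall y \near x, ~ K y by [].
    have [xd|xd] := ltP (d0 / 2) `|x - xe|.
      apply/near_ballE; exists (`|x - xe| - d0 / 2) => [|y yx [yd _]]; first by rewrite subr_gt0.
      have := ler_normD (x - y) (y - xe); rewrite addrA subrK [`|x - y|]distrC.
      by move: yx yd; lra.
    have fx : e0 < f x by rewrite ltNge; apply/negP => fx; apply: xK.
    have xd0 : `|x - xe| < d0 by apply: (le_lt_trans xd); move: d00; lra.
    have /continuous_forP/(_ ((f x - e0) / 2))[] := fc xd0; first by rewrite divr_gt0// subr_gt0.
    move=> d dd0 dH; apply/near_ballE; exists d => // y /dH yd [_ fy].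
    by move: yd; rewrite distrC => /(le_trans (ler_norm _)); lra.
rewrite -E => x [C0x [xd fx]]; split=> //.
by case: (C0S _ C0x).
Qed.

Lemma polar_orbits : exists2 e0 : R, 0 < e0 &
     exists (g : R -> set 'rV[R]_n) (T : R -> R),
       (forall e, 0 < e <= e0 -> periodic_orbit X S (g e) (T e)) /\
       (forall eta : R, 0 < eta -> exists2 d : R, 0 < d &
          forall e, 0 < e <= e0 -> e < d -> forall y, g e y -> `|y - xe| < eta) /\
       (T e @[e --> 0^'+] --> 2 * pi / om) /\
       (xe |` \bigcup_(e in [set e | 0 < e < e0]) g e) =
         connected_component (S `\` g e0) xe.
Proof.
have d02 : 0 < d0 / 2 by rewrite divr_gt0.
have [d dd0 dH] := f_small d02.
have re : 0 < r ^+ 2 / 4 by rewrite divr_gt0// exprn_gt0.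
(* The term [d / 2] puts the sublevel set of [e0] within [d0 / 2], as [loops_component] requires. *)
pose e0 := Num.min (r ^+ 2 / 4) (d / 2).
have e00 : 0 < e0 by rewrite lt_min re divr_gt0.
have e0r : e0 <= r ^+ 2 / 4 by rewrite ge_min lexx.
have e0d : e0 < d by rewrite gt_min; apply/orP; right; lra.
exists e0 => //.
have /choice[T TP] : forall e, exists T, 0 < e <= r ^+ 2 / 4 ->
    exists x, periodic_orbit X S (range (loop e)) T /\ T = pi *+ 2 * dtime e x.
  move=> e; have [eI|eI] := boolP (0 < e <= r ^+ 2 / 4); last by exists 0.
  by have [T [x TP]] := loop_orbit eI; exists T => _; exists x.
have inr e : 0 < e <= e0 -> 0 < e <= r ^+ 2 / 4.
  by move=> /andP[-> ee] /=; exact: le_trans e0r.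
exists (fun e => range (loop e)), T; split.
  by move=> e /inr/TP[x []].
split.
  move=> eta eta0; have [d' d'0 d'H] := f_small eta0; exists d' => // e eI ed y [th _ <-].
  have eI' : 0 <= e <= r ^+ 2 / 4 by case/andP: (inr _ eI) => /ltW -> ->.
  by have [? _ ? fl] := loopP th eI'; apply: d'H; rewrite ?fl.
split; last first.
  apply: loops_component; first by rewrite e00.
  by move=> x Sx xd fx; apply/ltW/dH => //; exact: le_lt_trans e0d.
apply/cvgrPdist_le => a a0; rewrite near_withinE.
have pi2 : 0 < pi *+ 2 :> R by rewrite mulrn_wgt0// pi_gt0.
have [d' d'0 d'H] := dtime_limit (divr_gt0 a0 pi2).
suff : \forall e \near (0 : R), 0 < e -> `|2 * pi / om - T e| <= a by [].
apply/near_ballE; exists (Num.min d' e0) => [|e]; first by rewrite lt_min d'0.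
rewrite subr0 lt_min => /andP[ed ee0] ep; rewrite gtr0_norm// in ed ee0.
have eI : 0 < e <= r ^+ 2 / 4 by rewrite inr// ep ltW.
have [x [_ ->]] := TP _ eI; have := d'H e x eI ed.
have -> : 2 * pi / om - pi *+ 2 * dtime e x = - (pi *+ 2 * (dtime e x - om^-1)).
  by rewrite -mulr_natr; ring.
by rewrite normrN normrM gtr0_norm// -ler_pdivlMl// mulrC.
Qed.

End polar.

(** * Charts of a surface near an equilibrium *)

Section leaf_chart.
Context {R : realType} {n : nat}.
Local Notation V := 'rV[R]_n.
Implicit Types (S : set V) (X : V -> V) (f : V -> R) (x y xe l : V).

(* [S] is treated as a surface near [xe] with chart [x |-> (ip l1 (x - xe), ip l2 (x - xe))]:
   [chart_strict] says that it is strictly tangent at [xe] to the span of [x1], [x2], which makes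
   the chart injective, and [chart_onto] that the chart covers a neighbourhood of the origin. *)
Definition chart_strict S xe l1 l2 x1 x2 := forall e : R, 0 < e ->
  exists2 d : R, 0 < d & forall x y, S x -> S y -> `|x - xe| < d -> `|y - xe| < d ->
    `|x - y - (ip l1 (x - y) *: x1 + ip l2 (x - y) *: x2)| <= e * `|x - y|.

Definition chart_onto S xe l1 l2 := exists K r : R, [/\ 0 < K, 0 < r &
  forall a b, `|a| < r -> `|b| < r -> exists x, [/\ S x, ip l1 (x - xe) = a,
    ip l2 (x - xe) = b & `|x - xe| <= K * (`|a| + `|b|)]].

Definition chart_field X S xe l1 l2 (b11 b12 b21 b22 : R) := forall e : R, 0 < e ->
  exists2 d : R, 0 < d & forall x, S x -> `|x - xe| < d ->
    `|ip l1 (X x) - (b11 * ip l1 (x - xe) + b12 * ip l2 (x - xe))| <= e * `|x - xe| /\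
    `|ip l2 (X x) - (b21 * ip l1 (x - xe) + b22 * ip l2 (x - xe))| <= e * `|x - xe|.

(** The error is that of a function whose gradient is small compared with the distance to [xe]: it
    controls increments of the remainder, not just its size. *)
Definition chart_level f S xe l1 l2 := forall e : R, 0 < e ->
  exists2 d : R, 0 < d & forall x y, S x -> S y -> `|x - xe| < d -> `|y - xe| < d ->
    `|f x - f y - ((ip l1 (x - xe) ^+ 2 + ip l2 (x - xe) ^+ 2) -
        (ip l1 (y - xe) ^+ 2 + ip l2 (y - xe) ^+ 2)) / 2| <=
    e * Num.max `|x - xe| `|y - xe| * `|x - y|.

(* The last clause recovers the whole velocity of a curve in a level set of [f] from a single
   component, because such a curve can only move along [X]. *)
Definition integral_near f X S xe := exists2 d : R, 0 < d &
  [/\ forall x, `|x - xe| < d -> {for x, continuous f},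
      forall x, `|x - xe| < d -> {for x, continuous X},
      forall (c : R -> V) (t : R), `|c t - xe| < d ->
        is_derive t 1 c (X (c t)) -> is_derive t 1 (f \o c) 0 &
      forall (c : R -> V) (t : R) m (k : R), (forall s, S (c s)) -> `|c t - xe| < d ->
        {for t, continuous c} -> (forall s, f (c s) = f (c t)) ->
        is_derive t 1 (fun s => ip m (c s)) k -> ip m (X (c t)) != 0 ->
        is_derive t 1 c ((k / ip m (X (c t))) *: X (c t))].

(** With [e = 1/2] in [chart_strict], half of [|x - y|] is absorbed on the left. *)
Lemma chart_lipschitz S xe l1 l2 x1 x2 : chart_strict S xe l1 l2 x1 x2 ->
  exists L d : R, [/\ 0 < L, 0 < d & forall x y, S x -> S y ->
    `|x - xe| < d -> `|y - xe| < d ->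
    `|x - y| <= L * (`|ip l1 (x - y)| + `|ip l2 (x - y)|)].
Proof.
move=> st; have [d d0 dH] := st 2^-1 ltac:(by rewrite invr_gt0).
exists (2 * (`|x1| + `|x2| + 1)), d; split=> //.
move=> x y Sx Sy xd yd; have := dH x y Sx Sy xd yd.
set a := ip l1 _; set b := ip l2 _ => H.
have := ler_normD (x - y - (a *: x1 + b *: x2)) (a *: x1 + b *: x2); rewrite subrK.
have := ler_normD (a *: x1) (b *: x2); rewrite !normrZ.
have : 0 <= `|a| * `|x2| by rewrite mulr_ge0.
have : 0 <= `|b| * `|x1| by rewrite mulr_ge0.
have : 0 <= `|a| by []. have : 0 <= `|b| by [].
move: H (`|a|) (`|b|) (`|x1|) (`|x2|); move: (`|x - y|) (`|x - y - _|) (`|_ + _|).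
by move=> *; nra.
Qed.

Lemma norm_mulBl_le (s s' c c' h : R) : 0 <= s' -> `|c| <= 1 -> `|c - c'| <= h ->
  `|s * c - s' * c'| <= `|s - s'| + s' * h.
Proof.
move=> s'0 c1 ch; have -> : s * c - s' * c' = (s - s') * c + s' * (c - c') by ring.
rewrite (le_trans (ler_normD _ _))// !normrM lerD//; first by rewrite ler_piMr.
by rewrite ger0_norm// ler_wpM2l.
Qed.

Lemma center_chart X S f xe l1 l2 x1 x2 (om : R) : 0 < om -> S xe -> X xe = 0 -> f xe = 0 ->
  chart_strict S xe l1 l2 x1 x2 -> chart_onto S xe l1 l2 ->
  chart_field X S xe l1 l2 0 (- om) om 0 -> chart_level f S xe l1 l2 ->
  integral_near f X S xe ->
  lyap_stable X S xe /\
  exists2 e0 : R, 0 < e0 &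
     exists (g : R -> set V) (T : R -> R),
       (forall e, 0 < e <= e0 -> periodic_orbit X S (g e) (T e)) /\
       (forall eta : R, 0 < eta -> exists2 d : R, 0 < d &
          forall e, 0 < e <= e0 -> e < d -> forall y, g e y -> `|y - xe| < eta) /\
       (T e @[e --> 0^'+] --> 2 * pi / om) /\
       (xe |` \bigcup_(e in [set e | 0 < e < e0]) g e) =
         connected_component (S `\` g e0) xe.
Proof.
move=> om0 Sxe Xxe fxe st [K [rK [K0 rK0 onto]]] fld lev [d1 d10 [fc Xc fX Xcurve]].
have [L [d2 [L0 d20 Lip]]] := chart_lipschitz st.
(* The coordinates of [P s th] have absolute sum at most [2 * s], so [2 * K] bounds its distance to
   [xe]; likewise [2 * L] is the Lipschitz constant needed for [PL]. *)
pose M := 2 * (K + L); have M0 : 0 < M by rewrite mulr_gt0// addr_gt0.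
have M20 : 0 < M ^+ 2 by rewrite exprn_gt0.
have LM : 2 * L <= M by rewrite /M; lra.
have KM : 2 * K <= M by rewrite /M; lra.
clearbody M.
(* One factor [M] comes from the distance to [xe] and one from the distance between the two points;
   dividing by [8 * M ^+ 2] leaves the 1/8 of [Pf]. *)
have [d3 d30 d3H] := lev (8 * M ^+ 2)^-1 ltac:(by rewrite invr_gt0 mulr_gt0).
have [d4 d40 d4H] := fld (om / (4 * M)) ltac:(by rewrite divr_gt0// mulr_gt0).
pose d0 := Num.min (Num.min d1 d2) (Num.min d3 d4).
have d00 : 0 < d0 by rewrite !lt_min d10 d20 d30.
have d0P (x : V) : `|x - xe| < d0 ->
    [/\ `|x - xe| < d1, `|x - xe| < d2, `|x - xe| < d3 & `|x - xe| < d4].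
  by rewrite !lt_min => /andP[/andP[-> ->] /andP[-> ->]].
pose r := Num.min (rK / 2) (d0 / (2 * M)).
have r0 : 0 < r by rewrite lt_min !divr_gt0// mulr_gt0.
have rrK : r < rK by rewrite gt_min; apply/orP; left; lra.
have Mr : M * r < d0.
  apply: (@le_lt_trans _ _ (d0 / 2)); last by lra.
  rewrite -ler_pdivlMl// ge_min; apply/orP; right.
  by rewrite (_ : M^-1 * (d0 / 2) = d0 / (2 * M))//; field; rewrite gt_eqF.
have /choice[psi' psiP'] : forall ab : R * R, exists x, `|ab.1| < rK -> `|ab.2| < rK ->
    [/\ S x, ip l1 (x - xe) = ab.1, ip l2 (x - xe) = ab.2 & `|x - xe| <= K * (`|ab.1| + `|ab.2|)].
  move=> [a b] /=; have [H|H] := boolP ((`|a| < rK) && (`|b| < rK)).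
    by case/andP: H => /onto H /H[x xP]; exists x.
  by exists xe => a1 b1; rewrite a1 b1 in H.
(* Points are chosen by Cartesian coordinates, so that [P] is automatically periodic in the
   angle. *)
pose P s th := psi' (s * cos th, s * sin th).
have c1 (th : R) : `|cos th| <= 1 by rewrite ler_norml cos_geN1 cos_le1.
have s1 (th : R) : `|sin th| <= 1 by rewrite ler_norml sin_geN1 sin_le1.
have PS s th : 0 <= s <= r -> [/\ S (P s th), ip l1 (P s th - xe) = s * cos th,
    ip l2 (P s th - xe) = s * sin th & `|P s th - xe| <= M * s].
  move=> /andP[sp sr].
  have cs : `|s * cos th| <= s by rewrite normrM ger0_norm// ler_piMr.
  have ss : `|s * sin th| <= s by rewrite normrM ger0_norm// ler_piMr.
  have srK : s < rK by exact: le_lt_trans rrK.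
  have [] := psiP' (s * cos th, s * sin th) (le_lt_trans cs srK) (le_lt_trans ss srK).
  move=> /= SP P1 P2 PK; split=> //; apply: le_trans PK _.
  apply: le_trans (ler_wpM2r sp KM).
  by rewrite -mulrA mulrCA ler_wpM2l ?(ltW K0)//; move: cs ss; lra.
have Pd s th : 0 <= s <= r -> `|P s th - xe| < d0.
  move=> sI; have [_ _ _ H] := PS s th sI; apply: le_lt_trans H (le_lt_trans _ Mr).
  by rewrite ler_wpM2l ?(ltW M0)//; case/andP: sI.
have Lip0 x y : S x -> S y -> `|x - xe| < d0 -> `|y - xe| < d0 ->
    `|x - y| <= L * (`|ip l1 (x - xe) - ip l1 (y - xe)| + `|ip l2 (x - xe) - ip l2 (y - xe)|).
  move=> Sx Sy /d0P[_ xd _ _] /d0P[_ yd _ _]; have := Lip _ _ Sx Sy xd yd.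
  by rewrite -!ipBr opprB !addrA subrK.
have PL s s' th th' : 0 <= s <= r -> 0 <= s' <= r ->
    `|P s th - P s' th'| <= M * (`|s - s'| + s' * `|th - th'|).
  move=> sI s'I; have [SP P1 P2 _] := PS s th sI; have [SP' P1' P2' _] := PS s' th' s'I.
  have := Lip0 _ _ SP SP' (Pd _ _ sI) (Pd _ _ s'I); rewrite P1 P2 P1' P2'.
  have s'0 : 0 <= s' by case/andP: s'I.
  have A := norm_mulBl_le s s'0 (c1 th) (cos_lipschitz th th').
  have B := norm_mulBl_le s s'0 (s1 th) (sin_lipschitz th th').
  have q0 : 0 <= `|s - s'| + s' * `|th - th'| by rewrite addr_ge0// mulr_ge0.
  move=> H; apply: le_trans H _; apply: le_trans (ler_wpM2r q0 LM).
  by rewrite -mulrA mulrCA ler_wpM2l ?(ltW L0)//; move: A B; lra.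
have Pf s s' th th' : 0 <= s <= r -> 0 <= s' <= r ->
  `|f (P s th) - f (P s' th') - (s ^+ 2 - s' ^+ 2) / 2| <=
  8^-1 * Num.max s s' * (`|s - s'| + s' * `|th - th'|).
  move=> sI s'I; have [SP P1 P2 PM] := PS s th sI; have [SP' P1' P2' PM'] := PS s' th' s'I.
  have [_ _ Pd3 _] := d0P _ (Pd s th sI); have [_ _ Pd3' _] := d0P _ (Pd s' th' s'I).
  have := d3H _ _ SP SP' Pd3 Pd3'; rewrite P1 P2 P1' P2' !exprMn -!mulrDr !cos2Dsin2 !mulr1.
  move=> H; apply: le_trans H _.
  have e0 : 0 <= (8 * M ^+ 2)^-1 by rewrite invr_ge0 mulr_ge0// ltW.
  have mm : 0 <= Num.max s s' by rewrite le_max; case/andP: sI => ->.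
  have A : Num.max `|P s th - xe| `|P s' th' - xe| <= M * Num.max s s'.
    rewrite ge_max (le_trans PM) ?(le_trans PM')// ler_wpM2l ?(ltW M0)// le_max lexx ?orbT//.
  apply: (@le_trans _ _ ((8 * M ^+ 2)^-1 * (M * Num.max s s') *
      (M * (`|s - s'| + s' * `|th - th'|)))).
    apply: ler_pM => //; last exact: PL.
      by rewrite mulr_ge0// le_max normr_ge0.
    exact: ler_wpM2l.
  by rewrite le_eqVlt; apply/orP; left; apply/eqP; field; rewrite gt_eqF.
have f_low x : S x -> `|x - xe| < d0 ->
  (ip l1 (x - xe) ^+ 2 + ip l2 (x - xe) ^+ 2) / 4 <= f x /\
  `|x - xe| ^+ 2 <= M ^+ 2 * (ip l1 (x - xe) ^+ 2 + ip l2 (x - xe) ^+ 2).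
  move=> Sx xd; have xed : `|xe - xe| < d0 by rewrite subrr normr0.
  have := Lip0 _ _ Sx Sxe xd xed; rewrite subrr !ip0r !subr0.
  have [_ _ xd3 _] := d0P _ xd; have [_ _ xed3 _] := d0P _ xed.
  have := d3H _ _ Sx Sxe xd3 xed3; rewrite fxe subrr !ip0r expr0n /= addr0 !subr0 normr0.
  rewrite max_l// -mulrA -expr2; set a := ip l1 _; set b := ip l2 _ => H1 H2.
  have H3 : `|x - xe| ^+ 2 <= M ^+ 2 * (a ^+ 2 + b ^+ 2).
    apply: (@le_trans _ _ ((L * (`|a| + `|b|)) ^+ 2)).
      by rewrite ler_pXn2r ?nnegrE// mulr_ge0 ?addr_ge0// ltW.
    rewrite exprMn; apply: (@le_trans _ _ (L ^+ 2 * (2 * (a ^+ 2 + b ^+ 2)))).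
      rewrite ler_wpM2l ?sqr_ge0// -[a ^+ 2]real_normK ?num_real// -[b ^+ 2]real_normK ?num_real//.
      have := sqr_ge0 (`|a| - `|b|); rewrite sqrrB sqrrD.
      by move: (`|a|) (`|b|); clear => ? ?; lra.
    rewrite mulrA ler_wpM2r ?addr_ge0 ?sqr_ge0//.
    apply: (@le_trans _ _ ((2 * L) ^+ 2)); last by rewrite ler_pXn2r ?nnegrE// ?mulr_ge0 ?(ltW L0) ?(ltW M0).
    by rewrite exprMn; have := sqr_ge0 L; clear; lra.
  split=> //; have : (8 * M ^+ 2)^-1 * `|x - xe| ^+ 2 <= 8^-1 * (a ^+ 2 + b ^+ 2).
    by rewrite invfM -mulrA ler_wpM2l ?invr_ge0// ler_pdivrMl.
  move: H1; rewrite ler_norml => /andP[H1 _] H4.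
  have := sqr_ge0 a; have := sqr_ge0 b; move: H1 H4.
  by move: (_^-1 * _ ^+ 2) (a ^+ 2) (b ^+ 2) (f x); clear => *; lra.
have P2pi s th : P s (th + pi *+ 2) = P s th by rewrite /P cosD2pi sinD2pi.
have Pinj x : S x -> `|x - xe| < d0 -> forall s th, 0 <= s <= r ->
    ip l1 (x - xe) = s * cos th -> ip l2 (x - xe) = s * sin th -> x = P s th.
  move=> Sx xd s th sI x1E x2E; have [SP P1 P2 _] := PS s th sI.
  have := Lip0 _ _ Sx SP xd (Pd _ _ sI); rewrite P1 P2 x1E x2E !subrr normr0 addr0 mulr0.
  by rewrite normr_le0 subr_eq0 => /eqP.
have fldE x : ip l1 (X x) - (0 * ip l1 (x - xe) + - om * ip l2 (x - xe)) =
    ip l1 (X x) + om * ip l2 (x - xe) /\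
    ip l2 (X x) - (om * ip l1 (x - xe) + 0 * ip l2 (x - xe)) =
    ip l2 (X x) - om * ip l1 (x - xe) by split; ring.
have Xfield e : 0 < e -> exists2 d : R, 0 < d & forall x, S x -> `|x - xe| < d ->
    `|ip l1 (X x) + om * ip l2 (x - xe)| <= e * `|x - xe| /\
    `|ip l2 (X x) - om * ip l1 (x - xe)| <= e * `|x - xe|.
  move=> /fld[d dd0 dH]; exists d => // x Sx xd.
  by have := dH x Sx xd; rewrite (fldE x).1 (fldE x).2.
have Xfield0 x : S x -> `|x - xe| < d0 ->
    `|ip l1 (X x) + om * ip l2 (x - xe)| <= om / (4 * M) * `|x - xe| /\
    `|ip l2 (X x) - om * ip l1 (x - xe)| <= om / (4 * M) * `|x - xe|.
  move=> Sx /d0P[_ _ _ xd].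
  by have := d4H x Sx xd; rewrite (fldE x).1 (fldE x).2.
have fc' x : `|x - xe| < d0 -> {for x, continuous f} by move=> /d0P[/fc].
have Xc' x : `|x - xe| < d0 -> {for x, continuous X} by move=> /d0P[/Xc].
have fX' (c : R -> V) (t : R) : `|c t - xe| < d0 ->
    is_derive t 1 c (X (c t)) -> is_derive t 1 (f \o c) 0.
  by move=> /d0P[H _ _ _]; exact: fX.
have Xcurve' (c : R -> V) (t : R) m (k : R) : (forall s, S (c s)) -> `|c t - xe| < d0 ->
    {for t, continuous c} -> (forall s, f (c s) = f (c t)) ->
    is_derive t 1 (fun s => ip m (c s)) k -> ip m (X (c t)) != 0 ->
    is_derive t 1 c ((k / ip m (X (c t))) *: X (c t)).
  by move=> Sc /d0P[H _ _ _]; exact: Xcurve.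
split.
  exact: (polar_lyapunov om0 r0 M0 Mr Sxe fxe Xxe PS P2pi PL Pf Pinj f_low fc' fX' Xc' Xcurve').
exact: (polar_orbits om0 r0 M0 Mr Sxe fxe PS P2pi PL Pf Pinj f_low fc' Xc' Xcurve' Xfield Xfield0).
Qed.

End leaf_chart.

(** * Instability at a saddle *)

Section saddle.
Context {R : realType} {n : nat}.
Local Notation V := 'rV[R]_n.

Lemma is_derive_ipB (z : R -> V) (l xe v : V) (t : R) : is_derive t 1 z v ->
  is_derive t 1 (fun s => ip l (z s - xe)) (ip l v).
Proof.
move=> zd; apply: is_derive_ip; rewrite -[v]subr0.
exact: (@is_deriveB _ _ _ z (cst xe) t 1 _ _ zd (is_derive_cst xe t 1)).
Qed.

Lemma is_derive_quad (u1 u2 : R -> R) (t d1 d2 p q r : R) :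
  is_derive t 1 u1 d1 -> is_derive t 1 u2 d2 ->
  is_derive t 1 (fun s => p * u1 s ^+ 2 + q * (u1 s * u2 s) + r * u2 s ^+ 2)
    (2 * p * (u1 t * d1) + q * (d1 * u2 t + u1 t * d2) + 2 * r * (u2 t * d2)).
Proof.
move=> H1 H2; rewrite (_ : (fun s => _) = p *: (u1 * u1) + q *: (u1 * u2) + r *: (u2 * u2)).
  rewrite [X in is_derive _ _ _ X](_ : _ = p *: (u1 t *: d1 + u1 t *: d1) +
      q *: (u1 t *: d2 + u2 t *: d1) + r *: (u2 t *: d2 + u2 t *: d2)); last first.
    by rewrite /GRing.scale /=; ring.
  have M11 := @is_deriveM _ _ u1 u1 t 1 _ _ H1 H1.
  have M12 := @is_deriveM _ _ u1 u2 t 1 _ _ H1 H2.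
  have M22 := @is_deriveM _ _ u2 u2 t 1 _ _ H2 H2.
  exact: (@is_deriveD _ _ _ _ _ t 1 _ _ (@is_deriveD _ _ _ _ _ t 1 _ _
    (@is_deriveZ _ _ _ _ p t 1 _ M11) (@is_deriveZ _ _ _ _ q t 1 _ M12))
    (@is_deriveZ _ _ _ _ r t 1 _ M22)).
by apply/funext => s; rewrite !fctE /= !expr2.
Qed.

Lemma saddle_unstable (X : V -> V) (S : set V) (xe l1 l2 x1 x2 : V) (a b c : R) :
  S xe -> chart_strict S xe l1 l2 x1 x2 -> chart_onto S xe l1 l2 ->
  chart_field X S xe l1 l2 a b c (- a) -> 0 < a ^+ 2 + b * c ->
  ~ lyap_stable X S xe.
Proof.
move=> Sxe st [K [r [K0 r0 onto]]] fld D0 stable; set D := _ + _ in D0.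
(* For [B] the linear part, [W u] is [u . B u]; as [B ^ 2] is [D] times the identity, [W]
   grows along the linear flow at the rate [|B u| ^ 2 + D |u| ^ 2]. *)
pose W (u1 u2 : R) := a * u1 ^+ 2 + (b + c) * (u1 * u2) - a * u2 ^+ 2.
pose k := 2 * `|a| + `|b + c| + 1.
have k0 : 0 < k by rewrite ltr_wpDl// addr_ge0.
have Wk u1 u2 : W u1 u2 <= k * (u1 ^+ 2 + u2 ^+ 2).
  have A : a * u1 ^+ 2 <= `|a| * u1 ^+ 2 by rewrite ler_wpM2r ?sqr_ge0 ?ler_norm.
  have B : - a * u2 ^+ 2 <= `|a| * u2 ^+ 2 by rewrite ler_wpM2r ?sqr_ge0// -normrN ler_norm.
  have C : (b + c) * (u1 * u2) <= `|b + c| * ((u1 ^+ 2 + u2 ^+ 2) / 2).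
    rewrite (le_trans (ler_norm _))// normrM ler_wpM2l//.
    by rewrite ler_norml; have := sqr_ge0 (u1 - u2); have := sqr_ge0 (u1 + u2);
      rewrite sqrrB sqrrD => ? ?; apply/andP; split; lra.
  have := sqr_ge0 u1; have := sqr_ge0 u2; have : 0 <= `|b + c| by []. have : 0 <= `|a| by [].
  have : 0 <= `|b + c| * (u1 ^+ 2 + u2 ^+ 2) by rewrite mulr_ge0 ?addr_ge0 ?sqr_ge0.
  have : 0 <= `|a| * (u1 ^+ 2 + u2 ^+ 2) by rewrite mulr_ge0 ?addr_ge0 ?sqr_ge0.
  by rewrite /W /k; move: A B C; move: (`|a|) (`|b + c|) (u1 ^+ 2) (u2 ^+ 2) => *; lra.
(* [W] is trace-free, hence indefinite unless it is zero, and [W = 0] would mean [a = 0], [b = - c]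
   and thus [D <= 0]. *)
have [p [q Wpq]] : exists p q, 0 < W p q.
  have [a0|a0|a0] := ltgtP 0 a.
  - by exists 1, 0; rewrite /W; lra.
  - by exists 0, 1; rewrite /W; lra.
  exists 1, (if 0 < b + c then 1 else -1); rewrite /W; case: ifP => [|/negbT]; first by lra.
  rewrite -leNgt le_eqVlt => /predU1P[bc|]; last by lra.
  move: D0; rewrite /D -a0 (_ : b = - c); last by lra.
  by have := sqr_ge0 c; rewrite expr2; nra.
have [L [d1 [L0 d10 Lip]]] := chart_lipschitz st.
(* Chosen so that the nonlinear part of the field changes the derivative of [w] by at most
   [D / 4 * |u|^2]. *)
have e0 : 0 < D / (8 * L * k) by rewrite divr_gt0// !mulr_gt0.
have [d2 d20 d2H] := fld _ e0.
pose eps := Num.min d1 d2; have eps0 : 0 < eps by rewrite lt_min d10.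
have [del del0 delH] := stable eps eps0.
pose pq := `|p| + `|q| + 1; have pq0 : 0 < pq by rewrite ltr_wpDl// addr_ge0.
pose s := Num.min r (del / K) / (2 * pq).
have s0 : 0 < s by rewrite divr_gt0 ?mulr_gt0// lt_min r0 divr_gt0.
have spq : s * pq < Num.min r (del / K).
  have : 0 < Num.min r (del / K) by rewrite lt_min r0 divr_gt0.
  have -> : s * pq = Num.min r (del / K) / 2 by rewrite /s; field; rewrite gt_eqF.
  by lra.
clearbody s; move: spq; rewrite lt_min => /andP[spr spd].
have [y [Sy y1 y2 yK]] : exists x, [/\ S x, ip l1 (x - xe) = s * p,
    ip l2 (x - xe) = s * q & `|x - xe| <= K * (`|s * p| + `|s * q|)].
  by apply: onto; apply: le_lt_trans spr; rewrite normrM gtr0_norm// ler_wpM2l ?(ltW s0)//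
    /pq; have := normr_ge0 p; have := normr_ge0 q; lra.
have yd : `|y - xe| < del.
  apply: le_lt_trans yK _; rewrite -ltr_pdivlMl// [K^-1 * _]mulrC; apply: le_lt_trans spd.
  by rewrite !normrM [`|s|]gtr0_norm// -mulrDr ler_wpM2l ?(ltW s0)// /pq lerDl.
(* Stability itself supplies a solution for all positive times and confines it; along it [w] stays
   bounded. *)
have [[gam [g0 [gS [gX gc]]]] conf] := delH y Sy yd.
have gE t : 0 <= t -> `|gam t - xe| < eps.
  move=> t0; apply: (conf (t + 1) gam g0); last by rewrite t0 ltrDl ltr01.
  split; first by move=> u /andP[u0 _]; exact: gS.
  by split=> // u /andP[u0 _]; exact: gX.
pose u1 t := ip l1 (gam t - xe); pose u2 t := ip l2 (gam t - xe).
pose w t := W (u1 t) (u2 t).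
pose du1 t := ip l1 (X (gam t)); pose du2 t := ip l2 (X (gam t)).
pose dw t := 2 * a * (u1 t * du1 t) + (b + c) * (du1 t * u2 t + u1 t * du2 t) +
  2 * (- a) * (u2 t * du2 t).
have wd (t : R) : 0 < t -> is_derive t 1 w (dw t).
  move=> /gX gd; rewrite (_ : w = fun s =>
    a * u1 s ^+ 2 + (b + c) * (u1 s * u2 s) + - a * u2 s ^+ 2).
    by apply: is_derive_quad; exact: is_derive_ipB.
  by apply/funext => z; rewrite /w /W mulNr.
have dw_ge t : 0 <= t -> D / 2 * (u1 t ^+ 2 + u2 t ^+ 2) <= dw t.
  move=> t0; have := gE t t0; rewrite lt_min => /andP[xd1 xd2].
  have xed : `|xe - xe| < d1 by rewrite subrr normr0.
  have := Lip _ _ (gS t t0) Sxe xd1 xed; rewrite -/(u1 t) -/(u2 t) => H.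
  have [] := d2H _ (gS t t0) xd2; rewrite -/(u1 t) -/(u2 t) -/(du1 t) -/(du2 t) /dw.
  set h := `|u1 t| + `|u2 t| in H.
  have h0 : 0 <= h by rewrite addr_ge0.
  have h2 : h ^+ 2 <= 2 * (u1 t ^+ 2 + u2 t ^+ 2).
    rewrite -[u1 t ^+ 2]real_normK ?num_real// -[u2 t ^+ 2]real_normK ?num_real//.
    by have := sqr_ge0 (`|u1 t| - `|u2 t|); rewrite /h sqrrB sqrrD; lra.
  move=> H1 H2.
  pose m := D / (8 * L * k) * (L * h).
  have m0 : 0 <= m by rewrite mulr_ge0 ?(ltW e0) ?mulr_ge0 ?(ltW L0).
  have {}H1 := le_trans H1 (ler_wpM2l (ltW e0) H).
  have {}H2 := le_trans H2 (ler_wpM2l (ltW e0) H).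
  rewrite -/m in H1 H2.
  have [e1 e1E] : exists e1, du1 t = a * u1 t + b * u2 t + e1.
    by exists (du1 t - (a * u1 t + b * u2 t)); ring.
  have [e2 e2E] : exists e2, du2 t = c * u1 t - a * u2 t + e2.
    by exists (du2 t - (c * u1 t - a * u2 t)); ring.
  move: H1 H2; rewrite e1E e2E mulNr !(addrC _ e1, addrC _ e2) !addrK => H1 H2.
  pose err := 2 * a * (u1 t * e1) + (b + c) * (e1 * u2 t + u1 t * e2) - 2 * a * (u2 t * e2).
  have errB : `|err| <= k * (m * h).
    have A : `|2 * a * (u1 t * e1)| <= 2 * `|a| * (`|u1 t| * m).
      by rewrite !normrM ger0_norm// !ler_wpM2l// mulr_ge0.
    have B : `|(b + c) * (e1 * u2 t + u1 t * e2)| <= `|b + c| * (m * h).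
      rewrite normrM ler_wpM2l// (le_trans (ler_normD _ _))// !normrM /h mulrDr addrC lerD//.
        by rewrite mulrC ler_wpM2r.
      by rewrite ler_wpM2r.
    have E : `|2 * a * (u2 t * e2)| <= 2 * `|a| * (`|u2 t| * m).
      by rewrite !normrM ger0_norm// !ler_wpM2l// mulr_ge0.
    rewrite /err; apply: le_trans (ler_normB _ _) _; apply: le_trans (lerD (ler_normD _ _) (lexx _)) _.
    have : 0 <= m * h by rewrite mulr_ge0.
    rewrite /k; move: A B E; rewrite /h.
    by move: (`|u1 t|) (`|u2 t|); clear => v1 v2 *; lra.
  have errD : k * (m * h) <= D / 4 * (u1 t ^+ 2 + u2 t ^+ 2).
    have -> : k * (m * h) = D / 8 * h ^+ 2 by rewrite /m; field; rewrite !gt_eqF.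
    by have := ler_wpM2l (ltW D0) h2; clear; lra.
  have := le_trans errB errD; rewrite ler_norml => /andP[+ _].
  have := sqr_ge0 (a * u1 t + b * u2 t); have := sqr_ge0 (c * u1 t - a * u2 t).
  have : 0 <= D * (u1 t ^+ 2 + u2 t ^+ 2) by rewrite mulr_ge0 ?(ltW D0) ?addr_ge0 ?sqr_ge0.
  by rewrite /err /D; move: (u1 t) (u2 t); clear => v1 v2 ? ? ? ?; lra.
have uc l : ip l (gam t - xe) @[t --> 0^'+] --> ip l (gam 0 - xe).
  apply: (@cvg_comp _ _ _ (fun t => gam t - xe) (ip l) _ (nbhs (gam 0 - xe))).
    exact: (cvgB gc (cvg_cst xe)).
  exact: continuous_ip.
have wc : w t @[t --> 0^'+] --> w 0.
  have c1 := uc l1; have c2 := uc l2; rewrite -/(u1 0) -/(u2 0) in c1 c2.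
  have -> : w = fun t => a * (u1 t * u1 t) + (b + c) * (u1 t * u2 t) - a * (u2 t * u2 t).
    by apply/funext => t; rewrite /w /W !expr2.
  exact: (cvgB (cvgD (cvgM (cvg_cst a) (cvgM c1 c1)) (cvgM (cvg_cst (b + c)) (cvgM c1 c2)))
    (cvgM (cvg_cst a) (cvgM c2 c2))).
have wmvt t : 0 < t -> exists2 z, 0 < z & w t - w 0 = dw z * t.
  move=> t0; have wct : {within `[0, t], continuous w}.
    by apply: (@right_ray_continuous _ _ w dw) wc => z /andP[z0 _]; exact: wd.
  have [|z] := @MVT R w dw 0 t t0 _ wct.
    by move=> z; rewrite in_itv /= => /andP[z0 _]; exact: wd.
  by rewrite in_itv /= subr0 => /andP[z0 _] E; exists z.
have w0 : 0 < w 0.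
  rewrite /w /u1 /u2 g0 y1 y2; have -> : W (s * p) (s * q) = s ^+ 2 * W p q by rewrite /W; ring.
  by rewrite mulr_gt0 ?exprn_gt0.
have wmono t : 0 < t -> w 0 <= w t.
  move=> t0; have [z z0 E] := wmvt t t0; rewrite -subr_ge0 E mulr_ge0// ?(ltW t0)//.
  apply: le_trans (dw_ge z (ltW z0)).
  by rewrite mulr_ge0 ?divr_ge0 ?(ltW D0) ?addr_ge0 ?sqr_ge0.
have [K1 K10 K1P] := ip_bounded l1; have [K2 K20 K2P] := ip_bounded l2.
pose N := k * ((K1 * eps) ^+ 2 + (K2 * eps) ^+ 2).
have wN t : 0 <= t -> w t <= N.
  move=> t0; apply: le_trans (Wk _ _) _; rewrite ler_wpM2l ?(ltW k0)//.
  have A l Kl : 0 < Kl -> (forall v, `|ip l v| <= Kl * `|v|) ->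
      ip l (gam t - xe) ^+ 2 <= (Kl * eps) ^+ 2.
    move=> Kl0 KlP; rewrite -real_normK ?num_real// ler_pXn2r ?nnegrE ?mulr_ge0 ?(ltW Kl0) ?(ltW eps0)//.
    by apply: le_trans (KlP _) _; rewrite ler_wpM2l ?(ltW Kl0) ?(ltW (gE _ _)).
  by rewrite lerD// A.
have N0 : 0 <= N by rewrite mulr_ge0 ?(ltW k0) ?addr_ge0 ?sqr_ge0.
(* Since [w] does not decrease and [|u|^2 >= w / k], its derivative is at least [D / (2 * k) * w 0];
   after time [t] it has gained [N + 1], above its bound [N]. *)
pose t := (N + 1) * (2 * k) / (D * w 0).
have t0 : 0 < t by rewrite divr_gt0 ?mulr_gt0// ltr_wpDl.
have [z z0 E] := wmvt t t0.
have : D / (2 * k) * w 0 <= dw z.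
  apply: le_trans (dw_ge z (ltW z0)).
  have -> : D / (2 * k) * w 0 = D / 2 * (k^-1 * w 0) by field; rewrite gt_eqF.
  rewrite ler_wpM2l ?divr_ge0 ?(ltW D0)// ler_pdivrMl//.
  exact: le_trans (wmono z z0) (Wk _ _).
move=> /(ler_wpM2r (ltW t0)); rewrite -E.
have -> : D / (2 * k) * w 0 * t = N + 1 by rewrite /t; field; rewrite !gt_eqF.
by have := wN t (ltW t0); lra.
Qed.

End saddle.

(** * Linearization of the flow *)

(** The constant [c] carries an inhomogeneous term: 0 for the growth of a solution, the square of
    the field error for its deviation from the linear flow. *)
Lemma gronwall (R : realType) (E dE : R -> R) (k c t : R) : 0 <= t ->
  (forall s : R, 0 <= s <= t -> is_derive s 1 E (dE s)) ->
  (forall s, 0 <= s <= t -> dE s <= k * (E s + c)) ->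
  E t + c <= (E 0 + c) * expR (k * t).
Proof.
rewrite le_eqVlt => /predU1P[<- _ _|t0 Ed Ek]; first by rewrite mulr0 expR0 mulr1.
pose G (s : R) := (E s + c) * expR (- k * s).
have Gd (s : R) : 0 <= s <= t ->
    is_derive s 1 G ((E s + c) * (expR (- k * s) * - k) + expR (- k * s) * dE s).
  move=> sI; have H1 : is_derive s 1 (fun u => E u + c) (dE s).
    by rewrite -[dE s]addr0; exact: (@is_deriveD _ _ _ E (cst c) s 1 _ _ (Ed s sI) (is_derive_cst c s 1)).
  have H2 : is_derive s 1 (fun u => expR (- k * u)) (expR (- k * s) * - k).
    have H : is_derive s 1 (fun u => - k * u) (- k).
      by rewrite -[X in is_derive _ _ _ X]mulr1; exact: (@is_deriveZ _ _ _ id (- k) s 1 _ (is_derive_id s 1)).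
    exact: (@is_derive1_comp _ expR (fun u => - k * u) s _ _ (is_derive_expR _) H).
  exact: (@is_deriveM _ _ _ _ s 1 _ _ H1 H2).
have [z /andP[z0 zt] H] := MVT_derive t0 Gd.
have : G t <= G 0.
  rewrite -subr_le0 H mulr_le0_ge0 ?subr_ge0 ?(ltW t0)//.
  have := Ek z; rewrite (ltW z0) (ltW zt) => /(_ isT) Hz.
  have -> : (E z + c) * (expR (- k * z) * - k) + expR (- k * z) * dE z =
    expR (- k * z) * (dE z - k * (E z + c)) by ring.
  by rewrite mulr_ge0_le0 ?expR_ge0// subr_le0.
rewrite /G mulr0 expR0 mulr1 mulNr expRN => /(ler_wpM2r (expR_ge0 (k * t))).
by rewrite mulfVK ?gt_eqF ?expR_gt0.
Qed.

Lemma is_derive_lincomb (R : realType) (p q : R -> R) (x y t dp dq : R) :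
  is_derive t 1 p dp -> is_derive t 1 q dq ->
  is_derive t 1 (fun s => p s * x + q s * y) (dp * x + dq * y).
Proof.
move=> H1 H2; rewrite (_ : (fun s => _) = x *: p + y *: q).
  rewrite [dp * x]mulrC [dq * y]mulrC.
  exact: (@is_deriveD _ _ _ _ _ t 1 _ _ (@is_deriveZ _ _ _ p x t 1 _ H1)
    (@is_deriveZ _ _ _ q y t 1 _ H2)).
by apply/funext => u; rewrite !fctE -![_ *: _]/(_ * _); ring.
Qed.

Section linearization.
Context {R : realType} {n : nat}.
Local Notation V := 'rV[R]_n.
Implicit Types (X : V -> V) (S : set V).

(* [p * v + q * (B v)], with [B] the trace-free linear part: as [B ^ 2] is a scalar matrix, the
   linear flow at time [t] has this form for some numbers [p t] and [q t]. *)
Definition lin_flow (l1 l2 x1 x2 : V) (a b c p q : R) (v : V) : V :=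
  (p * ip l1 v + q * (a * ip l1 v + b * ip l2 v)) *: x1 +
  (p * ip l2 v + q * (c * ip l1 v - a * ip l2 v)) *: x2.

(* A solution starting at distance [rho] of the equilibrium stays within [O(rho)] of it
   on a fixed time interval, so that the field differs there from its linear part by [o(rho)]. *)
Lemma flow_expansion X S (xe l1 l2 x1 x2 : V) (a b c t0 : R) (p q : R -> R) : 0 < t0 ->
  S xe -> chart_strict S xe l1 l2 x1 x2 -> chart_field X S xe l1 l2 a b c (- a) ->
  p 0 = 1 -> q 0 = 0 ->
  (forall t : R, is_derive t 1 p ((a ^+ 2 + b * c) * q t)) ->
  (forall t : R, is_derive t 1 q (p t)) ->
  forall e, 0 < e -> exists2 d : R, 0 < d & forall z : R -> V,
    (forall s, 0 <= s <= t0 -> S (z s)) ->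
    (forall s : R, 0 <= s <= t0 -> is_derive s 1 z (X (z s))) ->
    `|z 0 - xe| < d -> forall t, 0 <= t <= t0 ->
    `|z t - xe - lin_flow l1 l2 x1 x2 a b c (p t) (q t) (z 0 - xe)| <= e * `|z 0 - xe|.
Proof.
move=> t00 Sxe st fld p0 q0 pd qd e e0.
have [L [d1 [L0 d10 Lip]]] := chart_lipschitz st.
have [d2 d20 d2H] := fld 1 ltr01.
have [K1 K10 K1P] := ip_bounded l1; have [K2 K20 K2P] := ip_bounded l2.
pose be := `|a| + `|b| + `|c|; have be0 : 0 <= be by rewrite !addr_ge0.
have bil (v1 v2 : R) : v1 * (a * v1 + b * v2) + v2 * (c * v1 - a * v2) <= be * (v1 ^+ 2 + v2 ^+ 2).
  have A : a * v1 ^+ 2 <= `|a| * v1 ^+ 2 by rewrite ler_wpM2r ?sqr_ge0 ?ler_norm.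
  have A' : - a * v2 ^+ 2 <= `|a| * v2 ^+ 2 by rewrite ler_wpM2r ?sqr_ge0// -normrN ler_norm.
  have B u : u * (v1 * v2) <= `|u| * ((v1 ^+ 2 + v2 ^+ 2) / 2).
    rewrite (le_trans (ler_norm _))// normrM ler_wpM2l//.
    by rewrite ler_norml; have := sqr_ge0 (v1 - v2); have := sqr_ge0 (v1 + v2);
      rewrite sqrrB sqrrD => ? ?; apply/andP; split; lra.
  have B0 (u : R) : 0 <= `|u| * (v1 ^+ 2 + v2 ^+ 2) by rewrite mulr_ge0 ?addr_ge0 ?sqr_ge0.
  have := B b; have := B c; have := B0 b; have := B0 c; rewrite /be.
  by move: A A'; move: (`|a|) (`|b|) (`|c|) => *; lra.
clearbody be.
have sq2 (v1 v2 : R) : (`|v1| + `|v2|) ^+ 2 <= 2 * (v1 ^+ 2 + v2 ^+ 2).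
  rewrite -[v1 ^+ 2]real_normK ?num_real// -[v2 ^+ 2]real_normK ?num_real//.
  by have := sqr_ge0 (`|v1| - `|v2|); rewrite sqrrB sqrrD; lra.
(* Growth rate of [u1 ^+ 2 + u2 ^+ 2]: the linear part gives [2 * be] and the remainder, taken with
   [e = 1] and bounded through [L], gives [4 * L]. [C2] converts back to the squared norm. *)
pose k := 2 * be + 4 * L; pose C2 := 2 * L ^+ 2 * ((K1 ^+ 2 + K2 ^+ 2) * expR (k * t0)).
have C20 : 0 < C2 by rewrite !mulr_gt0 ?exprn_gt0 ?expR_gt0// addr_gt0 ?exprn_gt0.
pose C := Num.sqrt C2; have C0 : 0 < C by rewrite sqrtr_gt0.
have CE : C ^+ 2 = C2 by rewrite sqr_sqrtr// ltW.
(* Growth rate of the deviation from the linear flow, the products with the field error being split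
   by [2 * v * w <= v ^+ 2 + w ^+ 2]. *)
pose k2 := 2 * be + 2; pose G := expR (k2 * t0).
have G0 : 0 < G by exact: expR_gt0.
have G1 : 1 <= G by rewrite -expR0 ler_expR mulr_ge0 ?(ltW t00)// addr_ge0// mulr_ge0.
pose Y := `|x1| + `|x2| + 1; have Y0 : 0 < Y by rewrite ltr_wpDl// addr_ge0.
(* The final error has two halves: the deviation of the coordinates, amplified by [C], [G] and [Y],
   and the distance of the leaf from its tangent plane, amplified by [C]. *)
have e'0 : 0 < e / (2 * C * G * Y) by rewrite divr_gt0// !mulr_gt0.
have [d3 d30 d3H] := fld _ e'0.
have e''0 : 0 < e / (2 * C) by rewrite divr_gt0// mulr_gt0.
have [d4 d40 d4H] := st _ e''0.
pose d := Num.min (Num.min d1 d2) (Num.min d3 d4) / 2.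
have m0 : 0 < Num.min (Num.min d1 d2) (Num.min d3 d4) by rewrite !lt_min d10 d20 d30.
have d0 : 0 < d by rewrite divr_gt0.
have dP (x : R) : x <= d -> [/\ x < d1, x < d2, x < d3 & x < d4].
  move=> xd; have : x < Num.min (Num.min d1 d2) (Num.min d3 d4).
    by apply: le_lt_trans xd _; rewrite /d; lra.
  by rewrite !lt_min => /andP[/andP[-> ->] /andP[-> ->]].
clearbody d.
exists (Num.min d (d / C)) => [|z Sz zd]; first by rewrite lt_min d0 divr_gt0.
rewrite lt_min ltr_pdivlMr// => /andP[z0d z0C].
set rho := `|z 0 - xe| in z0d z0C *.
have rho0 : 0 <= rho by exact: normr_ge0.
pose u1 t := ip l1 (z t - xe); pose u2 t := ip l2 (z t - xe).
pose f1 t := ip l1 (X (z t)); pose f2 t := ip l2 (X (z t)).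
have u1d (s : R) : 0 <= s <= t0 -> is_derive s 1 u1 (f1 s).
  by move=> /zd; exact: is_derive_ipB.
have u2d (s : R) : 0 <= s <= t0 -> is_derive s 1 u2 (f2 s).
  by move=> /zd; exact: is_derive_ipB.
have xed (x : R) : 0 < x -> `|xe - xe| < x by rewrite subrr normr0.
have zL s : 0 <= s <= t0 -> `|z s - xe| <= d -> `|z s - xe| <= L * (`|u1 s| + `|u2 s|).
  move=> sI /dP[zd1 _ _ _].
  exact: (Lip _ _ (Sz s sI) Sxe zd1 (xed _ d10)).
have grow t : 0 <= t <= t0 -> (forall s, 0 <= s <= t -> `|z s - xe| <= d) ->
    `|z t - xe| <= C * rho.
  move=> /[dup] tI /andP[tp tt0] zdt; pose E s := 1 * u1 s ^+ 2 + 0 * (u1 s * u2 s) + 1 * u2 s ^+ 2.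
  have := @gronwall R E (fun s => 2 * 1 * (u1 s * f1 s) + 0 * (f1 s * u2 s + u1 s * f2 s) +
      2 * 1 * (u2 s * f2 s)) k 0 t tp.
  have sI s : 0 <= s <= t -> 0 <= s <= t0 by move=> /andP[-> st']; exact: le_trans tt0.
  move=> /(_ (fun s si => is_derive_quad 1 0 1 (u1d s (sI s si)) (u2d s (sI s si)))) H.
  have {H} : E t + 0 <= (E 0 + 0) * expR (k * t).
    apply: H => s si; rewrite addr0.
    have := zL s (sI s si) (zdt s si); have [_ zd2 _ _] := dP _ (zdt s si).
    have [] := d2H _ (Sz s (sI s si)) zd2; rewrite !mul1r -/(u1 s) -/(u2 s) -/(f1 s) -/(f2 s).
    set h := L * (`|u1 s| + `|u2 s|) => H1 H2 H3.
    have {}H1 := le_trans H1 H3; have {}H2 := le_trans H2 H3.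
    have M (v w : R) : `|w| <= h -> v * w <= `|v| * h.
      by move=> wh; rewrite (le_trans (ler_norm _))// normrM ler_wpM2l.
    have := M (u1 s) _ H1; have := M (u2 s) _ H2; have := bil (u1 s) (u2 s).
    have := ler_wpM2l (ltW L0) (sq2 (u1 s) (u2 s)); rewrite /h /E /k.
    move: (u1 s) (u2 s) (f1 s) (f2 s) (`|u1 s|) (`|u2 s|); clear.
    by move=> v1 v2 g1 g2 n1 n2 ? ? ? ?; lra.
  rewrite !addr0 => HE.
  have E0 : E 0 <= (K1 ^+ 2 + K2 ^+ 2) * rho ^+ 2.
    rewrite /E !mul1r mul0r addr0 mulrDl -!exprMn lerD//.
      by rewrite -real_normK ?num_real// ler_pXn2r ?nnegrE ?mulr_ge0 ?(ltW K10)//; exact: K1P.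
    by rewrite -real_normK ?num_real// ler_pXn2r ?nnegrE ?mulr_ge0 ?(ltW K20)//; exact: K2P.
  have zt := zL t tI (zdt t ltac:(by rewrite tp lexx)).
  rewrite -(@ler_pXn2r _ 2) ?nnegrE ?mulr_ge0 ?(ltW C0)//.
  apply: (@le_trans _ _ ((L * (`|u1 t| + `|u2 t|)) ^+ 2)).
    by rewrite ler_pXn2r ?nnegrE// mulr_ge0 ?(ltW L0) ?addr_ge0.
  rewrite exprMn; apply: (@le_trans _ _ (L ^+ 2 * (2 * E t))).
    by rewrite ler_wpM2l ?sqr_ge0//; have := sq2 (u1 t) (u2 t); rewrite /E; clear; lra.
  have -> : (C * rho) ^+ 2 =
      L ^+ 2 * (2 * ((K1 ^+ 2 + K2 ^+ 2) * rho ^+ 2 * expR (k * t0))).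
    by rewrite exprMn CE /C2; ring.
  rewrite ler_wpM2l ?sqr_ge0// ler_wpM2l//; apply: le_trans HE _; apply: ler_pM => //.
  - by rewrite /E !mul1r mul0r addr0 addr_ge0 ?sqr_ge0.
  by rewrite ler_expR ler_wpM2l// addr_ge0// mulr_ge0// ltW.
(* At a first time on the sphere of radius [d], [grow] would give [d <= C * rho], whereas the
   initial distance was taken below [d / C]. *)
have zdt s : 0 <= s <= t0 -> `|z s - xe| <= d.
  move=> /andP[s0 st0]; rewrite leNgt; apply/negP => ds.
  have zc : {within `[0, s], continuous (fun u => `|z u - xe|)}.
    apply: continuous_in_subspaceT => u; rewrite inE /= in_itv /= => /andP[u0 us].
    have zcu : {for u, continuous z}.
      apply: differentiable_continuous; apply/derivable1_diffP.
      by have [] := zd u; rewrite ?u0 ?(le_trans us).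
    by apply: cvg_norm; apply: cvgB; [exact: zcu|exact: cvg_cst].
  have [t1 [/andP[t10 t1s] Et1 lo]] := first_hit s0 zc z0d (ltW ds).
  have : `|z t1 - xe| <= C * rho.
    apply: grow; first by rewrite (ltW t10) (le_trans t1s).
    move=> u /andP[u0]; rewrite le_eqVlt => /predU1P[->|ut]; first by rewrite Et1.
    by rewrite ltW// lo// u0.
  by rewrite Et1 mulrC leNgt z0C.
have zC t : 0 <= t <= t0 -> `|z t - xe| <= C * rho.
  move=> /[dup] tI /andP[tp tt0]; apply: grow => // s /andP[sp st'].
  by apply: zdt; rewrite sp (le_trans st').
move=> t tI; pose U1 := u1 0; pose U2 := u2 0.
pose w1 t := p t * U1 + q t * (a * U1 + b * U2).
pose w2 t := p t * U2 + q t * (c * U1 - a * U2).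
have wd (x y s : R) : is_derive s 1 (fun s => p s * x + q s * y) ((a ^+ 2 + b * c) * q s * x + p s * y).
  exact: is_derive_lincomb (pd s) (qd s).
pose v1 t := u1 t - w1 t; pose v2 t := u2 t - w2 t.
have v1d (s : R) : 0 <= s <= t0 -> is_derive s 1 v1 (f1 s - (a * w1 s + b * w2 s)).
  move=> /u1d H; have H' := wd U1 (a * U1 + b * U2) s.
  have -> : a * w1 s + b * w2 s = (a ^+ 2 + b * c) * q s * U1 + p s * (a * U1 + b * U2).
    by rewrite /w1 /w2; ring.
  exact: (@is_deriveB _ _ _ u1 w1 s 1 _ _ H H').
have v2d (s : R) : 0 <= s <= t0 -> is_derive s 1 v2 (f2 s - (c * w1 s - a * w2 s)).
  move=> /u2d H; have H' := wd U2 (c * U1 - a * U2) s.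
  have -> : c * w1 s - a * w2 s = (a ^+ 2 + b * c) * q s * U2 + p s * (c * U1 - a * U2).
    by rewrite /w1 /w2; ring.
  exact: (@is_deriveB _ _ _ u2 w2 s 1 _ _ H H').
pose m := e / (2 * C * G * Y) * (C * rho).
have mm0 : 0 <= m by rewrite mulr_ge0 ?(ltW e'0) ?mulr_ge0 ?(ltW C0).
pose F s := 1 * v1 s ^+ 2 + 0 * (v1 s * v2 s) + 1 * v2 s ^+ 2.
have FB : F t <= (m * G) ^+ 2.
  case/andP: (tI) => tp tt0.
  have sI s : 0 <= s <= t -> 0 <= s <= t0 by move=> /andP[-> st']; exact: le_trans tt0.
  have F0 : F 0 = 0.
    by rewrite /F /v1 /v2 /w1 /w2 p0 q0 !mul1r !mul0r !addr0 /U1 /U2 !subrr expr0n /= addr0.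
  have := @gronwall R F _ k2 (m ^+ 2) t tp
    (fun s si => is_derive_quad 1 0 1 (v1d s (sI s si)) (v2d s (sI s si))).
  rewrite F0 add0r => H.
  have {H} : F t + m ^+ 2 <= m ^+ 2 * expR (k2 * t).
    apply: H => s si; have [_ _ zd3 _] := dP _ (zdt s (sI s si)).
    have [] := d3H _ (Sz s (sI s si)) zd3; rewrite -/(u1 s) -/(u2 s) -/(f1 s) -/(f2 s).
    move=> H1 H2; have H3 := ler_wpM2l (ltW e'0) (zC s (sI s si)).
    have {}H1 := le_trans H1 H3; have {}H2 := le_trans H2 H3; rewrite -/m in H1 H2.
    have Q (v w : R) : `|w| <= m -> 2 * (v * w) <= v ^+ 2 + m ^+ 2.
      move=> wm; have : w ^+ 2 <= m ^+ 2 by rewrite -real_normK ?num_real// ler_pXn2r ?nnegrE.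
      by have := sqr_ge0 (v - w); rewrite sqrrB; clear; lra.
    have := Q (v1 s) _ H1; have := Q (v2 s) _ H2; have := bil (v1 s) (v2 s).
    have := sqr_ge0 (v1 s); have := sqr_ge0 (v2 s).
    have := sqr_ge0 m; have := mulr_ge0 be0 (sqr_ge0 m); rewrite /F /k2 /v1 /v2.
    move: (u1 s) (u2 s) (w1 s) (w2 s) (f1 s) (f2 s); clear.
    by move=> a1 a2 b1 b2 g1 g2 *; lra.
  have : m ^+ 2 * expR (k2 * t) <= m ^+ 2 * G.
    by rewrite ler_wpM2l ?sqr_ge0// ler_expR ler_wpM2l// addr_ge0// mulr_ge0.
  have : m ^+ 2 * G <= m ^+ 2 * G ^+ 2.
    by rewrite ler_wpM2l ?sqr_ge0// expr2 ler_peMl// ltW.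
  by have := sqr_ge0 m; rewrite [(m * G) ^+ 2]exprMn; clear; lra.
have mG0 : 0 <= m * G by rewrite mulr_ge0// ltW.
have [v1B v2B] : `|v1 t| <= m * G /\ `|v2 t| <= m * G.
  have := sqr_ge0 (v1 t); have := sqr_ge0 (v2 t); move: FB; rewrite /F => FB p1 p2.
  by split; rewrite -(@ler_pXn2r _ 2) ?nnegrE// real_normK ?num_real//; move: FB p1 p2; clear; lra.
have [_ _ _ zd4] := dP _ (zdt t tI).
have := d4H _ _ (Sz t tI) Sxe zd4 (xed _ d40); rewrite -/(u1 t) -/(u2 t) => H4.
have {}H4 := le_trans H4 (ler_wpM2l (ltW e''0) (zC t tI)).
have -> : z t - xe - lin_flow l1 l2 x1 x2 a b c (p t) (q t) (z 0 - xe) =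
    (z t - xe - (u1 t *: x1 + u2 t *: x2)) + (v1 t *: x1 + v2 t *: x2).
  rewrite /lin_flow -/(u1 0) -/(u2 0) -/U1 -/U2 -/(w1 t) -/(w2 t) /v1 /v2.
  by rewrite !scalerBl [X in _ = _ + X]addrACA -opprD addrA subrK.
apply: le_trans (ler_normD _ _) _.
have A : `|v1 t *: x1 + v2 t *: x2| <= m * G * Y.
  apply: le_trans (ler_normD _ _) _; rewrite !normrZ.
  have := ler_wpM2r (normr_ge0 x1) v1B; have := ler_wpM2r (normr_ge0 x2) v2B.
  by rewrite /Y; move: mG0 (`|x1|) (`|x2|); clear => *; lra.
apply: le_trans (lerD H4 A) _; rewrite le_eqVlt; apply/orP; left; apply/eqP.
by rewrite /m; field; rewrite !gt_eqF.
Qed.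

End linearization.

Lemma is_derive_mulr_comp (R : realType) (g dg : R -> R) (w : R) :
  (forall x : R, is_derive x 1 g (dg x)) ->
  forall t : R, is_derive t 1 (fun s => g (w * s)) (w * dg (w * t)).
Proof.
move=> gd t.
have H : is_derive t 1 (fun u => w * u) w.
  by rewrite -[X in is_derive _ _ _ X]mulr1; exact: (@is_deriveZ _ _ _ id w t 1 _ (is_derive_id t 1)).
rewrite mulrC; exact: (@is_derive1_comp _ g (fun u => w * u) t _ _ (gd _) H).
Qed.

(** Hyperbolic functions, [1] and [t], or circular functions according to the sign of [D]. Parity
    serves to treat negative times through the reversed field. *)
Lemma linear_ode_fundamental (R : realType) (D : R) : exists p q : R -> R,
  [/\ p 0 = 1, q 0 = 0, forall t : R, is_derive t 1 p (D * q t) & forall t : R, is_derive t 1 q (p t)] /\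
  ((forall t, p (- t) = p t) /\ (forall t, q (- t) = - q t)).
Proof.
have [D0|D0|->] := ltgtP D 0; last first.
- exists (fun=> 1), id; split=> //; split=> // t; last exact: is_derive_id.
  by rewrite mul0r; exact: is_derive_cst.
- pose w := Num.sqrt D; have w0 : w != 0 by rewrite gt_eqF// sqrtr_gt0.
  have wE : D = w ^+ 2 by rewrite sqr_sqrtr// ltW.
  have ep (t : R) : is_derive t 1 (fun s => expR (w * s)) (w * expR (w * t)).
    exact: (@is_derive_mulr_comp _ expR expR w (fun x => is_derive_expR x)).
  have em (t : R) : is_derive t 1 (fun s => expR (- w * s)) (- w * expR (- w * t)).
    exact: (@is_derive_mulr_comp _ expR expR (- w) (fun x => is_derive_expR x)).
  exists (fun t => 2^-1 *: (expR (w * t) + expR (- w * t))),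
    (fun t => (2 * w)^-1 *: (expR (w * t) - expR (- w * t))); split; last first.
    split=> t; rewrite !mulrN !mulNr opprK; first by rewrite addrC.
    by rewrite -[RHS]scalerN opprB.
  split.
  - by rewrite !mulr0 expR0 /GRing.scale /=; field.
  - by rewrite !mulr0 expR0 subrr scaler0.
  - move=> t; have := @is_deriveZ _ _ _ _ 2^-1 t 1 _ (@is_deriveD _ _ _ _ _ t 1 _ _ (ep t) (em t)).
    suff -> : D * ((2 * w)^-1 *: (expR (w * t) - expR (- w * t))) =
      2^-1 *: (w * expR (w * t) + - w * expR (- w * t)) by [].
    by rewrite wE /GRing.scale /=; field.
  - move=> t; have := @is_deriveZ _ _ _ _ (2 * w)^-1 t 1 _ (@is_deriveB _ _ _ _ _ t 1 _ _ (ep t) (em t)).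
    suff -> : 2^-1 *: (expR (w * t) + expR (- w * t)) =
      (2 * w)^-1 *: (w * expR (w * t) - - w * expR (- w * t)) by [].
    by rewrite /GRing.scale /=; field.
pose w := Num.sqrt (- D); have w0 : w != 0 by rewrite gt_eqF// sqrtr_gt0 oppr_gt0.
have wE : D = - w ^+ 2 by rewrite sqr_sqrtr ?opprK// oppr_ge0 ltW.
have cd (t : R) : is_derive t 1 (fun s => cos (w * s)) (w * - sin (w * t)).
  exact: (@is_derive_mulr_comp _ cos (fun x => - sin x) w (fun x => is_derive_cos x)).
have sd (t : R) : is_derive t 1 (fun s => sin (w * s)) (w * cos (w * t)).
  exact: (@is_derive_mulr_comp _ sin cos w (fun x => is_derive_sin x)).
exists (fun t => cos (w * t)), (fun t => w^-1 *: sin (w * t)); split; last first.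
  by split=> t; rewrite mulrN ?cosN// sinN scalerN.
split; rewrite ?mulr0 ?cos0 ?sin0 ?scaler0//.
- move=> t; suff -> : D * (w^-1 *: sin (w * t)) = w * - sin (w * t) by exact: cd.
  by rewrite wE /GRing.scale /=; field.
- move=> t; rewrite [X in is_derive _ _ _ X](_ : _ = w^-1 *: (w * cos (w * t))).
    exact: (@is_deriveZ _ _ _ _ w^-1 t 1 _ (sd t)).
  by rewrite /GRing.scale /=; field.
Qed.

Lemma is_derive_scalel (R : realType) (W : normedModType R) (g : R -> R) (w : W) (t dg : R) :
  is_derive t 1 g dg -> is_derive t 1 (fun s => g s *: w) (dg *: w).
Proof.
move=> /is_deriveP gd; apply/is_deriveP => e e0.
have w0 : 0 < `|w| + 1 by rewrite ltr_wpDl.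
have [d d0 dH] := gd (e / (`|w| + 1)) ltac:(by rewrite divr_gt0).
exists d => // h /dH hd; rewrite scalerA -!scalerBl normrZ.
apply: le_trans (ler_wpM2r (normr_ge0 w) hd) _.
rewrite (_ : e / (`|w| + 1) * `|h| * `|w| = e * `|h| * (`|w| / (`|w| + 1))); last by ring.
by rewrite ler_piMr ?mulr_ge0 ?(ltW e0)// ler_pdivrMr// mul1r lerDl.
Qed.

(** * Tangent vectors of the leaf and the matrix of the linearization *)

Section tangent.
Context {R : realType} {n : nat}.
Local Notation V := 'rV[R]_n.
Implicit Types (X : V -> V) (S : set V).

Definition pair_basis (x1 x2 : V) (i : 'I_2) : V := if i == 0 then x1 else x2.

Definition mx2 (a b c d : R) : 'M[R]_2 :=
  \matrix_(i, j) if i == 0 then if j == 0 then a else b else if j == 0 then c else d.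

Lemma sum_pair_basis (x1 x2 : V) (k : 'I_2 -> R) :
  \sum_(i < 2) k i *: pair_basis x1 x2 i = k 0 *: x1 + k 1 *: x2.
Proof. by rewrite !big_ord_recl big_ord0 addr0 /pair_basis /=; congr (_ + k _ *: _); exact: val_inj. Qed.

(** [chart_strict] forces velocities into the plane. Conversely the points with coordinates [s * a]
    and [s * b] form a curve with the prescribed velocity at 0. *)
Lemma chart_tangent_basis S (xe l1 l2 x1 x2 : V) : S xe ->
  chart_strict S xe l1 l2 x1 x2 -> chart_onto S xe l1 l2 ->
  ip l1 x1 = 1 -> ip l1 x2 = 0 -> ip l2 x1 = 0 -> ip l2 x2 = 1 ->
  tangent_basis S xe (pair_basis x1 x2).
Proof.
move=> Sxe st [K [r [K0 r0 onto]]] l11 l12 l21 l22; split.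
  move=> k; rewrite sum_pair_basis => E i.
  have := congr1 (ip l1) E; rewrite ipDr !ipZr l11 l12 mulr1 mulr0 addr0 ip0r => k0.
  have := congr1 (ip l2) E; rewrite ipDr !ipZr l21 l22 mulr1 mulr0 add0r ip0r => k1.
  by case: i => [[|[|//]] i]; [rewrite -k0|rewrite -k1]; congr k; exact: val_inj.
move=> v; split.
  move=> [c [c0 [Sc cd]]].
  exists (fun i => if i == 0 then ip l1 v else ip l2 v); rewrite sum_pair_basis /=.
  have c1 := is_derive_ip l1 cd; have c2 := is_derive_ip l2 cd.
  (* The tangential part of the curve. The derivative of [c - u] is the component of [v] outside the
     plane, and [chart_strict] makes its increments at 0 negligible. *)
  pose u t := ip l1 (c t) *: x1 + ip l2 (c t) *: x2.
  have ud : is_derive (0 : R) 1 u (ip l1 v *: x1 + ip l2 v *: x2).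
    exact: (@is_deriveD _ _ _ _ _ (0 : R) 1 _ _ (is_derive_scalel x1 c1) (is_derive_scalel x2 c2)).
  have : is_derive (0 : R) 1 (c - u) (v - (ip l1 v *: x1 + ip l2 v *: x2)) by exact: is_deriveB.
  move=> /is_deriveP cu; apply/eqP; rewrite -subr_eq0 -normr_le0; apply/ler_addgt0Pr => e e0; rewrite add0r.
  have /is_deriveP cd' := cd.
  have e20 : 0 < e / 2 by rewrite divr_gt0.
  have [d1 d10 H1] := cu _ e20; have [d2 d20 H2] := cd' 1 ltr01.
  have v0 : 0 < `|v| + 1 by rewrite ltr_wpDl.
  have [d3 d30 H3] := st (e / (2 * (`|v| + 1))) ltac:(by rewrite divr_gt0// mulr_gt0).
  have /near_ballE[d4 d40 H4] := Sc.
  pose h := Num.min (Num.min d1 d2) (Num.min d4 (d3 / (`|v| + 1))) / 2.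
  have m0 : 0 < Num.min (Num.min d1 d2) (Num.min d4 (d3 / (`|v| + 1))) by rewrite !lt_min d10 d20 d40 divr_gt0.
  have h0 : 0 < h by rewrite divr_gt0.
  have : h < Num.min (Num.min d1 d2) (Num.min d4 (d3 / (`|v| + 1))) by rewrite /h; lra.
  rewrite !lt_min => /andP[/andP[h1 h2] /andP[h4 h3]]; clearbody h.
  have hn : `|h| = h by rewrite gtr0_norm.
  have := H1 h; rewrite hn add0r => /(_ h1) {}H1.
  have := H2 h; rewrite hn add0r c0 mul1r => /(_ h2) {}H2.
  have Sch := H4 h; rewrite subr0 hn in Sch; have {}Sch := Sch h4.
  have chv : `|c h - xe| <= (`|v| + 1) * h.
    rewrite -[c h - xe](subrK (h *: v)) (le_trans (ler_normD _ _))// normrZ hn; lra.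
  have ch3 : `|c h - xe| < d3 by rewrite (le_lt_trans chv)// mulrC -ltr_pdivlMr.
  have := H3 (c h) xe Sch Sxe ch3; rewrite subrr normr0 => /(_ d30).
  have -> : c h - xe - (ip l1 (c h - xe) *: x1 + ip l2 (c h - xe) *: x2) = (c - u) h - (c - u) 0.
    rewrite !ipBr !fctE /u c0 !scalerBl; apply/rowP => j; rewrite !mxE; ring.
  move=> H5; have H6 : `|(c - u) h - (c - u) 0| <= e / 2 * h.
    apply: le_trans H5 _; apply: le_trans (ler_wpM2l _ chv) _.
      by rewrite divr_ge0 ?mulr_ge0 ?(ltW v0) ?(ltW e0).
    by rewrite le_eqVlt; apply/orP; left; apply/eqP; field; rewrite gt_eqF.
  rewrite -(ler_pM2l h0) -[X in X * `|_|]hn -normrZ.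
  rewrite -[h *: _](subKr ((c - u) h - (c - u) 0)) (le_trans (ler_normB _ _))//.
  by have := lerD H6 H1; lra.
move=> [k ->]; rewrite sum_pair_basis; set a := k 0; set b := k 1.
have /choice[c cP] : forall s : R, exists x, `|s * a| < r -> `|s * b| < r ->
    [/\ S x, ip l1 (x - xe) = s * a, ip l2 (x - xe) = s * b & `|x - xe| <= K * (`|s * a| + `|s * b|)].
  move=> s; have [H|H] := boolP ((`|s * a| < r) && (`|s * b| < r)).
    by case/andP: H => /onto H /H[x xP]; exists x.
  by exists xe => a1 b1; rewrite a1 b1 in H.
pose q := `|a| + `|b| + 1; have q0 : 0 < q by rewrite ltr_wpDl// addr_ge0.
have cP' s : `|s| < r / q -> [/\ S (c s), ip l1 (c s - xe) = s * a, ip l2 (c s - xe) = s * b &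
    `|c s - xe| <= K * q * `|s|].
  rewrite ltr_pdivlMr// => sr.
  have A : `|s| * `|a| <= `|s| * q by rewrite ler_wpM2l// /q; have := normr_ge0 b; lra.
  have B : `|s| * `|b| <= `|s| * q by rewrite ler_wpM2l// /q; have := normr_ge0 a; lra.
  have [||Sc c1 c2 cK] := cP s.
  - by rewrite normrM (le_lt_trans A).
  - by rewrite normrM (le_lt_trans B).
  split=> //; apply: le_trans cK _; rewrite -mulrA ler_wpM2l ?(ltW K0)//.
  by rewrite !normrM -mulrDr mulrC ler_wpM2r// /q lerDl.
have rq0 : 0 < r / q by rewrite divr_gt0.
have c0 : c 0 = xe.
  have [_ _ _] := cP' 0 ltac:(by rewrite normr0).
  by rewrite normr0 mulr0 normr_le0 subr_eq0 => /eqP.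
exists c; split=> //; split.
  by apply/near_ballE; exists (r / q) => // s; rewrite subr0 => /cP'[].
apply/is_deriveP => e e0; have Kq0 : 0 < K * q by rewrite mulr_gt0.
have [d d0 dH] := st (e / (K * q)) ltac:(by rewrite divr_gt0).
exists (Num.min (r / q) (d / (K * q))) => [|h]; first by rewrite lt_min rq0 divr_gt0.
rewrite lt_min => /andP[hr hd]; have [Sc c1 c2 cK] := cP' h hr.
have cd : `|c h - xe| < d by rewrite (le_lt_trans cK)// mulrC -ltr_pdivlMr.
have := dH _ _ Sc Sxe cd ltac:(by rewrite subrr normr0); rewrite c1 c2 add0r c0.
rewrite scalerDr !scalerA => H; apply: le_trans H _.
apply: le_trans (ler_wpM2l _ cK) _; first by rewrite divr_ge0 ?(ltW e0) ?(ltW Kq0).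
by rewrite mulrA divfK ?gt_eqF.
Qed.

Lemma chart_fieldN X S (xe l1 l2 : V) (a b c d : R) : chart_field X S xe l1 l2 a b c d ->
  chart_field (fun x => - X x) S xe l1 l2 (- a) (- b) (- c) (- d).
Proof.
move=> fld e /fld[r r0 rH]; exists r => // x Sx xr; have [H1 H2] := rH x Sx xr.
have E u p q : - u - (- p * ip l1 (x - xe) + - q * ip l2 (x - xe)) =
    - (u - (p * ip l1 (x - xe) + q * ip l2 (x - xe))) by ring.
by rewrite !ipNr !E !normrN.
Qed.

(** The expansion holds for all [|t| <= t0] on one neighbourhood, so along curves in [S] each
    [phi t] has the linear flow as derivative at [xe]. Differentiating [p] and [q] at 0 leaves the
    linear part of the field. *)
Lemma chart_linearization X S (xe l1 l2 x1 x2 : V) (a b c : R) : S xe ->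
  chart_strict S xe l1 l2 x1 x2 -> chart_field X S xe l1 l2 a b c (- a) ->
  ip l1 x1 = 1 -> ip l1 x2 = 0 -> ip l2 x1 = 0 -> ip l2 x2 = 1 ->
  linearization_matrix X S xe (pair_basis x1 x2) (mx2 a b c (- a)).
Proof.
move=> Sxe st fld l11 l12 l21 l22 phi [r r0 phiP] j cv cv0 Scv cvd.
set v := pair_basis x1 x2 j in cvd *.
have [p [q [[p0 q0 pd qd] [pN qN]]]] := linear_ode_fundamental (a ^+ 2 + b * c).
pose Lf t := lin_flow l1 l2 x1 x2 a b c (p t) (q t).
pose t0 := r / 2; have t00 : 0 < t0 by rewrite divr_gt0.
have t0r : t0 < r by rewrite /t0; lra.
have expand e : 0 < e -> exists2 d : R, 0 < d & forall y, S y -> `|y - xe| < d ->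
    forall t, `|t| <= t0 -> `|phi t y - xe - Lf t (y - xe)| <= e * `|y - xe|.
  move=> e0.
  have [d1 d10 H1] := flow_expansion t00 Sxe st fld p0 q0 pd qd e0.
  have fldN := chart_fieldN fld; have pd' (t : R) : is_derive t 1 p (((- a) ^+ 2 + - b * - c) * q t).
    by rewrite sqrrN mulrNN; exact: pd.
  have [d2 d20 H2] := flow_expansion t00 Sxe st fldN p0 q0 pd' qd e0.
  exists (Num.min r (Num.min d1 d2)) => [|y Sy]; first by rewrite !lt_min r0 d10.
  rewrite !lt_min => /andP[/(phiP y Sy)[phi0 phid] /andP[yd1 yd2]].
  move=> t; have [tp|tn] := leP 0 t.
    move=> tt0; have := H1 (phi ^~ y); rewrite phi0; apply=> //.
    - by move=> s /andP[sp st0]; case: (phid s) => //; rewrite ger0_norm// (le_lt_trans st0).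
    - by move=> s /andP[sp st0]; case: (phid s) => //; rewrite ger0_norm// (le_lt_trans st0).
    - by rewrite tp -(ger0_norm tp).
  (* Negative times: the reversed curve solves the equation of [- X], which has the same [D]; parity
     of [p] and [q] restores the formula. *)
  move=> tt0; have := H2 (fun s => phi (- s) y); rewrite oppr0 phi0.
  have sr s : 0 <= s <= t0 -> `|- s| < r.
    by move=> /andP[sp st0]; rewrite normrN ger0_norm// (le_lt_trans st0).
  have zd (s : R) : 0 <= s <= t0 -> is_derive s 1 (fun s => phi (- s) y) (- X (phi (- s) y)).
    move=> sI; have [_ H] := phid _ (sr s sI).
    have := @is_derive_compr _ _ (phi ^~ y) -%R s (- 1) _ H (is_deriveNid s 1).
    by rewrite scaleN1r.
  have tI : 0 <= - t <= t0 by rewrite oppr_ge0 (ltW tn) -(ltr0_norm tn).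
  move=> /(_ (fun s sI => (phid (- s) (sr s sI)).1) zd yd2 (- t) tI).
  suff -> : lin_flow l1 l2 x1 x2 (- a) (- b) (- c) (p (- t)) (q (- t)) (y - xe) = Lf t (y - xe).
    by rewrite opprK.
  by rewrite /Lf /lin_flow pN qN; congr (_ *: _ + _ *: _); ring.
have LfZ t h w : Lf t (h *: w) = h *: Lf t w.
  rewrite /Lf /lin_flow !ipZr scalerDr !scalerA; congr (_ *: _ + _ *: _); ring.
have LfB t w w' : Lf t (w - w') = Lf t w - Lf t w'.
  rewrite /Lf /lin_flow !ipBr opprD addrACA -!scalerBl; congr (_ *: _ + _ *: _); ring.
have Lf_bounded t : exists2 k : R, 0 < k & forall w, `|Lf t w| <= k * `|w|.
  have [K1 K10 K1P] := ip_bounded l1; have [K2 K20 K2P] := ip_bounded l2.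
  pose k1 := `|p t| * K1 + `|q t| * (`|a| * K1 + `|b| * K2).
  pose k2 := `|p t| * K2 + `|q t| * (`|c| * K1 + `|a| * K2).
  have k10 : 0 <= k1 by rewrite !(addr_ge0, mulr_ge0)// ?(ltW K10) ?(ltW K20).
  have k20 : 0 <= k2 by rewrite !(addr_ge0, mulr_ge0)// ?(ltW K10) ?(ltW K20).
  exists (k1 * `|x1| + k2 * `|x2| + 1) => [|w]; first by rewrite ltr_wpDl// addr_ge0// mulr_ge0.
  rewrite (le_trans (ler_normD _ _))// !normrZ.
  have A := K1P w; have B := K2P w.
  have E (x y A' B' : R) : `|A'| <= K1 * `|w| -> `|B'| <= K2 * `|w| ->
      `|x * A' + y * B'| <= (`|x| * K1 + `|y| * K2) * `|w|.
    move=> A'h B'h; rewrite (le_trans (ler_normD _ _))// !normrM mulrDl -!mulrA.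
    by rewrite lerD// ler_wpM2l.
  have H1 : `|p t * ip l1 w + q t * (a * ip l1 w + b * ip l2 w)| <= k1 * `|w|.
    rewrite (le_trans (ler_normD _ _))// !normrM /k1 mulrDl -!mulrA lerD// ler_wpM2l//.
    exact: E.
  have H2 : `|p t * ip l2 w + q t * (c * ip l1 w - a * ip l2 w)| <= k2 * `|w|.
    rewrite (le_trans (ler_normD _ _))// !normrM /k2 mulrDl -!mulrA lerD// ler_wpM2l//.
    by rewrite -mulNr -[`|a|]normrN E.
  have := ler_wpM2r (normr_ge0 x1) H1; have := ler_wpM2r (normr_ge0 x2) H2.
  have : 0 <= `|w| by [].
  move: (`|x1|) (`|x2|) (`|w|) (`|_ + _|) (`|_ + _|) => ? ? ? ? ? ? ? ?; lra.
have phid (t : R) : `|t| < t0 -> is_derive (0 : R) 1 (fun s => phi t (cv s)) (Lf t v).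
  move=> /ltW tt0; have phixe : phi t xe = xe.
    have [d d0 dH] := expand 1 ltr01.
    have := dH xe Sxe; rewrite subrr normr0 mulr0 => /(_ d0 t tt0).
    by rewrite -(scale0r (0 : V)) LfZ !scale0r subr0 normr_le0 subr_eq0 => /eqP.
  apply/is_deriveP => e e0; have [k k0 kP] := Lf_bounded t.
  have /is_deriveP cvd' := cvd.
  have v0 : 0 < `|v| + 1 by rewrite ltr_wpDl.
  have [d1 d10 H1] := expand (e / (2 * (`|v| + 1))) ltac:(by rewrite divr_gt0// mulr_gt0).
  have [d2 d20 H2] := cvd' (e / (2 * k)) ltac:(by rewrite divr_gt0// mulr_gt0).
  have [d3 d30 H3] := cvd' 1 ltr01.
  have /near_ballE[d4 d40 H4] := Scv.
  exists (Num.min (Num.min (d1 / (`|v| + 1)) d2) (Num.min d3 d4)) => [|h].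
    by rewrite !lt_min divr_gt0// d20 d30.
  rewrite !lt_min => /andP[/andP[h1 /H2 {}H2] /andP[/H3 {}H3 h4]].
  rewrite add0r cv0 mul1r in H2 H3.
  have Sch : S (cv h) by apply: H4; rewrite subr0.
  have chv : `|cv h - xe| <= (`|v| + 1) * `|h|.
    rewrite -[cv h - xe](subrK (h *: v)) (le_trans (ler_normD _ _))// normrZ; lra.
  have ch1 : `|cv h - xe| < d1 by rewrite (le_lt_trans chv)// mulrC -ltr_pdivlMr.
  have {}H1 := H1 _ Sch ch1 t tt0.
  rewrite add0r cv0 phixe.
  have -> : phi t (cv h) - xe - h *: Lf t v =
      (phi t (cv h) - xe - Lf t (cv h - xe)) + Lf t (cv h - xe - h *: v).
    by rewrite [Lf t (_ - h *: v)]LfB LfZ addrA subrK.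
  apply: le_trans (ler_normD _ _) _.
  have A : e / (2 * (`|v| + 1)) * `|cv h - xe| <= e / 2 * `|h|.
    apply: le_trans (ler_wpM2l _ chv) _; first by rewrite divr_ge0 ?mulr_ge0 ?(ltW e0) ?(ltW v0).
    by rewrite le_eqVlt; apply/orP; left; apply/eqP; field; rewrite gt_eqF.
  have B : k * `|cv h - xe - h *: v| <= e / 2 * `|h|.
    apply: le_trans (ler_wpM2l (ltW k0) H2) _.
    by rewrite le_eqVlt; apply/orP; left; apply/eqP; field; rewrite gt_eqF.
  by have := kP (cv h - xe - h *: v); move: H1 A B; lra.
have near_t0 (Q : R -> Prop) : (forall t, `|t| < t0 -> Q t) -> \forall t \near (0 : R), Q t.
  by move=> H; apply/near_ballE; exists t0 => // t; rewrite subr0; exact: H.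
split; first by apply: near_t0 => t /phid[].
have -> : \sum_(i < 2) mx2 a b c (- a) i j *: pair_basis x1 x2 i =
    (a * ip l1 v + b * ip l2 v) *: x1 + (c * ip l1 v - a * ip l2 v) *: x2.
  rewrite sum_pair_basis !mxE /= /v /pair_basis.
  case: (j == 0); rewrite ?l11 ?l12 ?l21 ?l22 ?mulr1 ?mulr0 ?addr0 ?add0r ?subr0 ?sub0r//.
apply: (@near_eq_is_derive _ _ _ (fun t => Lf t v)).
  by apply: near_t0 => t /phid Ht; rewrite derive_val.
have wd (A B : R) : is_derive (0 : R) 1 (fun s => p s * A + q s * B) B.
  have := is_derive_lincomb A B (pd 0) (qd 0).
  by rewrite q0 p0 mulr0 mul0r add0r mul1r.
exact: (@is_deriveD _ _ _ _ _ (0 : R) 1 _ _ (is_derive_scalel x1 (wd _ _)) (is_derive_scalel x2 (wd _ _))).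
Qed.

Lemma char_poly_mx2 (a b c : R) :
  char_poly (mx2 a b c (- a)) = 'X^2 + (- (a ^+ 2 + b * c))%:P.
Proof.
rewrite /char_poly det_mx2 !mxE /= !mulr1n !mulr0n.
by rewrite !(polyCN, polyCD, polyCM, polyC_exp); ring.
Qed.

End tangent.

(** * Second order estimates *)

Section second_order.
Context {R : realType} {n : nat}.
Local Notation V := 'rV[R]_n.
Implicit Types (f : V -> R) (p v w : V) (A : 'M[R]_n).

Lemma is_derive_affine p v (t : R) : is_derive t 1 (fun s : R => p + s *: v) v.
Proof.
apply/is_deriveP => e e0; exists 1 => // h _.
by rewrite scalerDl addrA [p + _ + _]addrC addrK subrr normr0 mulr_ge0// ltW.
Qed.

(** The mean value theorem in direction [v] reduces the second difference to a difference of
    gradients at two points [t *: w] apart, to which strict differentiability of the gradient at [p]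
    applies. *)
Lemma second_difference f p A (r : R) v w : 0 < r ->
  (forall x, `|x - p| < r -> strict_diff f x (grad f x)) ->
  strict_diffV (grad f) p A^T -> forall e, 0 < e ->
  exists2 d : R, 0 < d & forall t : R, 0 < t < d ->
  `|f (p + t *: w + t *: v) - f (p + t *: v) - (f (p + t *: w) - f p) -
    t ^+ 2 * ip (w *m A^T) v| <= e * t ^+ 2.
Proof.
move=> r0 fd gd e e0.
pose k : R := n%:R * `|w| * `|v| + 1.
have k0 : 0 < k by rewrite ltr_wpDl// !mulr_ge0.
have [d d0 dH] := gd (e / k) ltac:(by rewrite divr_gt0).
pose y : R := `|v| + `|w| + 1; have y0 : 0 < y by rewrite ltr_wpDl// addr_ge0.
exists (Num.min r d / y) => [|t /andP[t0]]; first by rewrite divr_gt0// lt_min r0.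
rewrite ltr_pdivlMr// => td.
have bnd (s b : R) : 0 <= s <= t -> 0 <= b <= t -> `|p + b *: w + s *: v - p| < Num.min r d.
  move=> /andP[s0 st] /andP[b0 bt]; apply: le_lt_trans td.
  rewrite addrAC [p + _]addrC addrK addrC.
  apply: le_trans (ler_normD _ _) _; rewrite !normrZ (ger0_norm s0) (ger0_norm b0).
  have := ler_wpM2r (normr_ge0 v) st; have := ler_wpM2r (normr_ge0 w) bt.
  by rewrite /y; move: (`|v|) (`|w|) => *; lra.
pose g (s : R) := f (p + t *: w + s *: v) - f (p + s *: v).
pose dg s := ip (grad f (p + t *: w + s *: v)) v - ip (grad f (p + s *: v)) v.
have bnd0 (s : R) : 0 <= s <= t -> `|p + s *: v - p| < Num.min r d.
  by move=> sI; have := bnd s 0 sI; rewrite scale0r addr0 lexx ltW//; exact.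
have bndt (s : R) : 0 <= s <= t -> `|p + t *: w + s *: v - p| < Num.min r d.
  by move=> sI; apply: bnd => //; rewrite lexx ltW.
have gdv (s : R) : 0 <= s <= t -> is_derive s 1 g (dg s).
  move=> sI; apply: is_deriveB.
    have := bndt s sI; rewrite lt_min => /andP[H _].
    exact: (strict_diff_curve erefl (fd _ H) (is_derive_affine _ _ s)).
  have := bnd0 s sI; rewrite lt_min => /andP[H _].
  exact: (strict_diff_curve erefl (fd _ H) (is_derive_affine _ _ s)).
have [s /andP[s0 st] E] := MVT_derive t0 gdv.
have sI : 0 <= s <= t by rewrite !ltW.
have := bndt s sI; rewrite lt_min => /andP[_ H1].
have := bnd0 s sI; rewrite lt_min => /andP[_ H2].
have := dH _ _ H1 H2.
have -> : p + t *: w + s *: v - (p + s *: v) = t *: w.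
  by rewrite [p + t *: w + s *: v]addrAC [X in X - _]addrC addrK.
move=> H3.
have -> : f (p + t *: w + t *: v) - f (p + t *: v) - (f (p + t *: w) - f p) = g t - g 0.
  by rewrite /g !scale0r !addr0.
have -> : g t - g 0 - t ^+ 2 * ip (w *m A^T) v =
    t * ip (grad f (p + t *: w + s *: v) - grad f (p + s *: v) - (t *: w) *m A^T) v.
  by rewrite E /dg !ipBl -scalemxAl ipZl; ring.
rewrite normrM (gtr0_norm t0).
have H4 : n%:R * (e / k * `|t *: w|) * `|v| <= e * t.
  rewrite normrZ (gtr0_norm t0) (_ : n%:R * _ * _ = e * t * ((n%:R * `|w| * `|v|) / k)); last by ring.
  by rewrite ler_piMr ?mulr_ge0 ?(ltW e0) ?(ltW t0)// ler_pdivrMr// mul1r /k lerDl.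
rewrite [e * _]mulrC expr2 -mulrA ler_wpM2l ?(ltW t0)// [t * e]mulrC.
apply: le_trans H4; apply: le_trans (ip_norm_le _ _) _.
by rewrite ler_wpM2r// ler_wpM2l.
Qed.

(** The second difference is symmetric in [v] and [w], hence so is its limit after division by
    [t ^+ 2]. *)
Lemma hessian_symmetric f p A (r : R) : 0 < r ->
  (forall x, `|x - p| < r -> strict_diff f x (grad f x)) ->
  strict_diffV (grad f) p A^T -> A^T = A.
Proof.
move=> r0 fd gd.
have sym v w : ip (w *m A^T) v = ip (v *m A^T) w.
  apply/eqP; rewrite -subr_eq0 -normr_le0; apply/ler_addgt0Pr => e e0; rewrite add0r.
  have e20 : 0 < e / 2 by rewrite divr_gt0.
  have [d1 d10 H1] := second_difference v w r0 fd gd e20.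
  have [d2 d20 H2] := second_difference w v r0 fd gd e20.
  pose t := Num.min d1 d2 / 2.
  have m0 : 0 < Num.min d1 d2 by rewrite lt_min d10.
  have t0 : 0 < t by rewrite divr_gt0.
  have : t < Num.min d1 d2 by rewrite /t; lra.
  rewrite lt_min => /andP[td1 td2]; clearbody t.
  have := H1 t; rewrite t0 td1 => /(_ isT) {}H1.
  have := H2 t; rewrite t0 td2 => /(_ isT) {}H2.
  move: H2; rewrite [p + t *: v + _]addrAC => H2.
  have t2 : 0 < t ^+ 2 by rewrite exprn_gt0.
  rewrite -(ler_pM2l t2) -[X in X * `|_|](ger0_norm (ltW t2)) -normrM.
  have -> : t ^+ 2 * (ip (w *m A^T) v - ip (v *m A^T) w) =
      (f (p + t *: w + t *: v) - f (p + t *: w) - (f (p + t *: v) - f p) - t ^+ 2 * ip (v *m A^T) w) -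
      (f (p + t *: w + t *: v) - f (p + t *: v) - (f (p + t *: w) - f p) - t ^+ 2 * ip (w *m A^T) v).
    by ring.
  rewrite (le_trans (ler_normB _ _))//; apply: le_trans (lerD H2 H1) _.
  by rewrite -mulrDl -splitr mulrC.
have e i j : ip (ebasis R i *m A^T) (ebasis R j) = A j i.
  rewrite ip_ebasis mxE (bigD1 i)//= !mxE eqxx mul1r big1 ?addr0// => k ki.
  by rewrite !mxE (negPf ki) mul0r.
by apply/matrixP => i j; rewrite mxE -(e i j) sym e.
Qed.

(** Subtract the quadratic part along the segment from [y] to [x]: the remaining derivative is the
    error of the gradient paired with [x - y], to which the mean value theorem applies. *)
Lemma level_estimate f p A (r : R) : 0 < r ->
  (forall x, `|x - p| < r -> strict_diff f x (grad f x)) ->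
  strict_diffV (grad f) p A^T -> grad f p = 0 -> forall e, 0 < e ->
  exists2 d : R, 0 < d & forall x y, `|x - p| < d -> `|y - p| < d ->
    `|f x - f y - (ip ((x - p) *m A) (x - p) - ip ((y - p) *m A) (y - p)) / 2| <=
    e * Num.max `|x - p| `|y - p| * `|x - y|.
Proof.
move=> r0 fd gd gp e e0; have As := hessian_symmetric r0 fd gd.
rewrite As in gd.
have k0 : 0 < n%:R + 1 :> R by rewrite ltr_wpDl.
have [d d0 dH] := gd (e / (n%:R + 1)) ltac:(by rewrite divr_gt0).
exists (Num.min r d) => [|x y]; first by rewrite lt_min r0.
move=> xd yd; set m := Num.max _ _.
have md : m < Num.min r d by rewrite gt_max xd.
have m0 : 0 <= m by rewrite le_max normr_ge0.
pose D := x - y; pose Y := y - p.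
have ipS u v : ip (u *m A) v = ip (v *m A) u.
  have -> : ip (u *m A) v = (u *m A *m v^T)^T 0 0 by rewrite [RHS]mxE.
  by rewrite !trmx_mul trmxK As mulmxA.
have ipQ u v : ip ((u + v) *m A) (u + v) =
    ip (u *m A) u + 2 * ip (u *m A) v + ip (v *m A) v.
  by rewrite mulmxDl ipDl !ipDr (ipS v u); ring.
(* The trivial factors bring the polynomial into the form of [is_derive_quad] with the functions [s]
   and 1. *)
pose g (s : R) := f (y + s *: D) - (ip (D *m A) D / 2 * s ^+ 2 + ip (Y *m A) D * (s * 1) + 0 * 1 ^+ 2).
pose dg s := ip (grad f (y + s *: D)) D - (2 * (ip (D *m A) D / 2) * (s * 1) +
  ip (Y *m A) D * (1 * 1 + s * 0) + 2 * 0 * (1 * 0)).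
have zE s : y + s *: D - p = (1 - s) *: (y - p) + s *: (x - p).
  rewrite /D; apply/rowP => j; rewrite !mxE; ring.
have zm (s : R) : 0 <= s <= 1 -> `|y + s *: D - p| <= m.
  move=> /andP[s0 s1]; rewrite zE (le_trans (ler_normD _ _))// !normrZ.
  rewrite !ger0_norm ?subr_ge0//.
  have : (1 - s) * `|y - p| <= (1 - s) * m by rewrite ler_wpM2l ?subr_ge0// le_max lexx orbT.
  have : s * `|x - p| <= s * m by rewrite ler_wpM2l// le_max lexx.
  lra.
have gdv (s : R) : 0 <= s <= 1 -> is_derive s 1 g (dg s).
  move=> /zm sm; have : `|y + s *: D - p| < Num.min r d by exact: le_lt_trans md.
  rewrite lt_min => /andP[sr _].
  have H1 := strict_diff_curve erefl (fd _ sr) (is_derive_affine y D s).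
  have Hid : is_derive s 1 (fun u : R => u) 1 by exact: is_derive_id.
  have Hc : is_derive s 1 (fun _ : R => 1 : R) 0 by exact: is_derive_cst.
  have H2 := is_derive_quad (ip (D *m A) D / 2) (ip (Y *m A) D) 0 Hid Hc.
  exact: (@is_deriveB _ _ _ _ _ s 1 _ _ H1 H2).
have [s /andP[s0 s1] E] := MVT_derive ltr01 gdv.
have sI : 0 <= s <= 1 by rewrite !ltW.
have sd : `|y + s *: D - p| < d.
  by have := le_lt_trans (zm s sI) md; rewrite lt_min => /andP[].
have := dH _ p sd; rewrite subrr normr0 gp subr0 => /(_ d0) H.
have -> : f x - f y - (ip ((x - p) *m A) (x - p) - ip ((y - p) *m A) (y - p)) / 2 = g 1 - g 0.
  have -> : x - p = Y + D by rewrite /Y /D [RHS]addrC addrA subrK.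
  have yD : y + D = x by rewrite /D addrC subrK.
  rewrite /g scale1r scale0r addr0 yD -/Y.
  by rewrite ipQ expr0n /=; field.
have -> : g 1 - g 0 = ip (grad f (y + s *: D) - (y + s *: D - p) *m A) D.
  have -> : y + s *: D - p = Y + s *: D by rewrite /Y addrAC.
  by rewrite E subr0 mulr1 /dg ipBl [(Y + _) *m A]mulmxDl [ip (_ + _) D]ipDl
    -[(s *: D) *m A]scalemxAl ipZl; field.
apply: le_trans (ip_norm_le _ _) _; rewrite ler_wpM2r//.
apply: (@le_trans _ _ (n%:R * (e / (n%:R + 1) * m))).
  by rewrite ler_wpM2l// (le_trans H)// ler_wpM2l ?zm// divr_ge0 ?(ltW e0) ?(ltW k0).
rewrite (_ : _ * (_ * m) = e * m * (n%:R / (n%:R + 1))); last by ring.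
by rewrite ler_piMr ?mulr_ge0 ?(ltW e0)// ler_pdivrMr// mul1r lerDl.
Qed.

End second_order.

(** * Smooth functions *)

Section smooth.
Context {R : realType} {n : nat} (Omega : set 'rV[R]_n).
Local Notation V := 'rV[R]_n.
Implicit Types (f g : V -> R) (x : V).
Hypothesis oO : open Omega.

Lemma open_ball_sub x : Omega x -> exists2 r : R, 0 < r & forall y, `|y - x| < r -> Omega y.
Proof. by move=> Ox; apply/near_ballE; exact: open_nbhs_nbhs. Qed.

Lemma smooth_on_partial f j : smooth_on Omega f -> smooth_on Omega (partial f j).
Proof. by move=> fs vs; have := fs (rcons vs (ebasis R j)); rewrite /iderivs foldr_rcons. Qed.

Lemma smooth_on_continuous f x : smooth_on Omega f -> Omega x -> {for x, continuous f}.
Proof. by move=> fs Ox; exact: ((fs [::]).2 x Ox). Qed.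

Lemma smooth_on_strict_diff f x : smooth_on Omega f -> Omega x -> strict_diff f x (grad f x).
Proof.
move=> fs Ox; have [r r0 rO] := open_ball_sub Ox.
apply: (C1_strict_diff r0) => [j y yr|j]; first exact: ((fs [::]).1 _ _ (rO _ yr)).
exact: smooth_on_continuous (smooth_on_partial j fs) Ox.
Qed.

Lemma smooth_on_grad f x : smooth_on Omega f -> Omega x ->
  strict_diffV (grad f) x (hess f x)^T.
Proof.
move=> fs Ox; apply: strict_diffV_coord => j; rewrite trmxK.
have := smooth_on_strict_diff (smooth_on_partial j fs) Ox.
rewrite (_ : row j (hess f x) = grad (partial f j) x); last by apply/rowP => i; rewrite !mxE.
by rewrite (_ : (fun y => grad f y 0 j) = partial f j)//; apply/funext => y; rewrite mxE.
Qed.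

(** Meant for linear combinations, with which differentiation commutes. The iterated derivatives are
    compared only on [Omega]; openness lets the next derivative be compared too. *)
Lemma smooth_on_op (op : R -> R -> R) (F : V -> R) f g : smooth_on Omega f -> smooth_on Omega g ->
  (forall x v (h k : V -> R), derivable h x v -> derivable k x v ->
    derivable (fun y => op (h y) (k y)) x v /\
    'D_v (fun y => op (h y) (k y)) x = op ('D_v h x) ('D_v k x)) ->
  (forall x (h k : V -> R), {for x, continuous h} -> {for x, continuous k} ->
    {for x, continuous (fun y => op (h y) (k y))}) ->
  F = (fun x => op (f x) (g x)) -> smooth_on Omega F.
Proof.
move=> fs gs opd opc ->.
have E vs : forall x, Omega x ->
    iderivs vs (fun x => op (f x) (g x)) x = op (iderivs vs f x) (iderivs vs g x).
  elim: vs => [//|v vs IH] x Ox /=.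
  rewrite (@near_eq_derive _ _ _ _ (fun y => op (iderivs vs f y) (iderivs vs g y))).
    by have [] := opd x v _ _ ((fs vs).1 v x Ox) ((gs vs).1 v x Ox).
  have [r r0 rO] := open_ball_sub Ox; apply/near_ballE; exists r => // y /rO; exact: IH.
have near x vs : Omega x -> \forall y \near x,
    op (iderivs vs f y) (iderivs vs g y) = iderivs vs (fun x => op (f x) (g x)) y.
  move=> Ox; have [r r0 rO] := open_ball_sub Ox; apply/near_ballE; exists r => // y yr.
  by rewrite E//; exact: rO.
move=> vs; split=> [v x Ox|x Ox].
  apply: (near_eq_derivable (near x vs Ox)).
  by have [] := opd x v _ _ ((fs vs).1 v x Ox) ((gs vs).1 v x Ox).
have /continuous_forP H := opc x _ _ ((fs vs).2 x Ox) ((gs vs).2 x Ox).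
apply/continuous_forP => e /H[d d0 dH]; have [r r0 rO] := open_ball_sub Ox.
exists (Num.min d r) => [|y]; first by rewrite lt_min d0.
by rewrite lt_min => /andP[yd yr]; rewrite !E ?dH//; exact: rO.
Qed.

Lemma smooth_on0 : smooth_on Omega (fun=> 0).
Proof.
have E vs : iderivs vs (fun=> 0 : R) = (fun=> 0 : R) :> (V -> R).
  by elim: vs => [//|v vs /= ->]; apply/funext => x; exact: derive_cst.
move=> vs; rewrite E; split=> [v x _|x _]; first exact: derivable_cst.
exact: cst_continuous.
Qed.

Lemma smooth_on_addZ (a : R) f g : smooth_on Omega f -> smooth_on Omega g ->
  smooth_on Omega (fun x => a * f x + g x).
Proof.
move=> fs gs; apply: (@smooth_on_op (fun s t => a * s + t) _ f g fs gs _ _ erefl).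
  move=> x v h k hd kd; have Hh := derivableP hd; have Hk := derivableP kd.
  have H := @is_deriveD _ _ _ (a *: h) k x v _ _ (is_deriveZ a Hh) Hk.
  by split; [exact: (@ex_derive _ _ _ _ _ _ _ H)|exact: (@derive_val _ _ _ _ _ _ _ H)].
move=> x h k hc kc; apply: (@continuousD _ _ _ (fun y => a * h y) k) => //.
by apply: continuousM => //; exact: cst_continuous.
Qed.

Lemma smooth_on_Flam (C : nat -> V -> R) (lam : 'rV[R]_(n - 2)) :
  (forall k, (k < n - 1)%N -> smooth_on Omega (C k)) -> (2 <= n)%N ->
  smooth_on Omega (Flam C lam).
Proof.
move=> Cs n2; have sub (k : 'I_(n - 2)) : (k < n - 1)%N.
  by rewrite (bmx_n1E n2) ltnS ltnW.
have H (s : seq 'I_(n - 2)) : smooth_on Omega (fun x => \sum_(k <- s) lam 0 k * C k x).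
  elim: s => [|k s IH].
    by rewrite (_ : (fun x => _) = fun=> 0); [exact: smooth_on0|apply/funext => x; rewrite big_nil].
  rewrite (_ : (fun x => _) = fun x => lam 0 k * C k x + \sum_(k <- s) lam 0 k * C k x).
    exact: smooth_on_addZ (Cs _ (sub k)) IH.
  by apply/funext => x; rewrite big_cons.
rewrite (_ : Flam C lam = fun x => 1 * C (n - 2)%N x + \sum_(k < n - 2) lam 0 k * C k x).
  by apply: smooth_on_addZ; [apply: Cs; rewrite (bmx_n1E n2)|exact: H].
by apply/funext => x; rewrite mul1r.
Qed.

Lemma grad_Flam (C : nat -> V -> R) (lam : 'rV[R]_(n - 2)) x :
  (forall k, (k < n - 1)%N -> smooth_on Omega (C k)) -> (2 <= n)%N -> Omega x ->
  grad (Flam C lam) x = grad (C (n - 2)%N) x + \sum_(k < n - 2) lam 0 k *: grad (C k) x.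
Proof.
move=> Cs n2 Ox; have sub (k : 'I_(n - 2)) : (k < n - 1)%N.
  by rewrite (bmx_n1E n2) ltnS ltnW.
apply/rowP => j; rewrite !mxE summxE.
have Hd k : (k < n - 1)%N -> is_derive x (ebasis R j) (C k) (partial (C k) j x).
  by move=> kn; apply: derivableP; exact: ((Cs k kn [::]).1 _ _ Ox).
rewrite (_ : Flam C lam = C (n - 2)%N + \sum_(k < n - 2) (lam 0 k *: C k)); last first.
  by apply/funext => y; rewrite /Flam !fctE; congr (_ + _); rewrite fct_sumE.
have H0 : is_derive x (ebasis R j) (C (n - 2)%N) (partial (C (n - 2)%N) j x).
  by apply: Hd; rewrite (bmx_n1E n2).
have Hs := @is_derive_sum _ _ _ (n - 2) (fun k : 'I_(n - 2) => lam 0 k *: C k) x (ebasis R j)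
  _ (fun k => is_deriveZ (lam 0 k) (Hd k (sub k))).
have H := is_deriveD H0 Hs.
rewrite /partial (@derive_val _ _ _ _ _ _ _ H); congr (_ + _).
by apply: eq_bigr => k _; rewrite !mxE.
Qed.

End smooth.

(** The points with coordinates [s * a] and [s * b], for [s] between 0 and 1, form a Lipschitz path
    from [xe] by [chart_lipschitz], so its end lies in the same component. *)
Lemma chart_onto_component (R : realType) n (L : set 'rV[R]_n) xe l1 l2 x1 x2 : L xe ->
  chart_strict L xe l1 l2 x1 x2 -> chart_onto L xe l1 l2 ->
  chart_onto (connected_component L xe) xe l1 l2.
Proof.
move=> Lxe st [K [r [K0 r0 onto]]].
have [M [d [M0 d0 Lip]]] := chart_lipschitz st.
pose r' := Num.min r (d / (2 * K)) / 2.
have m0 : 0 < Num.min r (d / (2 * K)) by rewrite lt_min r0 divr_gt0// mulr_gt0.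
have r'0 : 0 < r' by rewrite divr_gt0.
have : r' < Num.min r (d / (2 * K)) by rewrite /r'; lra.
rewrite lt_min => /andP[r'r r'd]; clearbody r'.
exists K, r'; split=> // a b ar br.
have /choice[c cP] : forall s : R, exists x, 0 <= s <= 1 -> [/\ L x, ip l1 (x - xe) = s * a,
    ip l2 (x - xe) = s * b & `|x - xe| <= K * (`|s * a| + `|s * b|)].
  move=> s; have [/andP[s0 s1]|] := boolP (0 <= s <= 1); last by exists xe.
  have sm u : `|u| < r' -> `|s * u| < r.
    move=> ur; apply: le_lt_trans (lt_trans ur r'r).
    by rewrite normrM ger0_norm// ler_piMl.
  by have [x xP] := onto _ _ (sm a ar) (sm b br); exists x.
have cd s : 0 <= s <= 1 -> `|c s - xe| < d.
  move=> /[dup] sI /andP[s0 s1]; have [_ _ _ H] := cP s sI; apply: le_lt_trans H _.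
  rewrite !normrM (ger0_norm s0) -ltr_pdivlMl//.
  have : s * `|a| <= `|a| by rewrite ler_piMl.
  have : s * `|b| <= `|b| by rewrite ler_piMl.
  have -> : K^-1 * d = 2 * (d / (2 * K)) by field; rewrite gt_eqF.
  by move: ar br r'd; lra.
have I01 : 0 <= (0 : R) <= 1 by rewrite lexx ler01.
have I11 : 0 <= (1 : R) <= 1 by rewrite lexx ler01.
have c0 : c 0 = xe.
  have [_ _ _] := cP 0 I01; rewrite !mul0r normr0 addr0 mulr0 normr_le0 subr_eq0.
  by move/eqP.
have [_ a1 b1 K1] := cP 1 I11; rewrite !mul1r in a1 b1 K1.
exists (c 1); split=> //.
pose T := c @` `[0, 1].
have TL : T `<=` connected_component L xe.
  apply: connected_component_max.
  - by exists 0 => //=; rewrite in_itv.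
  - by move=> y [s]; rewrite /= in_itv /= => sI <-; case: (cP s sI).
  - apply: connected_continuous_connected; first exact: segment_connected.
    apply: (@lipschitz_within_continuous _ _ _ _ _ (M * (`|a| + `|b|))) => s t sI tI.
    have [Ls As Bs _] := cP s sI; have [Lt At Bt _] := cP t tI.
    have := Lip _ _ Ls Lt (cd s sI) (cd t tI).
    have -> : c s - c t = (c s - xe) - (c t - xe) by rewrite opprB addrA subrK.
    by rewrite (ipBr l1 (c s - xe)) (ipBr l2 (c s - xe)) As At Bs Bt -!mulrBl !normrM -mulrDr mulrCA mulrC.
by apply: TL; exists 1 => //=; rewrite in_itv.
Qed.

Lemma chart_strict_sub (R : realType) n (S T : set 'rV[R]_n) xe l1 l2 x1 x2 : S `<=` T ->
  chart_strict T xe l1 l2 x1 x2 -> chart_strict S xe l1 l2 x1 x2.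
Proof.
by move=> ST st e /st[d d0 dH]; exists d => // x y /ST Tx /ST Ty; exact: dH.
Qed.

(** * The symplectic leaf *)

Lemma det_continuous (R : realType) (V : normedModType R) m (M : V -> 'M[R]_m) x :
  (forall i j, {for x, continuous (fun y => M y i j)}) ->
  {for x, continuous (fun y => \det (M y))}.
Proof.
move=> Mc; apply: (@cvg_big _ _ +%R 0); first exact: add_continuous.
move=> s _; apply: cvgM; first exact: cvg_cst.
apply: cvg_big; first exact: mul_continuous.
by move=> i _; exact: Mc.
Qed.

Lemma continuous_rV (R : realType) (V : normedModType R) n (G : V -> 'rV[R]_n) x :
  (forall j, {for x, continuous (fun y => G y 0 j)}) -> {for x, continuous G}.
Proof.
move=> Gc; apply/continuous_forP => e e0.
have H (j : 'I_n) : \forall y \near x, `|G y 0 j - G x 0 j| <= e.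
  by have /continuous_forP/(_ e e0)/near_ballE := Gc j.
have /near_ballE[d d0 dH] : \forall y \near x, forall j, `|G y 0 j - G x 0 j| <= e.
  exact: filter_forall H.
exists d => // y /dH yH; apply: mx_norm_le => [|i j]; first exact: ltW.
by rewrite ord1 !mxE.
Qed.

Lemma ip_suml (R : realType) n I (r : seq I) (P : pred I) (G : I -> 'rV[R]_n) v :
  ip (\sum_(i <- r | P i) G i) v = \sum_(i <- r | P i) ip (G i) v.
Proof. exact: (big_morph (fun u => ip u v) (fun u w => ipDl u w v) (ip0l v)). Qed.

Section leaf.
Context {R : realType} {n : nat} (Omega : set 'rV[R]_n) (nu : 'rV[R]_n -> R).
Context (C : nat -> 'rV[R]_n -> R) (xe : 'rV[R]_n) (lam : 'rV[R]_(n - 2)).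
Local Notation V := 'rV[R]_n.
Hypotheses (n2 : (2 <= n)%N) (oO : open Omega) (nus : smooth_on Omega nu).
Hypothesis Cs : forall k, (k < n - 1)%N -> smooth_on Omega (C k).
Hypotheses (Oxe : Omega xe) (reg : regular nu C xe).
Hypothesis lamE :
  grad (C (n - 2)%N) xe + \sum_(k < n - 2) lam 0 k *: grad (C k) xe = 0.

Let dC (x : V) (k : nat) : V := grad (C k) x.
Let F := Flam C lam.
Let X := Xfield nu C.
Let L := leaf_level Omega nu C xe.
Let A := hess F xe.

Let Cs' k : (k < n - 2)%N -> smooth_on Omega (C k).
Proof. by move=> kn; apply: Cs; rewrite (bmx_n1E n2) ltnS ltnW. Qed.

Let Fs : smooth_on Omega F. Proof. exact: smooth_on_Flam. Qed.

Let Lxe : L xe. Proof. by []. Qed.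

Let gradFxe : grad F xe = 0.
Proof. by rewrite (grad_Flam _ Cs n2 Oxe). Qed.

(** [F] may stand for [H] because their gradients differ by a combination of the Casimir rows.
    Taking [m] to be the gradient of a Casimir or of [F] shows at once that these are conserved. *)
Lemma ip_Xfield m x : Omega x -> ip m (X x) = nu x * \det (bmx (dC x) m (grad F x)).
Proof.
move=> Ox; have -> : X x = nu x *: bcof n2 (dC x) (grad (C (n - 2)%N) x).
  apply/rowP => i; rewrite [LHS]mxE [RHS]mxE; congr (_ * _).
  rewrite -ip_ebasis ipC -det_bmx; congr (\det _); apply/matrixP => r j; rewrite !mxE.
  by case: ifP => _; rewrite ?mxE//; case: ifP => _; rewrite !mxE.
have swap g : \det (bmx (dC x) m g) = - ip g (bcof n2 (dC x) m).
  by rewrite (det_bmxN n2) (det_bmx n2).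
rewrite ipZr -det_bmx !swap (grad_Flam _ Cs n2 Ox) ipDl ip_suml big1 ?addr0// => k _.
by rewrite ipZl -(det_bmx n2) (det_bmx_alt1 n2)// mulr0.
Qed.

Lemma det_bmx_continuous l m x : Omega x ->
  {for x, continuous (fun y => \det (bmx (dC y) l m))}.
Proof.
move=> Ox; apply: det_continuous => r j.
rewrite (_ : (fun y => _) = fun y => if (r < n - 2)%N then partial (C r) j y
  else if (r == n - 2 :> nat)%N then l 0 j else m 0 j); last first.
  by apply/funext => y; rewrite !mxE; case: ifP => _; rewrite ?mxE//; case: ifP.
have [rn|_] := ltnP r (n - 2); last by case: ifP => _; exact: cst_continuous.
exact: smooth_on_continuous (smooth_on_partial j (Cs' rn)) Ox.
Qed.

Lemma Xfield_continuous x : Omega x -> {for x, continuous X}.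
Proof.
move=> Ox; apply: continuous_rV => j.
rewrite (_ : (fun y => X y 0 j) = fun y => nu y * \det (jacmat C j y)); last first.
  by apply/funext => y; rewrite mxE.
apply: continuousM; first exact: smooth_on_continuous nus Ox.
apply: det_continuous => r i.
rewrite (_ : (fun y => _) = fun y => if (r < n - 2)%N then partial (C r) i y
  else if (r == n - 2 :> nat)%N then (i == j)%:R else partial (C (n - 2)%N) i y); last first.
  by apply/funext => y; rewrite mxE.
have [rn|_] := ltnP r (n - 2).
  exact: smooth_on_continuous (smooth_on_partial i (Cs' rn)) Ox.
case: (r == n - 2 :> nat)%N; first exact: cst_continuous.
have Hs : smooth_on Omega (C (n - 2)%N) by apply: Cs; rewrite (bmx_n1E n2).
exact: smooth_on_continuous (smooth_on_partial i Hs) Ox.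
Qed.

Let gradF : strict_diffV (grad F) xe A^T.
Proof. exact: (smooth_on_grad oO Fs Oxe). Qed.

Let A_sym : A^T = A.
Proof.
have [r r0 rO] := open_ball_sub oO Oxe.
apply: (hessian_symmetric r0 _ gradF) => x /rO Ox.
exact: (smooth_on_strict_diff oO Fs Ox).
Qed.

Lemma Xfield_xe : X xe = 0.
Proof.
apply/rowP => j; rewrite -ip_ebasis ipC ip_Xfield// gradFxe mxE.
by rewrite det_bmxN// det_bmx ip0l oppr0 mulr0.
Qed.

(* At a point where the field does not vanish, the gradients of the Casimirs, of [F] and a
   form [m] not vanishing on the field are independent, and a curve in the leaf on which [F] is
   constant has zero velocity against all of them but [m]. *)
Lemma leaf_integral (a : R) S : a != 0 -> S `<=` L ->
  integral_near (fun x => (F x - F xe) / a) X S xe.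
Proof.
move=> a0 SL; have [r r0 rO] := open_ball_sub oO Oxe.
exists r => //; split=> [x /rO Ox|x /rO Ox|c t /rO Ox cX|c t m k Sc /rO Ox cc fcc mk mX].
- apply: continuousM; last exact: cst_continuous.
  by apply: continuousB; [exact: smooth_on_continuous Fs Ox|exact: cst_continuous].
- exact: Xfield_continuous.
- have H := strict_diff_curve erefl (smooth_on_strict_diff oO Fs Ox) cX.
  have E0 : ip (grad F (c t)) (X (c t)) = 0.
    by rewrite ip_Xfield// det_bmx_alt// mulr0.
  rewrite E0 in H.
  have HB := @is_deriveB _ _ _ _ _ t 1 _ _ H (is_derive_cst (F xe) t 1).
  have := @is_deriveZ _ _ _ _ a^-1 t 1 _ HB; rewrite subr0 scaler0.
  congr (is_derive _ _ _ _); apply/funext => s.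
  by rewrite !fctE /= mulrC.
- have FE s : F (c s) = F (c t).
    have := fcc s; move/(mulIf (invr_neq0 a0))/eqP.
    by rewrite (inj_eq (addIr _)) => /eqP.
  have CE j s : (j < n - 2)%N -> C j (c s) = C j (c t).
    by move=> jn; have [_ [-> // _]] := SL _ (Sc s); have [_ [-> // _]] := SL _ (Sc t).
  pose x := c t; pose N := bmx (dC x) m (grad F x).
  (* By [ip_Xfield], [nu x * \det N] is the nonzero number [ip m (X x)]. *)
  have Nu : N^T \in unitmx.
    rewrite unitmx_tr unitmxE unitfE; apply/eqP => N0.
    by move: mX; rewrite ip_Xfield// -/x -/N N0 mulr0 eqxx.
  pose w : V := k *: delta_mx 0 (bmx_i1 n2).
  have <- : w *m invmx N^T = (k / ip m (X x)) *: X x.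
    apply: (can_inj (mulmxK Nu)); rewrite mulmxKV//; apply/rowP => i.
    rewrite -scalemxAl [LHS]mxE [RHS]mxE /N mul_bmxT [delta_mx _ _ _ _]mxE eqxx /= [ip (X x) _]ipC.
    have [ri|->|->] := bmx_ordP n2 i.
    + rewrite row_bmx ri -val_eqE /= ltn_eqF// mulr0 -/(dC x i) (ip_Xfield (dC x i) Ox).
      by rewrite (det_bmx_alt1 n2 (dC x) (grad F x) ri) !mulr0.
    + by rewrite row_bmx1 eqxx mulr1 divfK.
    + rewrite row_bmx2 eq_sym (negPf (bmx_i12 n2)) mulr0 (ip_Xfield (grad F x) Ox) (det_bmx_alt n2).
      by rewrite !mulr0.
  apply: is_derive_preimage => // e e0.
  have /boolp.choice[d dP] : forall i : 'I_n, exists d : R, 0 < d /\ forall h : R, `|h| < d ->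
      `|((c (t + h) - c t) *m N^T - h *: w) 0 i| <= e * (`|c (t + h) - c t| + `|h|).
    (* A function constant along the curve bounds the component of the increment along its gradient
       by [e] times the increment, the error that [is_derive_preimage] tolerates. *)
    have small g : strict_diff g x (grad g x) -> (forall s, g (c s) = g (c t)) ->
        exists d : R, 0 < d /\ forall h : R, `|h| < d ->
        `|ip (c (t + h) - c t) (grad g x)| <= e * `|c (t + h) - c t|.
      move=> gd gc; have [d d0 dH] := gd e e0.
      have /continuous_forP/(_ (d / 2))[|d' d'0 d'H] := cc; first by rewrite divr_gt0.
      exists d'; split=> // h hd; have cd : `|c (t + h) - x| < d.
        have := d'H (t + h); rewrite [t + h]addrC addrK => /(_ hd); rewrite addrC /x; lra.
      have := dH _ x cd; rewrite subrr normr0 => /(_ d0).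
      by rewrite gc subrr sub0r normrN ipC.
    move=> i; have [ri|->|->] := bmx_ordP n2 i.
    + have [d [d0 dH]] := small _ (smooth_on_strict_diff oO (Cs' ri) Ox) (fun s => CE i s ri).
      exists d; split=> // h /dH H.
      rewrite mxE mul_bmxT row_bmx ri !mxE eqxx -val_eqE /= ltn_eqF// !mulr0 subr0.
      by rewrite (le_trans H)// ler_wpM2l ?(ltW e0)// lerDl.
    + have /is_deriveP/(_ e e0)[d d0 dH] := mk; exists d; split=> // h /dH.
      rewrite mxE mul_bmxT row_bmx1 !mxE !eqxx mulr1 -ipBr ipC => H.
      by rewrite (le_trans H)// ler_wpM2l ?(ltW e0)// lerDr.
    + have [d [d0 dH]] := small _ (smooth_on_strict_diff oO Fs Ox) FE.
      exists d; split=> // h /dH H.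
      rewrite mxE mul_bmxT row_bmx2 !mxE eqxx /= eq_sym (negPf (bmx_i12 n2)) !mulr0 subr0.
      by rewrite (le_trans H)// ler_wpM2l ?(ltW e0)// lerDl.
  exists (\big[Num.min/1]_i d i).
    by apply/bigmin_gtP; split=> // i _; case: (dP i).
  move=> h /bigmin_gtP[_ hd]; apply: mx_norm_le => [|i j].
    by rewrite mulr_ge0 ?(ltW e0) ?addr_ge0.
  by rewrite ord1; exact: (dP j).2 _ (hd j isT).
Qed.

Context (l1 l2 x1 x2 : V).
Hypothesis fr : frame (dC xe) l1 l2 x1 x2.

Let N := bmx (dC xe) l1 l2.

Let Nu : N^T \in unitmx.
Proof. by case: fr => d0 _ _ _; rewrite unitmx_tr unitmxE unitfE. Qed.

(** Straightens the leaf: the level set of the Casimirs is a fibre of the first [n - 2] coordinates,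
    and the last two are the chart, up to the shift by [xe]. *)
Let chart_map (x : V) : V := \row_r
  if (r < n - 2)%N then C r x else if (r == n - 2 :> nat)%N then ip l1 x else ip l2 x.

Let chart_map1 x : chart_map x 0 (bmx_i1 n2) = ip l1 x.
Proof. by rewrite mxE /= ltnn eqxx. Qed.

Let chart_map2 x : chart_map x 0 (bmx_i2 n2) = ip l2 x.
Proof. by rewrite mxE /= (bmx_n1E n2) ltnNge leqnSn /= gtn_eqF. Qed.

Let strict_diff_ip (l p : V) : strict_diff (ip l) p l.
Proof.
move=> e e0; exists 1 => // x y _ _.
by rewrite ipBr subrr normr0 mulr_ge0// ltW.
Qed.

Let chart_map_strict : strict_diffV chart_map xe N^T.
Proof.
apply: strict_diffV_coord => j; rewrite trmxK /N.
have [ri|->|->] := bmx_ordP n2 j.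
- rewrite row_bmx ri (_ : (fun x => _) = C j); last by apply/funext => x; rewrite mxE ri.
  exact: (smooth_on_strict_diff oO (Cs' ri) Oxe).
- rewrite row_bmx1 (_ : (fun x => _) = ip l1); first exact: strict_diff_ip.
  by apply/funext => x; exact: chart_map1.
- rewrite row_bmx2 (_ : (fun x => _) = ip l2); first exact: strict_diff_ip.
  by apply/funext => x; exact: chart_map2.
Qed.

(** Two points of the leaf share their Casimir values, so their images under [chart_map] differ
    exactly by the image of the tangent vector [z] under [N^T]; applying the inverse compares
    [x - y] with [z]. *)
Lemma leaf_strict : chart_strict L xe l1 l2 x1 x2.
Proof.
move=> e e0; have [k k0 kP] := mulmxr_bounded (invmx N^T).
have [d d0 dH] := chart_map_strict (divr_gt0 e0 k0).
case: (fr) => _ ax [l11 l12] [l21 l22].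
exists d => // x y [_ [Cx _]] [_ [Cy _]] xd yd.
set z := _ *: x1 + _ *: x2.
have zE : chart_map x - chart_map y = z *m N^T.
  apply/rowP => j; rewrite /N mul_bmxT ipC.
  have -> : (chart_map x - chart_map y) 0 j = chart_map x 0 j - chart_map y 0 j by rewrite !mxE.
  have [ri|->|->] := bmx_ordP n2 j.
  - have [a1 a2] := ax j ri.
    by rewrite row_bmx ri !mxE ri (Cx j ri) (Cy j ri) subrr /z (ipDr _ (_ *: x1)) !ipZr a1 a2 !mulr0 addr0.
  - by rewrite row_bmx1 !chart_map1 -ipBr /z (ipDr _ (_ *: x1)) !ipZr l11 l12 mulr1 mulr0 addr0.
  - by rewrite row_bmx2 !chart_map2 -ipBr /z (ipDr _ (_ *: x1)) !ipZr l21 l22 mulr1 mulr0 add0r.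
have -> : x - y - z = - ((chart_map x - chart_map y - (x - y) *m N^T) *m invmx N^T).
  by rewrite zE -mulmxBl mulmxK// opprB.
rewrite normrN; apply: le_trans (kP _) _; rewrite -ler_pdivlMl//.
by apply: le_trans (dH x y xd yd) _; rewrite mulrA [k^-1 * e]mulrC.
Qed.

Let row_free_bmx m m1 m2 : \det (bmx (dC m) m1 m2) != 0 -> row_free (grads (n - 2) C m).
Proof.
move=> d0; have Mu : bmx (dC m) m1 m2 \in unitmx by rewrite unitmxE unitfE.
pose g (i : 'I_(n - 2)) : 'I_n := Ordinal (ltn_trans (ltn_ord i) (bmx_ltn1 n2)).
have -> : grads (n - 2) C m = rowsub g (bmx (dC m) m1 m2).
  by apply/matrixP => i j; rewrite !mxE /= ltn_ord /dC mxE.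
apply/row_freeP; exists (invmx (bmx (dC m) m1 m2) *m (rowsub g 1%:M)^T).
rewrite mulmxA mul_rowsub_mx mulmxV//; apply/matrixP => i j; rewrite !mxE.
rewrite (bigD1 (g i))//= !mxE eqxx mul1r big1 ?addr0; last first.
  by move=> r ri; rewrite !mxE eq_sym (negPf ri) mul0r.
by rewrite -!val_eqE /= eq_sym val_eqE.
Qed.

(** [chart_map] takes all values near that of [xe], in particular those with unchanged Casimirs.
    Such points are regular, since [nu] and the determinant of the frame stay nonzero nearby. *)
Lemma leaf_onto : chart_onto L xe l1 l2.
Proof.
have [K [r [K0 r0 loc]]] := strict_diffV_locally_onto chart_map_strict Nu.
have [r1 r10 rO] := open_ball_sub oO Oxe.
have [nu0 _] := reg.
have near0 (g : V -> R) : {for xe, continuous g} -> g xe != 0 ->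
    exists2 d : R, 0 < d & forall x, `|x - xe| < d -> g x != 0.
  move=> gc g0; have g20 : 0 < `|g xe| / 2 by rewrite divr_gt0 ?normr_gt0.
  have /continuous_forP/(_ _ g20)[d d0 dH] := gc; exists d => // x /dH H.
  apply/eqP => gx; move: H; rewrite gx sub0r normrN.
  have : 0 < `|g xe| by rewrite normr_gt0.
  lra.
have [r2 r20 H2] := near0 _ (smooth_on_continuous nus Oxe) nu0.
case: (fr) => dN _ _ _.
have [r3 r30 H3] := near0 (fun y => \det (bmx (dC y) l1 l2)) (@det_bmx_continuous l1 l2 _ Oxe) dN.
pose m := Num.min r (Num.min r1 (Num.min r2 r3) / K).
have m0 : 0 < m by rewrite lt_min r0 divr_gt0// !lt_min r10 r20.
exists K, (m / 2); split; [by []|by rewrite divr_gt0|move=> a b am bm].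
pose w : V := a *: delta_mx 0 (bmx_i1 n2) + b *: delta_mx 0 (bmx_i2 n2).
have wn : `|w| <= `|a| + `|b|.
  apply: le_trans (ler_normD _ _) _; rewrite !normrZ lerD// ler_piMr//.
    by apply: mx_norm_le => // i j; rewrite mxE; case: (_ && _); rewrite ?normr1 ?normr0.
  by apply: mx_norm_le => // i j; rewrite mxE; case: (_ && _); rewrite ?normr1 ?normr0.
have wm : `|w| < m by move: wn am bm; lra.
have [|x xE xK] := loc (chart_map xe + w).
  by rewrite addrC addKr; apply: lt_le_trans wm _; rewrite ge_min lexx.
rewrite [chart_map xe + w]addrC addrK in xK.
have xw : `|x - xe| < Num.min r1 (Num.min r2 r3).
  apply: le_lt_trans xK _; rewrite -ltr_pdivlMl// mulrC.
  by apply: lt_le_trans wm _; rewrite ge_min lexx orbT.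
move: xw; rewrite !lt_min => /andP[xr1 /andP[xr2 xr3]].
exists x; split.
- split; first exact: rO.
  split; last by split; [exact: H2|exact: row_free_bmx (H3 _ xr3)].
  move=> k kn; have kn' := ltn_trans kn (bmx_ltn1 n2).
  have /rowP/(_ (Ordinal kn')) := xE.
  rewrite !mxE /= kn -!val_eqE /= !ltn_eqF//; last by rewrite (bmx_n1E n2) ltnS ltnW.
  by rewrite !mulr0 !addr0.
- have /rowP/(_ (bmx_i1 n2)) := xE; rewrite chart_map1 mxE chart_map1 ipBr => ->.
  by rewrite addrAC subrr add0r !mxE /= ?eqxx (negPf (bmx_i12 n2)) mulr1 mulr0 addr0.
- have /rowP/(_ (bmx_i2 n2)) := xE; rewrite chart_map2 mxE chart_map2 ipBr => ->.
  by rewrite addrAC subrr add0r !mxE /= ?eqxx eq_sym (negPf (bmx_i12 n2)) mulr1 mulr0 add0r.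
- by apply: le_trans xK _; rewrite ler_wpM2l// ltW.
Qed.

Let rho0 := nu xe * \det N.
Let q u v := ip (u *m A) v.

Let q_sym u v : q u v = q v u.
Proof.
have -> : q u v = (u *m A *m v^T)^T 0 0 by rewrite [RHS]mxE.
by rewrite !trmx_mul trmxK A_sym mulmxA.
Qed.

Let q_bounded : exists2 k : R, 0 < k & forall u v, `|q u v| <= k * `|u| * `|v|.
Proof.
have [k k0 kP] := mulmxr_bounded A.
exists (n%:R * k + 1) => [|u v]; first by rewrite ltr_wpDl// mulr_ge0// ltW.
apply: le_trans (ip_norm_le _ _) _; rewrite ler_wpM2r//.
have := ler_wpM2l (ler0n R n) (kP u); rewrite mulrA => H; apply: le_trans H _.
by rewrite ler_wpM2r// lerDl.
Qed.

(** By [ip_Xfield] the pairing is linear in the gradient of [F], with a continuous coefficient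
    vector [ka]. Three errors of size [e / 3] replace [ka x] by [ka xe], the gradient by its linear
    part, and [x - xe] by [z]; [det_frame] evaluates the result. *)
Lemma ip_Xfield_expansion m e : 0 < e -> exists2 d : R, 0 < d &
  forall x, L x -> `|x - xe| < d ->
  let z := ip l1 (x - xe) *: x1 + ip l2 (x - xe) *: x2 in
  `|ip m (X x) - rho0 * (ip m x1 * q z x2 - ip m x2 * q z x1)| <= e * `|x - xe|.
Proof.
move=> e0; have [r r0 rO] := open_ball_sub oO Oxe.
pose ka (x : V) : V := \row_j (nu x * \det (bmx (dC x) m (ebasis R j))).
have kaE g x : nu x * \det (bmx (dC x) m g) = ip g (ka x).
  rewrite (det_bmxN n2) (det_bmx n2) mulrN -mulNr -ipZr.
  have -> // : - nu x *: bcof n2 (dC x) m = ka x.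
  apply/rowP => j; rewrite [RHS]mxE (det_bmxN n2) (det_bmx n2) [ip (ebasis R j) _]ipC ip_ebasis mxE.
  by rewrite mulNr mulrN.
have kac : {for xe, continuous ka}.
  apply: continuous_rV => j.
  rewrite (_ : (fun y => _) = fun y => nu y * \det (bmx (dC y) m (ebasis R j))).
    apply: continuousM; first exact: (smooth_on_continuous nus Oxe).
    exact: det_bmx_continuous.
  by apply/funext => y; rewrite mxE.
have [kA kA0 kAP] := mulmxr_bounded A.
pose M : R := n%:R * (kA + 1) + 1; have M0 : 0 < M by rewrite ltr_wpDl// mulr_ge0// addr_ge0// ltW.
pose c : R := n%:R * `|ka xe| + 1; have c0 : 0 < c by rewrite ltr_wpDl// mulr_ge0.
have /continuous_forP/(_ (e / (3 * M)))[|d1 d10 H1] := kac; first by rewrite divr_gt0// mulr_gt0.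
have e2 : 0 < Num.min 1 (e / (3 * c)) by rewrite lt_min ltr01 divr_gt0// mulr_gt0.
have [d2 d20 H2] := gradF e2.
have e3 : 0 < e / (3 * c * kA) by rewrite divr_gt0// !mulr_gt0.
have [d3 d30 H3] := leaf_strict e3.
exists (Num.min (Num.min r d1) (Num.min d2 d3)) => [|x Lx]; first by rewrite !lt_min r0 d10 d20.
rewrite !lt_min => /andP[/andP[/rO Ox /H1 xd1] /andP[xd2 xd3]] /=; set z := _ *: x1 + _ *: x2.
have := H2 x xe xd2; rewrite subrr normr0 gradFxe subr0 A_sym => /(_ d20) {}H2.
have := H3 x xe Lx Lxe xd3; rewrite subrr normr0 -/z => /(_ d30) {}H3.
have H2a : `|grad F x - (x - xe) *m A| <= `|x - xe|.
  by apply: le_trans H2 _; rewrite ler_piMl// ge_min lexx.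
have H2b : `|grad F x - (x - xe) *m A| <= e / (3 * c) * `|x - xe|.
  by apply: le_trans H2 _; rewrite ler_wpM2r// ge_min lexx orbT.
have gb : `|grad F x| <= (kA + 1) * `|x - xe|.
  rewrite -[grad F x](subrK ((x - xe) *m A)) (le_trans (ler_normD _ _))//.
  by have := kAP (x - xe); rewrite mulrDl mul1r; lra.
have -> : rho0 * (ip m x1 * q z x2 - ip m x2 * q z x1) = ip (z *m A) (ka xe).
  by rewrite -kaE (det_frame n2 _ _ fr) /rho0 /q mulrA.
rewrite ip_Xfield// kaE.
have -> : ip (grad F x) (ka x) - ip (z *m A) (ka xe) =
    ip (grad F x) (ka x - ka xe) + ip (grad F x - (x - xe) *m A) (ka xe) +
    ip ((x - xe - z) *m A) (ka xe).
  rewrite (ipBr (grad F x)) (mulmxBl (x - xe) z) (ipBl (grad F x)) (ipBl ((x - xe) *m A)).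
  by rewrite !addrA !subrK.
have A1 : `|ip (grad F x) (ka x - ka xe)| <= e / 3 * `|x - xe|.
  apply: le_trans (ip_norm_le _ _) _.
  apply: (@le_trans _ _ (M * `|x - xe| * (e / (3 * M)))).
    apply: ler_pM; rewrite ?mulr_ge0 ?(ltW xd1)//.
    apply: le_trans (ler_wpM2l (ler0n R n) gb) _; rewrite mulrA ler_wpM2r//.
    by rewrite /M lerDl.
  by rewrite le_eqVlt; apply/orP; left; apply/eqP; field; rewrite gt_eqF.
have B1 v : n%:R * v * `|ka xe| <= c * `|v|.
  rewrite mulrAC; apply: (@le_trans _ _ (n%:R * `|ka xe| * `|v|)).
    by rewrite ler_wpM2l ?mulr_ge0// ler_norm.
  by rewrite ler_wpM2r// lerDl.
have A2 : `|ip (grad F x - (x - xe) *m A) (ka xe)| <= e / 3 * `|x - xe|.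
  apply: le_trans (ip_norm_le _ _) _; apply: le_trans (B1 _) _; rewrite normr_id.
  apply: le_trans (ler_wpM2l (ltW c0) H2b) _.
  by rewrite le_eqVlt; apply/orP; left; apply/eqP; field; rewrite gt_eqF.
have A3 : `|ip ((x - xe - z) *m A) (ka xe)| <= e / 3 * `|x - xe|.
  apply: le_trans (ip_norm_le _ _) _; apply: le_trans (B1 _) _; rewrite normr_id.
  apply: le_trans (ler_wpM2l (ltW c0) (kAP _)) _.
  apply: le_trans (ler_wpM2l (ltW c0) (ler_wpM2l (ltW kA0) H3)) _.
  by rewrite le_eqVlt; apply/orP; left; apply/eqP; field; rewrite !gt_eqF.
apply: le_trans (ler_normD _ _) _; apply: le_trans (lerD (ler_normD _ _) (lexx _)) _.
by move: A1 A2 A3; lra.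
Qed.

Lemma leaf_field : chart_field X L xe l1 l2
  (rho0 * q x1 x2) (rho0 * q x2 x2) (- (rho0 * q x1 x1)) (- (rho0 * q x1 x2)).
Proof.
move=> e e0; case: (fr) => _ _ [l11 l12] [l21 l22].
have [d1 d10 H1] := ip_Xfield_expansion l1 e0; have [d2 d20 H2] := ip_Xfield_expansion l2 e0.
exists (Num.min d1 d2) => [|x Lx]; first by rewrite lt_min d10.
rewrite lt_min => /andP[/(H1 x Lx) {}H1 /(H2 x Lx) {}H2].
move: H1 H2; rewrite /= l11 l12 l21 l22 /q !mulmxDl -!scalemxAl.
rewrite !(ipDl _ _ x1, ipDl _ _ x2, ipZl _ _ x1, ipZl _ _ x2) -/(q _ _) -/(q _ _) -/(q _ _) -/(q _ _).
set u1 := ip l1 (x - xe); set u2 := ip l2 (x - xe); rewrite (q_sym x2 x1) => H1 H2.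
split; [apply: le_trans H1|apply: le_trans H2]; rewrite le_eqVlt; apply/orP; left; apply/eqP;
  congr `| _ |; ring.
Qed.

(** [level_estimate] produces the quadratic form of [A] at [x - xe]. Passing to the tangential part
    [z] costs only an admissible error, because [qE] writes the difference as products in which one
    factor is small. *)
Lemma leaf_level_chart (a : R) : a != 0 -> q x1 x1 = a -> q x2 x2 = a -> q x1 x2 = 0 ->
  chart_level (fun x => (F x - F xe) / a) L xe l1 l2.
Proof.
move=> a0 q11 q22 q12 e e0; have [r r0 rO] := open_ball_sub oO Oxe.
have [k k0 kP] := q_bounded.
have a0' : 0 < `|a| by rewrite normr_gt0.
have e1 : 0 < e * `|a| / 2 by rewrite divr_gt0// mulr_gt0.
have [d1 d10 H1] := level_estimate r0 (fun x xr => smooth_on_strict_diff oO Fs (rO x xr))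
  gradF gradFxe e1.
(* The two products of [qE] contribute 2 and 4 to the factor 6; the bound 1 gives
   [|z v - z w| <= 2 * |v - w|]. *)
have e2 : 0 < Num.min 1 (e * `|a| / (6 * k)) by rewrite lt_min ltr01 divr_gt0// mulr_gt0.
have [d2 d20 H2] := leaf_strict e2.
exists (Num.min d1 d2) => [|x y Lx Ly]; first by rewrite lt_min d10.
rewrite !lt_min => /andP[xd1 xd2] /andP[yd1 yd2].
have xed : `|xe - xe| < d2 by rewrite subrr normr0.
have {}H1 := H1 x y xd1 yd1.
have Hxy := H2 x y Lx Ly xd2 yd2; have Hx := H2 x xe Lx Lxe xd2 xed.
have Hy := H2 y xe Ly Lxe yd2 xed.
set m := Num.max _ _ in H1 *; set t := Num.min _ _ in Hxy Hx Hy e2.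
have t1 : t <= 1 by rewrite ge_min lexx.
have tk : t <= e * `|a| / (6 * k) by rewrite ge_min lexx orbT.
pose z (v : V) := ip l1 v *: x1 + ip l2 v *: x2.
rewrite -/(z (x - y)) in Hxy; rewrite -/(z (x - xe)) in Hx; rewrite -/(z (y - xe)) in Hy.
have m0 : 0 <= m by rewrite le_max normr_ge0.
have xm : `|x - xe| <= m by rewrite le_max lexx.
have ym : `|y - xe| <= m by rewrite le_max lexx orbT.
have zB v w : z (v - w) = z v - z w.
  by rewrite /z !ipBr !scalerBl opprD addrACA.
have qz v : q (z v) (z v) = a * (ip l1 v ^+ 2 + ip l2 v ^+ 2).
  rewrite /q /z mulmxDl -!scalemxAl ipDl !ipDr !ipZl !ipZr -!/(q _ _) q11 q22 (q_sym x2 x1) q12.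
  by ring.
have qD u v w : q (u + v) w = q u w + q v w by rewrite /q mulmxDl ipDl.
have qN u w : q (- u) w = - q u w by rewrite /q mulNmx ipNl.
have qDr u v w : q w (u + v) = q w u + q w v by rewrite /q ipDr.
have qNr u w : q w (- u) = - q w u by rewrite /q ipNr.
have qE (v w zv zw : V) : q v v - q w w - (q zv zv - q zw zw) =
    q (v + w) (v - w - (zv - zw)) + q (v - zv + (w - zw)) (zv - zw).
  rewrite !(qD, qDr, qN, qNr) ?(q_sym w v) ?(q_sym zv v) ?(q_sym zw v).
  rewrite ?(q_sym zv w) ?(q_sym zw w) ?(q_sym zw zv).
  move: (q v v) (q w w) (q zv zv) (q zw zw) (q v w) (q zv zw) (q v zv) (q v zw) (q w zv) (q w zw).
  by move=> *; ring.
pose v := x - xe; pose w := y - xe.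
have xyE : x - y = v - w by rewrite /v /w opprB addrA subrK.
rewrite xyE zB in Hxy.
have B : `|q v v - q w w - (q (z v) (z v) - q (z w) (z w))| <= e * `|a| * m * `|x - y|.
  rewrite qE; apply: le_trans (ler_normD _ _) _.
  have D0 : 0 <= `|v - w| by [].
  have zvw : `|z v - z w| <= 2 * `|v - w|.
    rewrite -[z v - z w](subKr (v - w)) (le_trans (ler_normB _ _))//.
    have : t * `|v - w| <= 1 * `|v - w| by rewrite ler_wpM2r.
    by move: Hxy; lra.
  have P1 : `|q (v + w) (v - w - (z v - z w))| <= k * (2 * m) * (t * `|v - w|).
    apply: le_trans (kP _ _) _; apply: ler_pM => //; first by rewrite mulr_ge0// ltW.
    by rewrite ler_wpM2l ?(ltW k0)// (le_trans (ler_normD _ _))//; move: xm ym; rewrite /v /w; lra.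
  have P2 : `|q (v - z v + (w - z w)) (z v - z w)| <= k * (2 * (t * m)) * (2 * `|v - w|).
    apply: le_trans (kP _ _) _; apply: ler_pM => //; first by rewrite mulr_ge0// ltW.
    rewrite ler_wpM2l ?(ltW k0)// (le_trans (ler_normD _ _))//.
    have := ler_wpM2l (ltW e2) xm; have := ler_wpM2l (ltW e2) ym.
    by move: Hx Hy; rewrite -/v -/w; lra.
  apply: le_trans (lerD P1 P2) _; rewrite xyE.
  have -> : k * (2 * m) * (t * `|v - w|) + k * (2 * (t * m)) * (2 * `|v - w|) =
      t * (6 * k) * (m * `|v - w|) by ring.
  rewrite -[leRHS]mulrA ler_wpM2r ?mulr_ge0// -ler_pdivlMr// mulr_gt0//.
have -> : (F x - F xe) / a - (F y - F xe) / a -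
    (ip l1 (x - xe) ^+ 2 + ip l2 (x - xe) ^+ 2 - (ip l1 (y - xe) ^+ 2 + ip l2 (y - xe) ^+ 2)) / 2 =
    (F x - F y - (q v v - q w w) / 2 + (q v v - q w w - (q (z v) (z v) - q (z w) (z w))) / 2) / a.
  rewrite !qz -/v -/w; move: (F x) (F y) (F xe) (q v v) (q w w) (ip _ _) (ip _ _) (ip _ _) (ip _ _).
  by move=> *; field.
rewrite normrM normfV ler_pdivrMr//; apply: le_trans (ler_normD _ _) _.
rewrite (_ : e * m * `|x - y| * `|a| = e * `|a| / 2 * m * `|x - y| + (e * `|a| * m * `|x - y|) / 2); last by field.
rewrite lerD// normrM [`|2^-1|]ger0_norm// ler_wpM2r//.
Qed.

(* Jacobi's formula turns the minor of the inverse Hessian that defines [IX] into the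
   complementary minor of the Hessian, which lives on the tangent plane of the leaf. *)
Lemma IX_frame : A \in unitmx ->
  IX nu C lam xe = rho0 ^+ 2 * (q x1 x1 * q x2 x2 - q x1 x2 ^+ 2).
Proof.
move=> Au; case: (fr) => dN ax [l11 l12] [l21 l22].
have Nun : N \in unitmx by rewrite unitmxE unitfE.
(* The leading minor of [W] is the determinant in [IX]. The last two columns of the inverse of [N]
   are [x1] and [x2], so the trailing minor of [Q] is the determinant of the restricted Hessian. The
   factor [\det A] cancels against [\det W]. *)
pose W := N *m invmx A *m N^T; pose Q := (invmx N)^T *m A *m invmx N.
have WQ : W *m Q = 1%:M.
  rewrite /W /Q -!mulmxA [N^T *m _]mulmxA -trmx_mul mulVmx// trmx1 mul1mx.
  by rewrite [invmx A *m _]mulmxA mulVmx// mul1mx mulmxV.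
have colN i x : (forall j, ip (row j N) x = (j == i)%:R) -> col i (invmx N) = x^T.
  move=> H; have H2 : N *m x^T = delta_mx i 0.
    apply/matrixP => j o; rewrite (ord1 o) [RHS]mxE eqxx andbT -(H j) ipE mxE.
    by apply: eq_bigr => s _; rewrite !mxE.
  by rewrite -[x^T](mulKmx Nun) H2 colE.
have c1 : col (bmx_i1 n2) (invmx N) = x1^T.
  apply: colN => j; have [ri|->|->] := bmx_ordP n2 j.
  - by rewrite row_bmx ri -val_eqE /= ltn_eqF//; have [] := ax j ri.
  - by rewrite row_bmx1 eqxx.
  - by rewrite row_bmx2 eq_sym (negPf (bmx_i12 n2)).
have c2 : col (bmx_i2 n2) (invmx N) = x2^T.
  apply: colN => j; have [ri|->|->] := bmx_ordP n2 j.
  - rewrite row_bmx ri -val_eqE /= ltn_eqF//; first by have [] := ax j ri.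
    by rewrite (bmx_n1E n2) ltnS ltnW.
  - by rewrite row_bmx1 (negPf (bmx_i12 n2)).
  - by rewrite row_bmx2 eqxx.
have QE i j u v : col i (invmx N) = u^T -> col j (invmx N) = v^T -> Q i j = q u v.
  move=> iu jv; rewrite /q ipE mxE; apply: eq_bigr => s _.
  have /colP/(_ s) := jv; rewrite !mxE => ->; congr (_ * _).
  apply: eq_bigr => o _; congr (_ * _).
  by have /colP/(_ o) := iu; rewrite !mxE.
pose g (i : 'I_(n - 2)) : 'I_n := Ordinal (ltn_trans (ltn_ord i) (bmx_ltn1 n2)).
have nE : n = (n - 2 + 2)%N by rewrite subnK.
have := jacobi_minor2 nE (fun i => erefl : val (g i) = val i) (erefl : val (bmx_i1 n2) = (n - 2)%N)
  (bmx_n1E n2 : val (bmx_i2 n2) = (n - 2).+1) WQ.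
rewrite !(QE _ _ x1 x1 c1 c1, QE _ _ x2 x2 c2 c2, QE _ _ x1 x2 c1 c2, QE _ _ x2 x1 c2 c1).
rewrite (q_sym x2 x1) -expr2 => J.
rewrite /IX -/F -/A /wedge_ip.
rewrite (_ : \matrix_(i, j) _ = \matrix_(i < n - 2, j < n - 2) W (g i) (g j)); last first.
  apply/matrixP => i j; rewrite [LHS]mxE [RHS]mxE /ip.
  have rg s : row (g s) N = grad (C s) xe by rewrite row_bmx /= ltn_ord.
  rewrite trmx_mul trmxK trmx_inv A_sym -!rg.
  rewrite /W -!row_mul !mxE.
  by apply: eq_bigr => s _; rewrite !mxE.
rewrite J /W !det_mulmx det_tr det_inv /rho0.
have dA : \det A != 0 by rewrite -unitfE -unitmxE.
by field.
Qed.

(* Rescaling the frame makes the restricted Hessian [al] times the identity; the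
   constant in front of the field is then forced up to sign by [om ^+ 2]. *)
Lemma leaf_isotropic_frame (om : R) : 0 < om ->
    om ^+ 2 = rho0 ^+ 2 * (q x1 x1 * q x2 x2 - q x1 x2 ^+ 2) ->
  exists k1 k2 y1 y2 : V, exists al : R, frame (dC xe) k1 k2 y1 y2 /\
    [/\ al != 0, q y1 y1 = al, q y2 y2 = al, q y1 y2 = 0 &
        nu xe * \det (bmx (dC xe) k1 k2) = - om / al].
Proof.
move=> om0 omE; have omN0 : om != 0 by rewrite gt_eqF.
have om20 : 0 < om ^+ 2 by rewrite exprn_gt0.
have r0 : rho0 != 0 by apply: contraTneq om20 => r0; rewrite omE r0 expr0n mul0r ltxx.
have q0 : q x1 x1 != 0.
  apply: contraTneq om20 => q0; rewrite omE q0 mul0r sub0r mulrN oppr_gt0 -leNgt.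
  by rewrite mulr_ge0// sqr_ge0.
(* The new second vector is the linear part of the field applied to [x1], divided by [om], as in a
   basis where that part is the rotation with speed [om]. *)
have g0 : - (rho0 * q x1 x1) / om != 0 by rewrite mulf_neq0 ?invr_neq0// oppr_eq0 mulf_neq0.
have [fr' dE] := frame_change n2 (rho0 * q x1 x2 / om) fr g0.
have qDl u v w : q (u + v) w = q u w + q v w by rewrite /q mulmxDl ipDl.
have qZl (k : R) u w : q (k *: u) w = k * q u w by rewrite /q -scalemxAl ipZl.
have qDr u v w : q w (u + v) = q w u + q w v by rewrite /q ipDr.
have qZr (k : R) u w : q w (k *: u) = k * q w u by rewrite /q ipZr.
do 4 eexists; exists (q x1 x1); split; first exact: fr'.
split=> //; last first.
- rewrite dE mulrA -/rho0; move: (q x1 x1) (rho0) q0 r0 => a r a0 r0.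
  by field; rewrite omN0 r0 a0.
- rewrite qDr !qZr; move: (q x1 x1) (q x1 x2) (rho0) => a b r.
  by field; rewrite omN0.
- rewrite qDr !qZr !qDl !qZl (q_sym x2 x1).
  move: omE; move: (q x1 x1) (q x1 x2) (q x2 x2) (rho0) => a b c r omE.
  transitivity (a * (r ^+ 2 * (a * c - b ^+ 2)) / om ^+ 2); first by field.
  by rewrite -omE mulfK// expf_neq0.
Qed.

End leaf.

Lemma chart_field_sub (R : realType) n (X : 'rV[R]_n -> 'rV[R]_n) (S T : set 'rV[R]_n)
    xe l1 l2 a b c d : S `<=` T -> chart_field X T xe l1 l2 a b c d ->
  chart_field X S xe l1 l2 a b c d.
Proof. by move=> ST H e /H[r r0 rH]; exists r => // x /ST; exact: rH. Qed.

Lemma chart_level_sub (R : realType) n (f : 'rV[R]_n -> R) (S T : set 'rV[R]_n) xe l1 l2 :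
  S `<=` T -> chart_level f T xe l1 l2 -> chart_level f S xe l1 l2.
Proof. by move=> ST H e /H[r r0 rH]; exists r => // x y /ST Tx /ST; exact: rH. Qed.

Theorem theorem6p1 (R : realType) (n : nat) (Omega : set 'rV[R]_n)
  (nu : 'rV[R]_n -> R) (C : nat -> 'rV[R]_n -> R) (xe : 'rV[R]_n)
  (lam : 'rV[R]_(n - 2)) :
  (2 <= n)%N ->
  open Omega ->
  smooth_on Omega nu ->
  (forall k, (k < n - 1)%N -> smooth_on Omega (C k)) ->
  equil_set Omega nu C xe ->
  grad (C (n - 2)%N) xe + \sum_(k < n - 2) lam 0 k *: grad (C k) xe = 0 ->
  hess (Flam C lam) xe \in unitmx ->
  let X := Xfield nu C in
  let S := leaf Omega nu C xe in
  let I := IX nu C lam xe in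
  (* (a) *)
  (exists b : 'I_2 -> 'rV[R]_n, tangent_basis S xe b /\
     exists M : 'M[R]_2, linearization_matrix X S xe b M /\
       char_poly M = 'X^2 + I%:P) /\
  (* (b) *)
  (I < 0 -> ~ lyap_stable X S xe) /\
  (* (c) *)
  (0 < I -> lyap_stable X S xe) /\
  (* (d) *)
  (0 < I -> exists2 e0 : R, 0 < e0 &
     exists (g : R -> set 'rV[R]_n) (T : R -> R),
       (forall e, 0 < e <= e0 -> periodic_orbit X S (g e) (T e)) /\
       (forall eta : R, 0 < eta -> exists2 d : R, 0 < d &
          forall e, 0 < e <= e0 -> e < d -> forall y, g e y -> `|y - xe| < eta) /\
       (T e @[e --> 0^'+] --> 2 * pi / Num.sqrt I) /\
       (xe |` \bigcup_(e in [set e | 0 < e < e0]) g e) =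
         connected_component (S `\` g e0) xe).
Proof.
move=> n2 oO nus Cs [Oxe [reg _]] lamE Au X S I.
pose dC := fun (x : 'rV[R]_n) k => grad (C k) x.
have L_xe : leaf_level Omega nu C xe xe by [].
have SL : S `<=` leaf_level Omega nu C xe by exact: connected_component_sub.
have Sxe : S xe by exact: connected_component_refl.
have charts l1 l2 x1 x2 : frame (dC xe) l1 l2 x1 x2 ->
    chart_strict S xe l1 l2 x1 x2 /\ chart_onto S xe l1 l2.
  move=> fr; have H := leaf_strict nu n2 oO Cs Oxe fr; split.
    exact: chart_strict_sub SL H.
  exact: chart_onto_component L_xe H (leaf_onto n2 oO nus Cs Oxe reg fr).
have [l1 [l2 [x1 [x2 fr]]]] : exists l1 l2 x1 x2, frame (dC xe) l1 l2 x1 x2.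
  apply: frame_exists => //; have [_] := reg; congr (is_true (row_free _)).
  by apply/matrixP => i j; rewrite !mxE.
have [SS SO] := charts _ _ _ _ fr.
have SF := chart_field_sub SL (leaf_field n2 oO nus Cs Oxe reg lamE fr).
have IE := IX_frame nu n2 oO Cs Oxe fr Au; rewrite -/I in IE.
case: (fr) => _ _ [l11 l12] [l21 l22].
move: SF IE; set r := nu xe * _; cbv beta.
set q11 := ip (x1 *m _) x1; set q12 := ip (x1 *m _) x2; set q22 := ip (x2 *m _) x2 => SF IE.
(* The square of the trace-free linear part is [- I] times the identity; this number enters both the
   characteristic polynomial and the saddle criterion. *)
have dE : (r * q12) ^+ 2 + r * q22 * - (r * q11) = - I.
  by rewrite IE; ring.
split.
  exists (pair_basis x1 x2); split; first exact: (chart_tangent_basis Sxe SS SO l11 l12 l21 l22).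
  eexists; split; first exact: (chart_linearization Sxe SS SF l11 l12 l21 l22).
  by rewrite char_poly_mx2 dE opprK.
split=> [I0|].
  by apply: (saddle_unstable Sxe SS SO SF); rewrite dE oppr_gt0.
have [I0|] := ltP 0 I; last by [].
have om0 : 0 < Num.sqrt I by rewrite sqrtr_gt0.
have omE : Num.sqrt I ^+ 2 = r ^+ 2 * (q11 * q22 - q12 ^+ 2) by rewrite sqr_sqrtr// ltW.
have [k1 [k2 [y1 [y2 [al [fr' [al0 q1 q2 q3 rE]]]]]]] :=
  leaf_isotropic_frame n2 oO Cs Oxe fr om0 omE.
have [SS' SO'] := charts _ _ _ _ fr'.
have SF' := chart_field_sub SL (leaf_field n2 oO nus Cs Oxe reg lamE fr').
have {}SF' : chart_field X S xe k1 k2 0 (- Num.sqrt I) (Num.sqrt I) 0.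
  by move: SF'; rewrite q1 q2 q3 rE mulr0 oppr0 divfK// opprK.
have f0 : (Flam C lam xe - Flam C lam xe) / al = 0 by rewrite subrr mul0r.
have [st per] := center_chart om0 Sxe (Xfield_xe nu n2 Cs Oxe lamE) f0 SS' SO' SF'
  (chart_level_sub SL (leaf_level_chart n2 oO Cs Oxe reg lamE fr' al0 q1 q2 q3))
  (leaf_integral lam n2 oO nus Cs Oxe al0 SL).
by split=> _.
Qed.
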